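(* Let $\rho,\gamma,L\ge 0$ and $\delta,\sigma>0$. Let $\varphi:\mathbb{R}^d\to(-\infty,+\infty]$ be a proper, lower semicontinuous, $(\rho,\gamma)$-semiconvex function such that $|\varphi(x)-\varphi(y)|\le L+L|x-y|$ for all $x,y\in\mathrm{Dom}(\varphi)$, and such that $\mathrm{Dom}(\varphi)$ satisfies the $(\gamma,\delta,\sigma)$-shifted uniform interior ball condition. Let $x_0\in\overline{\mathrm{Dom}(\varphi)}$ and let $m:\mathbb{R}_+\to\mathbb{R}^d$ be continuous with $m(0)=0$. Let $f:\mathbb{R}_+\times\mathbb{R}^d\to\mathbb{R}^d$ be such that $f(\cdot,x)$ is measurable for every $x\in\mathbb{R}^d$, and suppose there is $\mu\in L^1_{loc}(\mathbb{R}_+)$ such that for a.e. $t\ge0$: (i) $x\mapsto f(t,x)$ is continuous on $\mathbb{R}^d$; (ii) $\langle x-y,f(t,x)-f(t,y)\rangle\le\mu(t)|x-y|^2$ for all $x,y\in\mathbb{R}^d$; and, moreover, (iii) $\int_0^Tf^\#(s)\,ds<\infty$ for all $T\ge0$, where $f^\#(t)=\sup\{|f(t,x)|:x\in\overline{\mathrm{Dom}(\varphi)}\}$. Then the generalized Skorohod equation $$x(t)+k(t)=x_0+\int_0^tf(s,x(s))\,ds+m(t),\quad t\ge0,\qquad dk(t)\in\partial^-\varphi(x(t))(dt)$$ has a unique solution $(x,k)$.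
   Context: Here $|\cdot|$ and $\langle\cdot,\cdot\rangle$ are the Euclidean norm and inner product, $\overline B(x,r)$ is the closed ball, $\mathrm{Bd}(E)$ is the boundary of $E$. For $\varphi:\mathbb{R}^d\to(-\infty,+\infty]$, $\mathrm{Dom}(\varphi)=\{v:\varphi(v)<+\infty\}$; $\varphi$ is proper if $\mathrm{Dom}(\varphi)$ is nonempty and has no isolated points. The Fréchet subdifferential is $\partial^-\varphi(x)=\emptyset$ if $x\notin\mathrm{Dom}(\varphi)$, and for $x\in\mathrm{Dom}(\varphi)$ $$\partial^-\varphi(x)=\Big\{\hat x\in\mathbb{R}^d:\liminf_{y\to x}\frac{\varphi(y)-\varphi(x)-\langle\hat x,y-x\rangle}{|y-x|}\ge 0\Big\}.$$ A nonempty closed set $E\subset\mathbb{R}^d$ is $\gamma$-semiconvex ($\gamma\ge0$) if for every $x\in\mathrm{Bd}(E)$ there is $\hat x\in\mathbb{R}^d\setminus\{0\}$ with $\langle\hat x,y-x\rangle\le\gamma|\hat x||y-x|^2$ for all $y\in E$. The function $\varphi$ is $(\rho,\gamma)$-semiconvex ($\rho,\gamma\ge0$) if: $\overline{\mathrm{Dom}(\varphi)}$ is $\gamma$-semiconvex; $\partial^-\varphi(x)\ne\emptyset$ for some $x$; and for all $x$, all $\hat x\in\partial^-\varphi(x)$ and all $y\in\mathbb{R}^d$, $\langle\hat x,y-x\rangle+\varphi(x)\le\varphi(y)+(\rho+\gamma|\hat x|)|y-x|^2$. A set $E$ satisfies the $(\gamma,\delta,\sigma)$-shifted uniform interior ball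 condition if for every $y\in E$ there exist $\lambda_y\in(0,1]$ and $v_y\in\mathbb{R}^d$, $|v_y|\le1$, with $\lambda_y-(|v_y|+\lambda_y)^2\gamma\ge\sigma$ and $\overline B(x+v_y,\lambda_y)\subset E$ for all $x\in E\cap\overline B(y,\delta)$. $\mathrm{Var}_t(k)$ denotes the total variation of $k$ on $[0,t]$; $BV_{loc}(\mathbb{R}_+;\mathbb{R}^d)$ is the set of functions with $\mathrm{Var}_t(k)<\infty$ for all $t$. The notation $dk(t)\in\partial^-\varphi(x(t))(dt)$ means that $x,k:\mathbb{R}_+\to\mathbb{R}^d$ are continuous and: (j) $x(t)\in\overline{\mathrm{Dom}(\varphi)}$ for all $t\ge0$ and $\varphi(x(\cdot))\in L^1_{loc}(\mathbb{R}_+)$; (jj) $k\in BV_{loc}(\mathbb{R}_+;\mathbb{R}^d)$, $k(0)=0$; (jv) for all $0\le s\le t$ and all continuous $y:\mathbb{R}_+\to\mathbb{R}^d$, $$\int_s^t\langle y(r)-x(r),dk(r)\rangle+\int_s^t\varphi(x(r))dr\le\int_s^t\varphi(y(r))dr+\int_s^t|y(r)-x(r)|^2\big(\rho\,dr+\gamma\,d\mathrm{Var}_r(k)\big).$$ A solution of the generalized Skorohod equation is a pair $(x,k)$ satisfying the displayed integral equation for all $t\ge0$ together with $dk(t)\in\partial^-\varphi(x(t))(dt)$ in this sense. *)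

(* Defs.v *)
From HB Require Import structures.
From mathcomp Require Import all_boot all_order all_algebra.
From mathcomp Require Import all_classical all_reals all_analysis.

Set Implicit Arguments.
Unset Strict Implicit.
Unset Printing Implicit Defensive.

Import Order.TTheory GRing.Theory Num.Theory.
Import numFieldTopology.Exports numFieldNormedType.Exports.

Local Open Scope classical_set_scope.
Local Open Scope ring_scope.

(** R^d is ['rV[R]_d].  The norm of the library on matrices is the sup norm,
    hence the Euclidean norm [enorm] below; both induce the topology of
    ['rV[R]_d], so [closure], [interior], [continuous], etc. are the usual ones.
    Functions on R_+ = [0, +oo[ are represented by functions on R whose values
    on negative numbers are irrelevant. *)

Definition dotp (R : realType) (d : nat) (x y : 'rV[R]_d) : R :=
  \sum_(i < d) x ord0 i * y ord0 i.

Definition enorm (R : realType) (d : nat) (x : 'rV[R]_d) : R :=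
  Num.sqrt (dotp x x).

Definition boundary (T : topologicalType) (E : set T) : set T :=
  closure E `\` interior E.

(** ** Semiconvexity *)

(* Functions with values in (-oo, +oo] are [\bar R]-valued functions which are
   separately assumed to avoid -oo. *)
Definition edom (R : realType) (T : Type) (phi : T -> \bar R) : set T :=
  [set v | (phi v < +oo)%E].

Definition proper_fun (R : realType) (T : topologicalType)
    (phi : T -> \bar R) : Prop :=
  edom phi !=set0 /\ isolated (edom phi) = set0.

Definition frechet_subdiff (R : realType) (d : nat) (phi : 'rV[R]_d -> \bar R)
    (x : 'rV[R]_d) : set 'rV[R]_d :=
  [set xh | edom phi x /\
    (0 <= limf_einf (fun y => (phi y - phi x - (dotp xh (y - x))%:E)
                              * ((enorm (y - x))^-1)%:E) x^')%E].

Definition semiconvex_set (R : realType) (d : nat) (gamma : R)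
    (E : set 'rV[R]_d) : Prop :=
  [/\ E !=set0, closed E &
      forall x, boundary E x -> exists2 xh : 'rV[R]_d, xh != 0 &
        forall y, E y ->
          dotp xh (y - x) <= gamma * enorm xh * enorm (y - x) ^+ 2].

Definition semiconvex_fun (R : realType) (d : nat) (rho gamma : R)
    (phi : 'rV[R]_d -> \bar R) : Prop :=
  [/\ semiconvex_set gamma (closure (edom phi)),
      exists x, frechet_subdiff phi x !=set0 &
      forall x xh y, frechet_subdiff phi x xh ->
        ((dotp xh (y - x))%:E + phi x <=
         phi y + ((rho + gamma * enorm xh) * enorm (y - x) ^+ 2)%:E)%E].

Definition shifted_uniform_interior_ball (R : realType) (d : nat)
    (gamma delta sigma : R) (E : set 'rV[R]_d) : Prop :=
  forall y, E y -> exists (lam : R) (v : 'rV[R]_d),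
    [/\ 0 < lam <= 1, enorm v <= 1,
        sigma <= lam - (enorm v + lam) ^+ 2 * gamma &
        forall x, E x -> closed_ball_ (@enorm R d) y delta x ->
          closed_ball_ (@enorm R d) (x + v) lam `<=` E].

(** ** Integration on R_+ *)

Definition L1loc (R : realType) (g : R -> \bar R) : Prop :=
  forall T : R, 0 <= T -> lebesgue_measure.-integrable `[0, T] g.

(* The underlying sigma-algebra of the library on R is the Borel one; here the
   domain carries the complete sigma-algebra of Lebesgue-measurable sets. *)
Definition lebesgue_measurable_fun (R : realType) (D : set R) (g : R -> R)
    : Prop :=
  measurable_fun
    (D : set (caratheodory_type (mu_ext (@wlength R idfun)))) g.

Definition vint (R : realType) (d : nat) (t : R) (g : R -> 'rV[R]_d)
    : 'rV[R]_d :=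
  \row_i \int[lebesgue_measure]_(s in `[0, t]) g s ord0 i.

(* Same as [variation] and [total_variation], with the Euclidean norm. *)
Definition vvariation (R : realType) (d : nat) (a b : R) (k : R -> 'rV[R]_d)
    (s : seq R) : R :=
  let F := k \o nth b (a :: s) in
  \sum_(0 <= n < size s) enorm (F n.+1 - F n).

Definition vtotal_variation (R : realType) (d : nat) (t : R)
    (k : R -> 'rV[R]_d) : \bar R :=
  ereal_sup [set (vvariation 0 t k s)%:E | s in itv_partition 0 t].

Definition BVloc (R : realType) (d : nat) (k : R -> 'rV[R]_d) : Prop :=
  forall t : R, 0 <= t -> (vtotal_variation t k < +oo)%E.

Definition cumul (R : realType) (F : R -> R)
  (h : nondecreasing F /\ right_continuous F) : R -> R := F.
HB.instance Definition _ (R : realType) (F : R -> R)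
    (h : nondecreasing F /\ right_continuous F) :=
  isCumulative.Build R _ R (cumul h) h.1 h.2.

(* The measure [dF] on R_+: F is extended to R by the constant F 0 on the left
   of 0.  The default value [mzero] is not used below: it only occurs when F is
   not nondecreasing and right-continuous on R_+. *)
Definition stieltjes (R : realType) (F : R -> R)
    : {measure set (measurableTypeR R) -> \bar R} :=
  match pselect (nondecreasing (F \o Num.max 0) /\
                 right_continuous (F \o Num.max 0)) with
  | left h => lebesgue_stieltjes_measure (cumul h)
  | right _ => mzero
  end.

(* Integral over ]s, t] of a real function against a function of locally bounded
   variation, through the Jordan decomposition k = pos_tv - neg_tv. It is only
   used for continuous k, for which singletons are null sets, so that including
   the endpoint s or not is immaterial. *)
Definition bv_int (R : realType) (s t : R) (g k : R -> R) : R :=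
  \int[stieltjes (fine \o pos_tv 0 k)]_(r in `]s, t]) g r -
  \int[stieltjes (fine \o neg_tv 0 k)]_(r in `]s, t]) g r.

Definition vbv_int (R : realType) (d : nat) (s t : R) (g k : R -> 'rV[R]_d)
    : R :=
  \sum_(i < d) bv_int s t (fun r => g r ord0 i) (fun r => k r ord0 i).

Definition dVar (R : realType) (d : nat) (k : R -> 'rV[R]_d)
    : {measure set (measurableTypeR R) -> \bar R} :=
  stieltjes (fun t => fine (vtotal_variation t k)).

(** ** The generalized Skorohod equation *)

Definition continuousRplus (R : realType) (d : nat) (x : R -> 'rV[R]_d)
    : Prop :=
  {within `[0, +oo[, continuous x}.

(* dk(t) \in \partial^- phi(x(t)) (dt) *)
Definition driven_by_subdiff (R : realType) (d : nat) (rho gamma : R)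
    (phi : 'rV[R]_d -> \bar R) (x k : R -> 'rV[R]_d) : Prop :=
  [/\ continuousRplus x /\ continuousRplus k,
      (forall t, 0 <= t -> closure (edom phi) (x t)) /\ L1loc (phi \o x),
      BVloc k /\ k 0 = 0 &
      forall (s t : R) (y : R -> 'rV[R]_d), 0 <= s -> s <= t ->
        continuousRplus y ->
        ((vbv_int s t (fun r => (y r - x r)%R) k)%:E
         + \int[lebesgue_measure]_(r in `[s, t]) phi (x r)
         <= \int[lebesgue_measure]_(r in `[s, t]) phi (y r)
            + (rho * (\int[lebesgue_measure]_(r in `[s, t])
                        enorm (y r - x r) ^+ 2)
               + gamma * (\int[dVar k]_(r in `]s, t])
                        enorm (y r - x r) ^+ 2))%R%:E)%E].

Definition skorohod_solution (R : realType) (d : nat) (rho gamma : R)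
    (phi : 'rV[R]_d -> \bar R) (x0 : 'rV[R]_d) (f : R -> 'rV[R]_d -> 'rV[R]_d)
    (m : R -> 'rV[R]_d) (x k : R -> 'rV[R]_d) : Prop :=
  (forall t, 0 <= t -> x t + k t = x0 + vint t (fun s => f s (x s)) + m t)
  /\ driven_by_subdiff rho gamma phi x k.

Definition fsharp (R : realType) (d : nat) (phi : 'rV[R]_d -> \bar R)
    (f : R -> 'rV[R]_d -> 'rV[R]_d) (t : R) : \bar R :=
  ereal_sup [set (enorm (f t x))%:E | x in closure (edom phi)].

(* Main.v *)
Require Import Defs.
From mathcomp Require Import all_boot all_order all_algebra.
From mathcomp Require Import all_classical all_reals all_analysis.
From mathcomp Require Import measurable_realfun ring lra.

Set Implicit Arguments.
Unset Strict Implicit.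
Unset Printing Implicit Defensive.

Import Order.TTheory GRing.Theory Num.Theory.
Import numFieldTopology.Exports numFieldNormedType.Exports.

Local Open Scope classical_set_scope.
Local Open Scope ring_scope.

Local Ltac vring := apply/rowP => ?; rewrite !mxE; ring.

(** Existence rests on the implicit Euler scheme in which X_{j+1} minimizes
    psi + |. - (X_j + dM_j)|^2 / (2h) over the domain, dM_j being the increment of the
    data, and K = M - X is the pushing term.  Testing the subdifferential inequality
    with X + v + lam dK/|dK|, which the interior ball condition keeps in the domain,
    bounds the variation of K by its increment plus O(time); together with a discrete
    Gronwall inequality this yields, uniformly in h, a modulus of continuity for X and a
    bound for the variation of K, hence a locally uniform limit x.

    In the inequality passed to the limit the factor gamma dVar(K_h) is too large, since
    Var(k) may be smaller than lim Var(K_h).  On a short interval it is replaced by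
    gamma |k(b) - k(a)|: minimizing H psi - <k(b) - k(a), .> plus a large quadratic near
    x(a) gives a point where semiconvexity improves the constant of the support
    inequality to the sharp one, at the price of an error eps (H + Var(K_h)) that
    vanishes after summation.

    Uniqueness is Gronwall's inequality for |x - x'|^2 with respect to
    2 rho dt + gamma (dVar(k) + dVar(k')) + nu dt. *)

(** The sharp constant is reachable because semiconvexity speaks of all Fréchet subgradients: a
    support inequality at a point with an arbitrary quadratic constant already makes its slope u a
    subgradient, so the constant drops to rho + gamma |u|, however much variation was spent in
    producing u. The price stays summable because it is an increment of t + E(t), with E a limit of
    the discrete variations. The growth condition allows phi to jump by L between nearby points of
    its domain. Hence single jumps of K are controlled by an energy inequality and not by continuity
    of phi, energies pass to the limit only as lower bounds, and along a test curve phi is compared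
    with its mean over a short interval. Limits at all times are taken along one free ultrafilter.
    Integral inequalities are proved for additive functions of intervals, on cells so short that the
    integrands against dk are almost constant. *)

(** * Euclidean inner product and norm *)

Section Euclid.
Variables (R : realType) (d : nat).
Implicit Types (x y z : 'rV[R]_d).

Lemma dotpC x y : dotp x y = dotp y x.
Proof. by apply: eq_bigr => i _; rewrite mulrC. Qed.
Lemma dotpDl x y z : dotp (x + y) z = dotp x z + dotp y z.
Proof. by rewrite -big_split; apply: eq_bigr => i _; rewrite mxE mulrDl. Qed.
Lemma dotpDr x y z : dotp z (x + y) = dotp z x + dotp z y.
Proof. by rewrite dotpC dotpDl !(dotpC z). Qed.
Lemma dotpZl a x y : dotp (a *: x) y = a * dotp x y.
Proof. by rewrite /dotp big_distrr /=; apply: eq_bigr => i _; rewrite mxE mulrA. Qed.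
Lemma dotpZr a x y : dotp x (a *: y) = a * dotp x y.
Proof. by rewrite dotpC dotpZl dotpC. Qed.
Lemma dotpNl x y : dotp (- x) y = - dotp x y.
Proof. by rewrite -scaleN1r dotpZl mulN1r. Qed.
Lemma dotpNr x y : dotp x (- y) = - dotp x y.
Proof. by rewrite -scaleN1r dotpZr mulN1r. Qed.
Lemma dotp0l x : dotp 0 x = 0.
Proof. by rewrite -(scale0r x) dotpZl mul0r. Qed.
Lemma dotp0r x : dotp x 0 = 0.
Proof. by rewrite dotpC dotp0l. Qed.
Definition dotpE := (dotpDl, dotpDr, dotpNl, dotpNr, dotpZl, dotpZr).

Lemma dotp_suml (I : Type) (r : seq I) (P : pred I) (u : I -> 'rV[R]_d) y :
  dotp (\sum_(i <- r | P i) u i) y = \sum_(i <- r | P i) dotp (u i) y.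
Proof.
by elim/big_rec2 : _ => [|i a b _ <-]; rewrite ?dotp0l// dotpDl.
Qed.

Lemma dotp_ge0 x : 0 <= dotp x x.
Proof. by apply: sumr_ge0 => i _; rewrite -expr2 sqr_ge0. Qed.
Lemma enorm_ge0 x : 0 <= enorm x.
Proof. exact: sqrtr_ge0. Qed.
Lemma enorm_sqr x : enorm x ^+ 2 = dotp x x.
Proof. by rewrite sqr_sqrtr// dotp_ge0. Qed.
Lemma enorm0 : enorm (0 : 'rV[R]_d) = 0.
Proof. by rewrite /enorm dotp0l sqrtr0. Qed.
Lemma enormN x : enorm (- x) = enorm x.
Proof. by rewrite /enorm dotpNl dotpNr opprK. Qed.
Lemma enorm_distC x y : enorm (x - y) = enorm (y - x).
Proof. by rewrite -enormN opprB. Qed.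
Lemma enormZ a x : enorm (a *: x) = `|a| * enorm x.
Proof.
by rewrite /enorm dotpZl dotpZr mulrA -expr2 sqrtrM ?sqr_ge0// sqrtr_sqr.
Qed.
Lemma enorm_eq0 x : (enorm x == 0) = (x == 0).
Proof.
apply/idP/idP => [|/eqP->]; last by rewrite enorm0.
move=> /eqP x0; have := enorm_sqr x; rewrite x0 expr0n/= => /esym/eqP.
rewrite psumr_eq0 => [/allP x0i|i _]; last by rewrite -expr2 sqr_ge0.
apply/eqP/rowP => i; rewrite mxE.
by have := x0i i; rewrite mem_index_enum/= mulf_eq0 orbb => /(_ isT)/eqP.
Qed.

Lemma cauchy_schwarz x y : `|dotp x y| <= enorm x * enorm y.
Proof.
have [->|y0] := eqVneq y 0; first by rewrite dotp0r normr0 enorm0 mulr0.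
have ny : 0 < enorm y by rewrite lt_neqAle eq_sym enorm_eq0 y0 enorm_ge0.
rewrite -(@ler_pXn2r _ 2)// ?nnegrE ?mulr_ge0 ?enorm_ge0//.
rewrite real_normK ?num_real// exprMn !enorm_sqr.
have := dotp_ge0 (dotp y y *: x - dotp x y *: y).
rewrite !dotpE (dotpC y x).
have yy : 0 < dotp y y by rewrite -enorm_sqr exprn_gt0.
set a := dotp x x; set b := dotp x y; set c := dotp y y.
move=> h; have : 0 <= c * (a * c - b ^+ 2) by lra.
by rewrite pmulr_rge0// subr_ge0.
Qed.

Lemma dotp_le x y : dotp x y <= enorm x * enorm y.
Proof. exact: le_trans (ler_norm _) (cauchy_schwarz _ _). Qed.

Lemma dotp_ge x y : - (enorm x * enorm y) <= dotp x y.
Proof. by have := cauchy_schwarz x y; rewrite ler_norml => /andP[]. Qed.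

Lemma enormD x y : enorm (x + y) <= enorm x + enorm y.
Proof.
rewrite -(@ler_pXn2r _ 2)// ?nnegrE ?addr_ge0 ?enorm_ge0//.
rewrite enorm_sqr sqrrD !enorm_sqr !dotpE (dotpC y x).
have := dotp_le x y; lra.
Qed.

Lemma enormB x y : enorm (x - y) <= enorm x + enorm y.
Proof. by rewrite -(enormN y) enormD. Qed.

Lemma enorm_dist_tri z x y : enorm (x - y) <= enorm (x - z) + enorm (z - y).
Proof. by rewrite -[x - y](subrKA z) enormD. Qed.

Lemma enorm_sub_ge x y : enorm x - enorm y <= enorm (x - y).
Proof. by rewrite lerBlDr -{1}(subrK y x) enormD. Qed.

Lemma enorm_sum (I : Type) (r : seq I) (P : pred I) (u : I -> 'rV[R]_d) :
  enorm (\sum_(i <- r | P i) u i) <= \sum_(i <- r | P i) enorm (u i).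
Proof.
elim/big_rec2 : _ => [|i a b _ h]; first by rewrite enorm0.
by apply: le_trans (enormD _ _) _; rewrite lerD2l.
Qed.

Lemma coord_le_enorm x i : `|x ord0 i| <= enorm x.
Proof.
rewrite -sqrtr_sqr ler_wsqrtr// /dotp (bigD1 i)//= expr2 lerDl.
by apply: sumr_ge0 => j _; rewrite -expr2 sqr_ge0.
Qed.

Lemma enorm_le_sum x : enorm x <= \sum_(i < d) `|x ord0 i|.
Proof.
have -> : x = \sum_(i < d) x ord0 i *: delta_mx ord0 i by exact: row_sum_delta.
apply: le_trans (enorm_sum _ _ _) _; rewrite -row_sum_delta.
apply: ler_sum => i _; rewrite enormZ ler_piMr//.
rewrite /enorm /dotp (bigD1 i)//= big1 ?addr0 => [|j ji].
  by rewrite !mxE !eqxx mulr1 sqrtr1.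
by rewrite !mxE !(negbTE ji) andbF mul0r.
Qed.

End Euclid.

(** * Euclidean neighbourhoods, limits along ultrafilters, uniform continuity *)

Lemma invS_small (R : realType) (e : R) : 0 < e ->
  exists N, forall n, (N <= n)%N -> n.+1%:R^-1 < e.
Proof. by move=> e0; have [N _ hN] := near_infty_natSinv_lt (PosNum e0); exists N. Qed.

Section Topology.
Variables (R : realType) (d : nat).

Lemma nbhs_enormP (x : 'rV[R]_d) (A : set 'rV[R]_d) :
  nbhs x A <-> exists2 e : R, 0 < e & forall y, enorm (y - x) < e -> A y.
Proof.
split.
  move=> /nbhs_ballP[e /= e0 xA]; exists e => // y yx.
  apply: xA; split => // i j; rewrite ord1 /ball/= distrC; apply: le_lt_trans yx.
  by have := coord_le_enorm (y - x) j; rewrite !mxE.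
(* Dividing by d + 1 rather than d covers d = 0 and makes the sum of d coordinate bounds strictly
   smaller than e. *)
move=> [e e0 xA]; apply/nbhs_ballP; exists (e / d.+1%:R) => [|y xy] /=.
  by rewrite divr_gt0// ltr0n.
apply: xA; apply: le_lt_trans (enorm_le_sum _) _.
apply: (@le_lt_trans _ _ (\sum_(i < d) (e / d.+1%:R))).
  apply: ler_sum => i _; rewrite !mxE distrC ltW//.
  by have [_ /(_ ord0 i)] := xy.
rewrite sumr_const card_ord -[_ *+ d]mulr_natr mulrAC ltr_pdivrMr ?ltr0n//.
by rewrite ltr_pM2l// ltr_nat.
Qed.

Lemma closure_enormP (E : set 'rV[R]_d) (x : 'rV[R]_d) :
  closure E x <-> forall e : R, 0 < e -> exists2 y, E y & enorm (y - x) < e.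
Proof.
split => [clx e e0|h B /nbhs_enormP[e e0 eB]].
  have : nbhs x [set y | enorm (y - x) < e] by apply/nbhs_enormP; exists e.
  by move=> /clx[y [Ey yx]]; exists y.
by have [y Ey yx] := h e e0; exists y; split => //; exact: eB.
Qed.

Lemma continuousRplusP (x : R -> 'rV[R]_d) : continuousRplus x <->
  forall t : R, 0 <= t -> forall e : R, 0 < e -> exists2 r : R, 0 < r &
    forall s : R, 0 <= s -> `|s - t| < r -> enorm (x s - x t) < e.
Proof.
split => [cx t t0 e e0|h].
  have tI : [set` `[0, +oo[] t by rewrite /= in_itv/= t0.
  have := cx t; rewrite /continuous_at.
  have -> : x @ nbhs (t : subspace `[0, +oo[) = x @ within `[0, +oo[ (nbhs t).
    by rewrite nbhs_subspace_in.
  move=> /(_ [set y | enorm (y - x t) < e]) H.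
  have : (within `[0, +oo[ (nbhs t)) (x @^-1` [set y | enorm (y - x t) < e]).
    by apply: H; apply/nbhs_enormP; exists e.
  rewrite /within => /nbhs_ballP[r /= r0 tr]; exists r => // s s0 st.
  by apply: tr; rewrite /= ?in_itv/= ?s0// /ball/= distrC.
apply/subspace_continuousP => t; rewrite /= in_itv/= andbT => t0 A.
move=> /nbhs_enormP[e e0 eA]; have [r r0 tr] := h t t0 e e0.
apply/(nbhs_ballP t); exists r => // s /= ts.
by rewrite in_itv/= andbT => s0; apply: eA; apply: tr => //; rewrite distrC.
Qed.

(** A free ultrafilter replaces the extraction of subsequences: every bounded sequence converges
    along it, so limits exist for all times at once without a diagonal argument. *)
Lemma ultra_oo : exists2 U : set_system nat, UltraFilter U &
  forall N, U [set n | (N <= n)%N].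
Proof.
have [U [UF ooU]] := ultraFilterLemma (@eventually_filter).
by exists U => // N; apply: ooU; exact: nbhs_infty_ge.
Qed.

(** Compactness of [-C, C] gives a cluster point, and for an ultrafilter a cluster point is a limit:
    otherwise the complement of one of its balls would belong to the filter. *)
Lemma ultra_real (U : set_system nat) (u : nat -> R) (C : R) :
  UltraFilter U -> U [set n | `|u n| <= C] ->
  exists l, forall e : R, 0 < e -> U [set n | `|u n - l| < e].
Proof.
move=> UU uC.
have [//|l [_ ul]] := @segment_compact R (- C) C (u @ U) _ _.
  by apply: (@filterS _ U _ _ _ _ uC) => n /=; rewrite in_itv/= -ler_norml.
exists l => e e0.
have [//|h] := in_ultra_setVsetC [set n | `|u n - l| < e] UU.
have := ul _ (ball l e) (_ : (u @ U) [set r | ~ (`|r - l| < e)]) (nbhsx_ballx _ _ e0).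
case.
  exact: h.
by move=> z [/= + lz]; rewrite distrC.
Qed.

Lemma ultra_row (U : set_system nat) (u : nat -> 'rV[R]_d) (C : R) :
  UltraFilter U -> U [set n | enorm (u n) <= C] ->
  exists l, forall e : R, 0 < e -> U [set n | enorm (u n - l) < e].
Proof.
move=> UU uC.
have h i : exists l, forall e : R, 0 < e -> U [set n | `|u n ord0 i - l| < e].
  apply: (@ultra_real _ _ C) => //; apply: filterS uC => n /=.
  exact: le_trans (coord_le_enorm _ _).
have [l hl] := choice h.
exists (\row_i l i) => e e0.
have e1 : 0 < e / d.+1%:R by rewrite divr_gt0// ltr0n.
have : U [set n | forall i : 'I_d, `|u n ord0 i - l i| < e / d.+1%:R].
  by apply: filter_forall => i; exact: hl.
apply: filterS => n /= hn; apply: le_lt_trans (enorm_le_sum _) _.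
apply: (@le_lt_trans _ _ (\sum_(i < d) (e / d.+1%:R))).
  by apply: ler_sum => i _; rewrite !mxE ltW.
rewrite sumr_const card_ord -[_ *+ d]mulr_natr mulrAC ltr_pdivrMr ?ltr0n//.
by rewrite ltr_pM2l// ltr_nat.
Qed.

(* Stated for an arbitrary pseudometric so that it serves both for curves and
   for real functions. *)
Lemma segment_unif_continuous (dist : R -> R -> R) (T : R) :
  (forall s t, dist s t = dist t s) ->
  (forall r s t, dist r t <= dist r s + dist s t) ->
  (forall t : R, 0 <= t <= T -> forall e : R, 0 < e -> exists2 r : R, 0 < r &
     forall s : R, 0 <= s <= T -> `|s - t| < r -> dist s t < e) ->
  forall e : R, 0 < e -> exists2 r : R, 0 < r &
    forall s t : R, 0 <= s <= T -> 0 <= t <= T -> `|s - t| <= r -> dist s t < e.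
Proof.
move=> dC dT dc e e0; apply: contrapT => H.
have bad n : exists st : R * R, [/\ 0 <= st.1 <= T, 0 <= st.2 <= T,
    `|st.1 - st.2| <= n.+1%:R^-1 & e <= dist st.1 st.2].
  apply: contrapT => Hn; apply: H; exists n.+1%:R^-1 => [|s t sT tT st].
    by rewrite invr_gt0 ltr0n.
  by rewrite ltNge; apply/negP => est; apply: Hn; exists (s, t).
have [st hst] := choice bad.
have [U UU Uoo] := ultra_oo.
have [t ht] : exists l, forall e : R, 0 < e -> U [set n | `|(st n).1 - l| < e].
  apply: (@ultra_real U (fun n => (st n).1) T) => //.
  apply: filterS filterT => n _ /=.
  by have [/andP[s0 sT] _ _ _] := hst n; rewrite ger0_norm.
have tT : 0 <= t <= T.
  apply/andP; split; rewrite leNgt; apply/negP => h.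
    have : U [set n | `|(st n).1 - t| < - t] by apply: ht; rewrite oppr_gt0.
    move=> /filter_ex[n /=]; have [/andP[s0 _] _ _ _] := hst n.
    by rewrite ltr_norml; lra.
  have : U [set n | `|(st n).1 - t| < t - T] by apply: ht; rewrite subr_gt0.
  move=> /filter_ex[n /=]; have [/andP[_ s0] _ _ _] := hst n.
  by rewrite ltr_norml; lra.
have [r r0 hr] := dc t tT (e / 2) (divr_gt0 e0 (ltr0Sn _ 1)).
have r2 : 0 < r / 2 by rewrite divr_gt0.
have [N hN] := invS_small r2.
have [n [/= nt Nn]] := filter_ex (filterI (ht _ r2) (Uoo N)).
have [s1 s2 s12' est] := hst n.
have nN := hN n Nn.
have s12 : `|(st n).1 - (st n).2| < r / 2 := le_lt_trans s12' nN.
have h1 : dist (st n).1 t < e / 2 by apply: hr => //; apply: lt_trans nt _; lra.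
have h2 : dist (st n).2 t < e / 2.
  apply: hr => //; have : `|(st n).2 - t| <= `|(st n).1 - (st n).2| + `|(st n).1 - t|.
    by rewrite (distrC (st n).1 (st n).2) ler_distD.
  lra.
have := dT (st n).1 t (st n).2; rewrite (dC t); lra.
Qed.

End Topology.

(** * From the extended-valued phi to a real function psi on a closed domain D *)

(** The properties of phi on which the construction rests, free of extended reals and of
    subdifferentials. In [psi_selfimprove] the constant [c] is arbitrary and does not appear in the
    conclusion. *)
Record skorohod_data (R : realType) (d : nat) (rho gamma L delta sigma : R)
    (D : set 'rV[R]_d) (psi : 'rV[R]_d -> R) : Prop := {
  rho_ge0 : 0 <= rho;
  gamma_ge0 : 0 <= gamma;
  L_ge0 : 0 <= L;
  delta_gt0 : 0 < delta;
  sigma_gt0 : 0 < sigma;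
  dom_closed : forall x,
    (forall e : R, 0 < e -> exists2 y, D y & enorm (y - x) < e) -> D x;
  psi_lsc : forall x, D x -> forall e : R, 0 < e -> exists2 r : R, 0 < r &
    forall y, D y -> enorm (y - x) < r -> psi x - e < psi y;
  psi_growth : forall x y, D x -> D y ->
    `|psi x - psi y| <= L + L * enorm (x - y);
  psi_selfimprove : forall z u (c : R), D z ->
    (forall y, D y -> dotp u (y - z) + psi z <= psi y + c * enorm (y - z) ^+ 2) ->
    forall y, D y -> dotp u (y - z) + psi z <=
      psi y + (rho + gamma * enorm u) * enorm (y - z) ^+ 2;
  dom_ball : forall y, D y -> exists (lam : R) (v : 'rV[R]_d),
    [/\ 0 < lam <= 1, enorm v <= 1,
        sigma <= lam - (enorm v + lam) ^+ 2 * gamma &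
        forall x w, D x -> enorm (x - y) <= delta -> enorm w <= lam ->
          D (x + v + w)] }.

Section SemiconvexData.
Variables (R : realType) (d : nat) (rho gamma L delta sigma : R).
Variable phi : 'rV[R]_d -> \bar R.
Hypotheses (phiNy : forall v, phi v != -oo%E) (phi_lsc : lower_semicontinuous phi).
Hypothesis phi_gr : forall x y, edom phi x -> edom phi y ->
    (`|phi x - phi y| <= (L + L * enorm (x - y))%:E)%E.
Let psi := fine \o phi.

Lemma edom_fineK x : edom phi x -> phi x = (psi x)%:E.
Proof.
by move=> Dx; rewrite /psi/= fineK// fin_numE phiNy/= -ltey.
Qed.

Lemma edom_growth x y : edom phi x -> edom phi y ->
  `|psi x - psi y| <= L + L * enorm (x - y).
Proof.
move=> Dx Dy; have := phi_gr Dx Dy.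
by rewrite (edom_fineK Dx) (edom_fineK Dy) -EFinB/= lee_fin.
Qed.

(** At a limit point with phi = +oo, lower semicontinuity would make phi exceed every constant
    nearby, whereas the growth bound keeps it below a fixed constant on the domain near that
    point. *)
Lemma edom_closed : 0 <= L -> forall x,
  (forall e : R, 0 < e -> exists2 y, edom phi y & enorm (y - x) < e) ->
  edom phi x.
Proof.
move=> L0 x hx; rewrite /edom/= ltNge; apply/negP => phix.
have [y0 Dy0 y0x] := hx 1 ltr01.
have : ((psi y0 + L + L * 2)%:E < phi x)%E.
  by apply: lt_le_trans phix; rewrite ltey.
move=> /phi_lsc[V /nbhs_enormP[e e0 eV] hV].
have e1 : 0 < Num.min e 1 by rewrite lt_min e0 ltr01.
have [y Dy] := hx _ e1; rewrite lt_min => /andP[yxe yx1].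
have := hV y (eV y yxe); rewrite (edom_fineK Dy) lte_fin.
have := edom_growth Dy Dy0; rewrite ler_norml => /andP[_ h1].
have h2 : enorm (y - y0) <= 2.
  by have := enorm_dist_tri x y y0; rewrite (enorm_distC x); lra.
have := ler_wpM2l L0 h2; lra.
Qed.

Lemma closure_edom : 0 <= L -> closure (edom phi) = edom phi.
Proof.
move=> L0; apply/seteqP; split; last exact: subset_closure.
by move=> x /closure_enormP; exact: edom_closed.
Qed.

(** A quadratic error is o(|y - z|), so it does not affect the lower limit that defines the Fréchet
    subdifferential. *)
Lemma frechet_quadratic z u (c : R) : edom phi z ->
  (forall y, edom phi y ->
    dotp u (y - z) + psi z <= psi y + c * enorm (y - z) ^+ 2) ->
  frechet_subdiff phi z u.
Proof.
move=> Dz hy; split=> //; rewrite limf_einfE; apply/lee_subgt0Pr => /= e e0.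
have c1 : 0 < `|c| + 1 by rewrite ltr_wpDl.
(* On this punctured ball the quotient is at least -c |y - z|, hence at least -e; outside the domain
   it is +oo. *)
apply: (@le_trans _ _ (ereal_inf ((fun y => (phi y - phi z - (dotp u (y - z))%:E)
    * ((enorm (y - z))^-1)%:E)%E @`
    [set y | y != z /\ enorm (y - z) < e / (`|c| + 1)]))).
  apply: le_ereal_inf_tmp => _ [y /= [yz yze] <-].
  rewrite add0e.
  have n0 : 0 < enorm (y - z).
    by rewrite lt_neqAle enorm_ge0 eq_sym enorm_eq0 subr_eq0 yz.
  have [Dy|] := boolP (phi y < +oo)%E; last first.
    rewrite -leNgt leye_eq => /eqP ->.
    by rewrite (edom_fineK Dz) /= gt0_mulye ?lte_fin ?invr_gt0// leey.
  rewrite (edom_fineK Dz) (edom_fineK Dy) -!EFinB -EFinM lee_fin.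
  rewrite ler_pdivlMr//.
  have := hy y Dy; have := ler_norm c.
  have : (`|c| + 1) * enorm (y - z) <= e.
    by rewrite mulrC -ler_pdivlMr// ltW.
  set n := enorm _ in n0 *; set k := `|c| => h1 h2 h3.
  have h4 := ler_wpM2r (ltW n0) h1.
  have h5 : c * n ^+ 2 <= (k + 1) * n * n.
    by rewrite -mulrA -expr2 ler_wpM2r ?sqr_ge0//; lra.
  lra.
apply: ereal_sup_ubound => /=.
exists [set y | y != z /\ enorm (y - z) < e / (`|c| + 1)] => //.
rewrite /dnbhs/within/=; apply/nbhs_enormP; exists (e / (`|c| + 1)).
  by rewrite divr_gt0.
by move=> y yz.
Qed.

Lemma semiconvex_selfimprove z u (c : R) :
  semiconvex_fun rho gamma phi -> edom phi z ->
  (forall y, edom phi y ->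
    dotp u (y - z) + psi z <= psi y + c * enorm (y - z) ^+ 2) ->
  forall y, edom phi y -> dotp u (y - z) + psi z <=
      psi y + (rho + gamma * enorm u) * enorm (y - z) ^+ 2.
Proof.
move=> [_ _ sc] Dz hz y Dy.
have := sc _ _ y (frechet_quadratic Dz hz).
by rewrite (edom_fineK Dz) (edom_fineK Dy) -!EFinD lee_fin.
Qed.

Lemma skorohod_data_intro : 0 <= rho -> 0 <= gamma -> 0 <= L -> 0 < delta ->
  0 < sigma -> semiconvex_fun rho gamma phi ->
  shifted_uniform_interior_ball gamma delta sigma (edom phi) ->
  skorohod_data rho gamma L delta sigma (edom phi) psi.
Proof.
move=> r0 g0 L0 d0 s0 sc sb; split => //.
- exact: edom_closed.
- move=> x Dx e e0; have : ((psi x - e)%:E < phi x)%E.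
    by rewrite (edom_fineK Dx) lte_fin ltrBlDr ltrDl.
  move=> /phi_lsc[V /nbhs_enormP[r r0' rV] hV]; exists r => // y Dy yx.
  by have := hV y (rV y yx); rewrite (edom_fineK Dy) lte_fin.
- by move=> x y Dx Dy; exact: edom_growth.
- by move=> z u c Dz hz y Dy; exact: semiconvex_selfimprove Dz hz _ Dy.
- move=> y /sb[lam [v [lam1 v1 sl h]]]; exists lam, v; split => // x w Dx xy wl.
  apply: (h x) => //; first by rewrite /closed_ball_/= enorm_distC.
  by rewrite /closed_ball_/= opprD addrA subrr sub0r enormN.
Qed.

End SemiconvexData.

(** * Proximal minimization and the self-improved support inequality *)

Section Minimizers.
Variables (R : realType) (d : nat) (rho gamma L delta sigma : R).
Variables (D : set 'rV[R]_d) (psi : 'rV[R]_d -> R).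
Hypothesis S : skorohod_data rho gamma L delta sigma D psi.

Lemma psi_lower x y : D x -> D y -> psi x - L - L * enorm (x - y) <= psi y.
Proof. by move=> Dx Dy; have := psi_growth S Dx Dy; rewrite ler_norml => /andP[]; lra. Qed.

(** By the growth bound psi - <u, .> decreases at most linearly, so the quadratic term makes the
    functional coercive. A minimizing sequence is then bounded, its ultrafilter limit lies in the
    closed set D, and lower semicontinuity makes it a minimizer. *)
Lemma minimizer_exists x1 (u p : 'rV[R]_d) (c : R) : D x1 -> 0 < c ->
  exists2 z, D z & forall y, D y ->
   psi z - dotp u z + c * enorm (z - p) ^+ 2 <=
   psi y - dotp u y + c * enorm (y - p) ^+ 2.
Proof.
move=> Dx1 c0; have L0 := L_ge0 S.
pose g y := psi y - dotp u y + c * enorm (y - p) ^+ 2.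
pose B := L + enorm u.
have B0 : 0 <= B by rewrite addr_ge0// enorm_ge0.
pose A := psi x1 - L - L * enorm (p - x1) - enorm u * enorm p.
have glow y : D y -> A - B * enorm (y - p) + c * enorm (y - p) ^+ 2 <= g y.
  move=> Dy; rewrite lerD2r.
  have h1 := psi_lower Dx1 Dy; have h2 := dotp_le u y.
  have h3 : enorm y <= enorm (y - p) + enorm p by rewrite -{1}(subrK p y) enormD.
  have h4 : enorm (x1 - y) <= enorm (y - p) + enorm (p - x1).
    by rewrite enorm_distC enorm_dist_tri.
  have h5 := ler_wpM2l L0 h4; have h6 := ler_wpM2l (enorm_ge0 u) h3.
  rewrite /A /B; lra.
pose I := inf [set g y | y in D].
have hI : has_inf [set g y | y in D].
  split; first by exists (g x1), x1.
  exists (A - B ^+ 2 / c) => _ [y Dy <-]; apply: le_trans (glow y Dy).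
  set r := enorm _; have := sqr_ge0 (c * r - B / 2).
  have -> : A - B * r + c * r ^+ 2 = A - (B * (c * r) - (c * r) ^+ 2) / c.
    by field; rewrite gt_eqF.
  move=> h; rewrite lerD2l lerN2 ler_pM2r ?invr_gt0//.
  by have := sqr_ge0 B; lra.
have seqh n : exists y, D y /\ g y < I + n.+1%:R^-1.
  have n0 : (0 : R) < n.+1%:R^-1 by rewrite invr_gt0 ltr0n.
  by have [_ [y Dy <-] hy] := inf_adherent n0 hI; exists y.
have [y_ /all_and2[Dy gy]] := choice seqh.
have [U UU Uoo] := ultra_oo.
pose K : R := `|I + 1 - A|.
have yb n : enorm (y_ n - p) <= 1 + (B + K) / c.
  have := glow _ (Dy n); have := gy n; set r := enorm _.
  have : n.+1%:R^-1 <= 1 :> R by rewrite invf_le1 ?ltr0n// ler1n.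
  move=> h1 h2' h3.
  have h2 : g (y_ n) < I + 1 by apply: lt_le_trans h2' _; rewrite lerD2l.
  have h4 : (c * r - B) * r <= K by have := ler_norm (I + 1 - A); rewrite -/K; lra.
  have K0 : 0 <= K by exact: normr_ge0.
  have [r1|r1] := leP r 1.
    have : 0 <= (B + K) / c by apply: divr_ge0; [exact: addr_ge0|exact: ltW].
    lra.
  have h5 : c * r - B <= K.
    have [h0|h0] := leP (c * r - B) 0; first by apply: le_trans h0 _; rewrite /K.
    by apply: le_trans h4; rewrite ler_peMr// ltW.
  by have : r <= (B + K) / c; [rewrite ler_pdivlMr//; lra|lra].
have [z hz] : exists l, forall e : R, 0 < e -> U [set n | enorm (y_ n - l) < e].
  apply: (@ultra_row _ _ _ _ (1 + (B + K) / c + enorm p)) => //.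
  apply: filterS filterT => n _ /=.
  by rewrite -{1}(subrK p (y_ n)) (le_trans (enormD _ _))// lerD2r.
have Dz : D z.
  apply: (dom_closed S) => e /hz /filter_ex[n /= hn].
  by exists (y_ n).
exists z => // y0 Dy0.
have gI : I <= g y0 by apply: (ge_inf hI.2); exists y0.
apply: le_trans gI; rewrite -/(g z); apply/ler_addgt0Pr => e e0.
have e3 : 0 < e / 3 by lra.
have [r r0 hr] := psi_lsc S Dz e3.
(* [M] bounds the loss per unit distance in the linear and quadratic terms between [z] and [y_ n].
   The three thirds of e pay for lower semicontinuity, for this loss, and for the distance of
   [g (y_ n)] to the infimum. *)
pose M := enorm u + 2 * c * enorm (z - p) + 1.
have M0 : 0 < M.
  by rewrite ltr_wpDl// addr_ge0 ?enorm_ge0// mulr_ge0 ?enorm_ge0//; lra.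
have [N hN] := invS_small e3.
have m0 : 0 < Num.min r (e / 3 / M) by rewrite lt_min r0 divr_gt0.
have [n [/= + Nn]] := filter_ex (filterI (hz _ m0) (Uoo N)).
rewrite lt_min ltr_pdivlMr// => /andP[h1 h2].
have h3 := hr _ (Dy n) h1; have h4' := gy n.
have nN := hN n Nn.
have h4 : g (y_ n) < I + e / 3 by apply: lt_trans h4' _; rewrite ltrD2l.
have h5 := dotp_le u (y_ n - z).
have h6 : enorm (z - p) ^+ 2 - 2 * enorm (z - p) * enorm (y_ n - z) <= enorm (y_ n - p) ^+ 2.
  have := enorm_dist_tri (y_ n) z p.
  have -> : enorm (z - y_ n) = enorm (y_ n - z) by exact: enorm_distC.
  set a := enorm (z - p); set b := enorm (y_ n - z); set e' := enorm _.
  have : 0 <= a by exact: enorm_ge0.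
  have : 0 <= b by exact: enorm_ge0.
  have : 0 <= e' by exact: enorm_ge0.
  move=> e'0 b0 a0 ab; have [ba|ab'] := leP b a; last by nra.
  have : (a - b) ^+ 2 <= e' ^+ 2 by rewrite ler_pXn2r ?nnegrE//; lra.
  by have := sqr_ge0 b; nra.
have h7 := ler_wpM2l (ltW c0) h6.
move: h2 h4 h5; rewrite /M /g !dotpE => h2 h4 h5.
have := enorm_ge0 (y_ n - z); lra.
Qed.

Lemma selfimprove_scaled (H c : R) (z U : 'rV[R]_d) : 0 < H -> D z ->
  (forall y, D y -> dotp U (y - z) + H * psi z <=
                    H * psi y + c * enorm (y - z) ^+ 2) ->
  forall y, D y -> dotp U (y - z) + H * psi z <=
    H * psi y + (rho * H + gamma * enorm U) * enorm (y - z) ^+ 2.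
Proof.
move=> H0 Dz hz y Dy; have Hne : H != 0 by rewrite gt_eqF.
have Hi : 0 <= H^-1 by rewrite invr_ge0 ltW.
have : dotp (H^-1 *: U) (y - z) + psi z <= psi y +
   (rho + gamma * enorm (H^-1 *: U)) * enorm (y - z) ^+ 2.
  apply: (psi_selfimprove S (c := H^-1 * c)) => // w Dw.
  have := ler_wpM2l Hi (hz w Dw); rewrite 2!mulrDr !(mulrA H^-1) mulVf// !mul1r.
  by rewrite dotpZl.
move=> /(ler_wpM2l (ltW H0)); rewrite enormZ (ger0_norm Hi) dotpZl.
set P := dotp _ _; set Q := enorm U; set Y := enorm _ ^+ 2.
have -> : H * (H^-1 * P + psi z) = P + H * psi z by field.
by have -> : H * (psi y + (rho + gamma * (H^-1 * Q)) * Y) =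
  H * psi y + (rho * H + gamma * Q) * Y by field.
Qed.

(** Together with [selfimprove_scaled] this lets an increment U gathered over a time H play the role
    of H times a subgradient. After rescaling, the term gamma |U| carries no factor H, just as dVar
    stands beside dt in the limit inequality. *)
Lemma minimizer_scaled x1 (U p : 'rV[R]_d) (H c : R) : D x1 -> 0 < H -> 0 < c ->
  exists2 z, D z & forall y, D y ->
   H * psi z - dotp U z + c * enorm (z - p) ^+ 2 <=
   H * psi y - dotp U y + c * enorm (y - p) ^+ 2.
Proof.
move=> Dx1 H0 c0; have Hne : H != 0 by rewrite gt_eqF.
have [z Dz hz] := minimizer_exists (H^-1 *: U) p Dx1 (divr_gt0 c0 H0).
exists z => // y Dy; have := ler_wpM2l (ltW H0) (hz y Dy); rewrite !dotpZl.
have E (A B C : R) : H * (A - H^-1 * B + c / H * C) = H * A - B + c * C.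
  by field.
by rewrite !E.
Qed.

(** One implicit Euler step from a, with q = a + dM and q - z the increment of the pushing term.
    Expanding the squares in the minimality of z gives a support inequality with constant 1/2, which
    then improves itself; comparing z with a gives the energy inequality. *)
Lemma prox_step (h : R) (a q : 'rV[R]_d) : 0 < h -> D a ->
  exists z, [/\ D z,
   forall y, D y -> dotp (q - z) (y - z) + h * psi z <=
     h * psi y + (rho * h + gamma * enorm (q - z)) * enorm (y - z) ^+ 2 &
   enorm (q - z) ^+ 2 <= enorm (q - a) ^+ 2 + 2 * h * (psi a - psi z)].
Proof.
move=> h0 Da; have c0 : (0 : R) < 2^-1 by rewrite invr_gt0; lra.
have [z Dz] := minimizer_scaled 0 q Da h0 c0.
move=> hz0; have hz y : D y -> h * psi z + 2^-1 * enorm (z - q) ^+ 2 <=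
    h * psi y + 2^-1 * enorm (y - q) ^+ 2.
  by move=> /hz0; rewrite !dotp0l !subr0.
exists z; split => //; last first.
  by have := hz a Da; rewrite (enorm_distC q) (enorm_distC q); lra.
move=> y Dy; apply: (selfimprove_scaled (c := 2^-1)) => // w Dw.
have := hz w Dw.
rewrite !enorm_sqr !dotpE (dotpC z q) (dotpC w q) (dotpC z w); lra.
Qed.

End Minimizers.

(** * A priori estimates for the discrete scheme *)

(** The hypothesis is implicit, since the last term of the sum contains [a j] itself; it is absorbed
    because the weights are at most 1/2, at the cost of the factor 2 in the exponent. *)
Lemma discrete_gronwall (R : realType) (a b : nat -> R) (al : R) (n : nat) :
  0 <= al -> (forall l, 0 <= a l) -> (forall l, 0 <= b l) ->
  (forall l, (l < n)%N -> b l <= 2^-1) ->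
  (forall j, (j <= n)%N -> a j <= al + \sum_(l < j) b l * a l.+1) ->
  forall j, (j <= n)%N -> a j <= al * expR (2 * \sum_(l < j) b l).
Proof.
move=> al0 a0 b0 b2 aS j jn; apply: le_trans (aS j jn) _.
elim: j jn => [|j IH] jn; first by rewrite !big_ord0 mulr0 expR0 mulr1 addr0.
have {IH} := IH (ltnW jn); have := aS _ jn.
rewrite !big_ord_recr /= mulrDr expRD.
set s := \sum_(l < j) b l * a l.+1; set E := expR (2 * _) => h1 h2.
have h3 := b2 _ jn; have h4 := expR_ge1Dx (2 * b j).
have h5 : al + (s + b j * a j.+1) <= (al + s) * (1 + 2 * b j).
  have h6 := b0 j.
  have h9 : 0 <= al + s.
    by rewrite addr_ge0// sumr_ge0// => l _; rewrite mulr_ge0.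
  have [T TE] : exists T, T = al + (s + b j * a j.+1) by eexists.
  rewrite -TE in h1 *.
  have h8 := ler_wpM2l h6 h1.
  have h11 : T * (1 - b j) <= al + s by lra.
  (* The product equals 1 + b (1 - 2 b), so this is exactly where b <= 1/2 is used. *)
  have h12 : 1 <= (1 - b j) * (1 + 2 * b j) by nra.
  have h13 : 0 <= T by apply: le_trans (a0 j.+1) _.
  have h14 := ler_wpM2l h13 h12.
  have h15 : T * (1 - b j) * (1 + 2 * b j) <= (al + s) * (1 + 2 * b j).
    by rewrite ler_wpM2r//; lra.
  lra.
apply: le_trans h5 _; rewrite mulrA; apply: ler_pM => //.
- by rewrite addr_ge0// sumr_ge0// => l _; rewrite mulr_ge0.
- by have := b0 j; lra.
Qed.

(** Only what one proximal step yields is recorded, without the origin of the data M, so that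
    estimates can restart at any index. [scheme_energy] compares a step with the previous iterate
    and bounds individual jumps. *)
Record discrete_scheme (R : realType) (d : nat) (rho gamma : R)
    (D : set 'rV[R]_d) (psi : 'rV[R]_d -> R) (h : R) (X M : nat -> 'rV[R]_d)
    : Prop := {
  scheme_step : 0 < h;
  scheme_dom : forall j, D (X j);
  scheme_ineq : forall j y, D y ->
    dotp ((M j.+1 - X j.+1) - (M j - X j)) (y - X j.+1) + h * psi (X j.+1) <=
    h * psi y + (rho * h + gamma * enorm ((M j.+1 - X j.+1) - (M j - X j))) *
                enorm (y - X j.+1) ^+ 2;
  scheme_energy : forall j,
    enorm ((M j.+1 - X j.+1) - (M j - X j)) ^+ 2 <=
    enorm (M j.+1 - M j) ^+ 2 + 2 * h * (psi (X j) - psi (X j.+1)) }.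

(** The arithmetic that closes [variation_to_increment], where k and u are the norms of the given
    and the corrected slope, and e, q, r the distances z - p, y - z, y - p. Every error is a
    multiple of A eps (1 + r)^2; the multiples 16, 256 gamma, 64, 27 and 1 add up to 108 + 256
    gamma. *)
Lemma increment_error (R : realType) (rho gamma H k eps eta A W e r q u : R) :
  0 <= rho -> 0 <= gamma -> 0 <= H -> 0 <= k -> 0 < eps -> eps <= 1 ->
  eps ^+ 2 = eta -> 0 < A -> rho * H + gamma * k <= A -> W <= A ->
  0 <= e -> e <= 4 * eps -> 0 <= r -> 0 <= q -> q <= r + e -> u <= k + 4 * A * e ->
  (rho * H + gamma * u) * q ^+ 2 + 4 * A * e * q +
    A * (3 / 2 * e ^+ 2 + 3 * eta) + eta * W <=
  (rho * H + gamma * k) * r ^+ 2 + (108 + 256 * gamma) * (A * (eps * (1 + r) ^+ 2)).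
Proof.
move=> rho0 gamma0 H0 k0 eps0 eps1 etaE A0 kA WA e0 eE r0 q0 qr uA.
have [s sE] : exists s, s = 1 + r by eexists.
rewrite -sE; have s1 : 1 <= s by lra.
have q4 : q <= 4 * s by lra.
have eps_r := ler_wpM2l (ltW eps0) eps1; have eta0 : 0 <= eta by rewrite -etaE sqr_ge0.
have sq : q ^+ 2 <= r ^+ 2 + 16 * eps * s ^+ 2.
  have : q ^+ 2 <= (r + e) ^+ 2 by rewrite ler_pXn2r ?nnegrE// addr_ge0.
  have h1 := ler_wpM2l r0 eE; have h2 := ler_pM e0 e0 eE eE.
  have h3 := mulr_ge0 (ltW eps0) r0; have h4 := mulr_ge0 (ltW eps0) (sqr_ge0 r).
  clear - h1 h2 h3 h4 eps_r sE; rewrite sE; lra.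
have sq16 : q ^+ 2 <= 16 * s ^+ 2.
  have -> : 16 * s ^+ 2 = (4 * s) ^+ 2 by ring.
  by rewrite ler_pXn2r ?nnegrE// mulr_ge0// (le_trans ler01).
have ssl : s <= s ^+ 2 by rewrite expr2 ler_peMl// (le_trans ler01).
have ss : 1 <= s ^+ 2 by exact: le_trans ssl.
have es0 : 0 <= eps * s ^+ 2 by rewrite mulr_ge0 ?sqr_ge0// ltW.
have [T TE] : exists T, T = A * (eps * s ^+ 2) by eexists.
have es1 : eps * 1 <= eps * s ^+ 2 by rewrite ler_wpM2l// ltW.
have b1 : (rho * H + gamma * k) * q ^+ 2 <= (rho * H + gamma * k) * r ^+ 2 + 16 * T.
  have ck0 : 0 <= rho * H + gamma * k by rewrite addr_ge0// mulr_ge0.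
  have h1 := ler_wpM2l ck0 sq; have h2 := ler_wpM2r es0 kA.
  clear - h1 h2 TE; rewrite TE; lra.
have cwe : A * e <= A * (4 * eps) by rewrite ler_wpM2l// ltW.
have cwe0 : 0 <= A * e by rewrite mulr_ge0// ltW.
have b2 : gamma * (4 * A * e) * q ^+ 2 <= 256 * gamma * T.
  have h1 := ler_wpM2l gamma0 (ler_pM cwe0 (sqr_ge0 q) cwe sq16).
  clear - h1 TE; rewrite TE; lra.
have b3 : 4 * A * e * q <= 64 * T.
  have h1 := ler_pM cwe0 q0 cwe q4.
  have h2 : eps * s <= eps * s ^+ 2 by rewrite ler_wpM2l// ltW.
  have h3 := ler_wpM2l (ltW A0) h2; clear - h1 h3 TE; rewrite TE; lra.
have b4 : A * (3 / 2 * e ^+ 2 + 3 * eta) <= 27 * T.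
  have h1 := ler_pM e0 e0 eE eE.
  have h3 : 3 / 2 * e ^+ 2 + 3 * eta <= 27 * (eps * s ^+ 2).
    by clear - h1 es1 etaE eps_r; rewrite -etaE expr2 in h1 *; lra.
  have := ler_wpM2l (ltW A0) h3; clear - TE; rewrite TE; lra.
have b5 : eta * W <= T.
  have h1 := ler_wpM2l eta0 WA.
  have h3 : eta <= eps * s ^+ 2 by clear - es1 eps_r etaE; lra.
  have := ler_wpM2l (ltW A0) h3; clear - h1 TE; rewrite TE; lra.
have b6 := ler_wpM2r (sqr_ge0 q) (ler_wpM2l gamma0 uA).
clear - b1 b2 b3 b4 b5 b6 TE; rewrite -TE; lra.
Qed.

Section Scheme.
Variables (R : realType) (d : nat) (rho gamma L delta sigma : R).
Variables (D : set 'rV[R]_d) (psi : 'rV[R]_d -> R).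
Hypothesis S : skorohod_data rho gamma L delta sigma D psi.

Definition pushing (X M : nat -> 'rV[R]_d) j := M j - X j.
Definition push_step X M j := pushing X M j.+1 - pushing X M j.
Definition push_var X M n := \sum_(l < n) enorm (push_step X M l).

Lemma push_var_ge0 X M n : 0 <= push_var X M n.
Proof. by apply: sumr_ge0 => l _; exact: enorm_ge0. Qed.

Lemma push_var_le X M m n : (m <= n)%N -> push_var X M m <= push_var X M n.
Proof.
move=> /subnK <-; elim: (n - m)%N => [//|k IH]; rewrite addSn.
by apply: le_trans IH _; rewrite /push_var big_ord_recr/= lerDl enorm_ge0.
Qed.

Lemma push_sum X M n : pushing X M n - pushing X M 0 = \sum_(l < n) push_step X M l.
Proof.
elim: n => [|n IH]; first by rewrite big_ord0 subrr.
by rewrite big_ord_recr/= -IH /push_step [RHS]addrC subrKA.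
Qed.

Lemma push_le_var X M n : enorm (pushing X M n - pushing X M 0) <= push_var X M n.
Proof. by rewrite push_sum; exact: enorm_sum. Qed.

Lemma scheme_shift h X M i : discrete_scheme rho gamma D psi h X M ->
  discrete_scheme rho gamma D psi h (fun j => X (i + j)%N) (fun j => M (i + j)%N).
Proof.
by move=> [h0 XD XI XE]; split=> // j *; rewrite !addnS; [exact: XI|exact: XE].
Qed.

Lemma push_var_shift X M i n :
  push_var X M (i + n) = push_var X M i +
  push_var (fun j => X (i + j)%N) (fun j => M (i + j)%N) n.
Proof.
rewrite /push_var big_split_ord/=; congr (_ + _); apply: eq_bigr => l _.
by rewrite /push_step /pushing !addnS.
Qed.

(** Although psi may jump by L, the energy inequality multiplies its drop by h: with q the jump and
    w = |dM|, q^2 <= w^2 + 2 h (L + L (q + w)), so q is small with h and w. *)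
Lemma scheme_jump (e : R) : 0 < e -> exists2 eta : R, 0 < eta &
  forall h X M, discrete_scheme rho gamma D psi h X M -> forall j,
  h <= eta -> enorm (M j.+1 - M j) <= eta -> enorm (push_step X M j) <= e.
Proof.
(* With this [A], a jump q > e would give q e <= A max(h, w) <= e^2, a contradiction. *)
move=> e0; have L0 := L_ge0 S; pose A := 1 + 4 * L + 2 * L * e.
have A0 : 0 < A by have := mulr_ge0 L0 (ltW e0); rewrite /A; lra.
exists (Num.min 1 (e ^+ 2 / A)) => [|h X M sch j].
  by rewrite lt_min ltr01 divr_gt0 ?exprn_gt0.
rewrite !le_min !ler_pdivlMr// => /andP[h1 hA] /andP[w1 wA].
have := scheme_energy sch j; rewrite -/(pushing X M j) -/(pushing X M j.+1).
rewrite -/(push_step X M j); have h0 := scheme_step sch.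
set q := enorm (push_step X M j); set w := enorm (M j.+1 - M j) in w1 wA *.
move=> hq; rewrite leNgt; apply/negP => eq.
have w0 : 0 <= w by exact: enorm_ge0.
have xq : enorm (X j - X j.+1) <= q + w.
  rewrite /q /w enorm_distC -[X j.+1 - X j]opprK enormN.
  have -> : - (X j.+1 - X j) = push_step X M j - (M j.+1 - M j).
    rewrite /push_step /pushing; apply/rowP => i; rewrite !mxE; ring.
  exact: enormB.
have := psi_growth S (scheme_dom sch j) (scheme_dom sch j.+1).
rewrite ler_norml => /andP[_ hpsi].
have h3 := ler_wpM2l L0 xq.
have h4 : psi (X j) - psi (X j.+1) <= L + L * (1 + q) by nra.
have h5 := ler_wpM2l (ltW h0) h4.
have hq' : q ^+ 2 <= w ^+ 2 + 2 * (h * (L + L * (1 + q))) by lra.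
have h6 : w ^+ 2 <= w by rewrite expr2 ler_piMr.
have h7 : q * q <= (w + h * (4 * L) + 2 * h * L * e) * (q / e).
  have qe1 : 1 <= q / e by rewrite ler_pdivlMr// mul1r ltW.
  have hL : 0 <= h * L by rewrite mulr_ge0// ltW.
  have h8 : 0 <= w + h * (4 * L) by nra.
  have h9 := ler_wpM2l h8 qe1.
  have h10 : 2 * h * L * e * (q / e) = 2 * h * L * q by field; rewrite gt_eqF.
  rewrite mulrDl h10; rewrite -expr2; lra.
have q0 : 0 < q by exact: lt_trans e0 eq.
have h8 : q <= (w + h * (4 * L) + 2 * h * L * e) / e.
  by rewrite -(ler_pM2r q0) mulrAC -mulrA.
move: h8; rewrite ler_pdivlMr// => h8.
have h9 : Num.max h w * A <= e ^+ 2 by rewrite maxEle; case: ifP.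
have h10 : w + h * (4 * L) + 2 * h * L * e <= Num.max h w * A.
  have m1 : h <= Num.max h w by rewrite le_max lexx.
  have m2 : w <= Num.max h w by rewrite le_max lexx orbT.
  have Le : 0 <= L * e by rewrite mulr_ge0// ltW.
  have := ler_wpM2r L0 m1; have := ler_wpM2r Le m1; rewrite /A; lra.
have : e * e < q * e by rewrite ltr_pM2r.
by rewrite expr2 in h9; lra.
Qed.

(** The test point gains lam |dK| and loses at most gamma (|v| + lam)^2 |dK|, so sigma |dK| remains.
    As v is the same for the whole window, the terms <dK, v> telescope to the increment of K. The
    test point is within 2 of X, whence 3 L from the growth of psi and 4 rho from the quadratic
    term. *)
Lemma scheme_var_bound h X M n : discrete_scheme rho gamma D psi h X M ->
  (forall l, (l < n)%N -> enorm (X l.+1 - X 0) <= delta) ->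
  sigma * push_var X M n <= enorm (pushing X M n - pushing X M 0) +
    (3 * L + 4 * rho) * (n%:R * h).
Proof.
move=> sch near0; have L0 := L_ge0 S; have r0 := rho_ge0 S; have g0 := gamma_ge0 S.
have h0 := scheme_step sch.
have [lam [v [/andP[lam0 lam1] v1 sl ball]]] := dom_ball S (scheme_dom sch 0%N).
have step l : (l < n)%N -> sigma * enorm (push_step X M l) <=
    - dotp (push_step X M l) v + (3 * L + 4 * rho) * h.
  move=> ln; set k := push_step X M l; set q := enorm k.
  have C0 : 0 <= (3 * L + 4 * rho) * h by apply: mulr_ge0; [lra|exact: ltW].
  have addE (b c e : 'rV[R]_d) : b + c + e - b = c + e by vring.
  have [k0|k0] := eqVneq k 0.
    by rewrite /q k0 enorm0 dotp0l mulr0 oppr0 add0r.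
  have q0 : 0 < q by rewrite lt_neqAle eq_sym enorm_eq0 k0 enorm_ge0.
  pose w := (lam / q) *: k.
  have wl : enorm w = lam.
    by rewrite enormZ ger0_norm ?divr_ge0 ?ltW// -/q divfK// gt_eqF.
  have Dl := scheme_dom sch l.+1.
  have Dy : D (X l.+1 + v + w) by apply: ball => //; [exact: near0|rewrite wl].
  have := scheme_ineq sch l Dy; rewrite -/(pushing X M l) -/(pushing X M l.+1).
  rewrite -/(push_step X M l) -/k -/q.
  rewrite addE.
  have yx : enorm (v + w) <= enorm v + lam by rewrite -wl enormD.
  have y2 : enorm (v + w) <= 2 by lra.
  have := psi_growth S Dy Dl; rewrite ler_norml => /andP[_].
  rewrite addE.
  move=> hpsi.
  have -> : dotp k (v + w) = dotp k v + lam * q.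
    rewrite dotpDr /w dotpZr -enorm_sqr -/q; congr (_ + _); field.
    by rewrite gt_eqF.
  have n0 := enorm_ge0 (v + w); have nv0 := enorm_ge0 v.
  have sq1 : enorm (v + w) ^+ 2 <= (enorm v + lam) ^+ 2.
    by rewrite ler_pXn2r ?nnegrE// addr_ge0// ltW.
  have sq2 : enorm (v + w) ^+ 2 <= 4 by nra.
  have rh : 0 <= rho * h by rewrite mulr_ge0// ltW.
  have gq : 0 <= gamma * q by rewrite mulr_ge0// ltW.
  have e1 := ler_wpM2l rh sq2; have e2 := ler_wpM2l gq sq1.
  have Ly := ler_wpM2l L0 y2.
  have e3 : psi (X l.+1 + v + w) - psi (X l.+1) <= 3 * L by lra.
  have e4 := ler_wpM2l (ltW h0) e3.
  have e5 := ler_wpM2r (ltW q0) sl.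
  lra.
have : \sum_(l < n) sigma * enorm (push_step X M l) <=
    \sum_(l < n) (- dotp (push_step X M l) v + (3 * L + 4 * rho) * h).
  by apply: ler_sum => l _; exact: step.
rewrite -big_distrr /= big_split /= sumr_const card_ord sumrN -dotp_suml -push_sum.
rewrite -/(push_var X M n) => H; apply: le_trans H _.
rewrite -[_ *+ n]mulr_natr (mulrC n%:R) mulrA lerD2r.
have := dotp_ge (pushing X M n - pushing X M 0) v.
have := ler_wpM2l (enorm_ge0 (pushing X M n - pushing X M 0)) v1; lra.
Qed.

(** The square of |K_j - K_0| grows by at most 2 <dK, K_{j+1} - K_0>. Since K = M - X, this splits
    into an increment of M, bounded by w, and <dK, X_0 - X_{j+1}>, bounded by the scheme inequality
    tested with X_0. There |X_0 - X_{j+1}|^2 <= 2 |K_{j+1} - K_0|^2 + 2 w^2, which leaves the sum to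
    be handled by Gronwall. *)
Lemma scheme_energy_bound h X M n (w : R) :
  discrete_scheme rho gamma D psi h X M ->
  (forall l, (l <= n)%N -> enorm (X l - X 0) <= delta) ->
  (forall l, (l <= n)%N -> enorm (M l - M 0) <= w) ->
  forall j, (j <= n)%N ->
  enorm (pushing X M j - pushing X M 0) ^+ 2 <=
   (2 * w * push_var X M n + 2 * (n%:R * h) * (L + L * delta + rho * delta ^+ 2)
     + 4 * gamma * w ^+ 2 * push_var X M n) +
   \sum_(l < j) 4 * gamma * enorm (push_step X M l) *
       enorm (pushing X M l.+1 - pushing X M 0) ^+ 2.
Proof.
move=> sch Xd Mw j jn.
have L0 := L_ge0 S; have r0 := rho_ge0 S; have g0 := gamma_ge0 S.
have h0 := scheme_step sch; have d0 := delta_gt0 S.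
have w0 : 0 <= w by apply: le_trans (enorm_ge0 _) (Mw _ (leq0n _)).
pose C2 := L + L * delta + rho * delta ^+ 2.
have C20 : 0 <= C2.
  have := mulr_ge0 L0 (ltW d0); have := mulr_ge0 r0 (sqr_ge0 delta).
  by rewrite /C2; lra.
suff H : enorm (pushing X M j - pushing X M 0) ^+ 2 <=
   (2 * w * push_var X M j + 2 * (j%:R * h) * C2
     + 4 * gamma * w ^+ 2 * push_var X M j) +
   \sum_(l < j) 4 * gamma * enorm (push_step X M l) *
       enorm (pushing X M l.+1 - pushing X M 0) ^+ 2.
  apply: le_trans H _; rewrite lerD2r -/C2.
  have jn' : j%:R <= n%:R :> R by rewrite ler_nat.
  have Vjn := push_var_le X M jn.
  have e1 := ler_wpM2l w0 Vjn.
  have e2 := ler_wpM2r C20 (ler_wpM2r (ltW h0) jn').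
  have e3 := ler_wpM2l (mulr_ge0 g0 (sqr_ge0 w)) Vjn.
  lra.
elim: j jn => [|j IH] jn.
  by rewrite subrr enorm0 expr0n/= /push_var !big_ord0; lra.
have {IH} := IH (ltnW jn).
have -> : push_var X M j.+1 = push_var X M j + enorm (push_step X M j).
  by rewrite /push_var big_ord_recr.
rewrite big_ord_recr /=.
set s := \sum_(l < j) _; set V := push_var X M j.
set k := push_step X M j; set q := enorm k.
set a := pushing X M j.+1 - pushing X M 0; set b := pushing X M j - pushing X M 0.
move=> IH.
have sqE (y z : 'rV[R]_d) : enorm y ^+ 2 <= enorm (y - z) ^+ 2 + 2 * dotp z y.
  by rewrite !enorm_sqr !dotpE (dotpC z y); have := dotp_ge0 z; lra.
have ab : enorm a ^+ 2 <= enorm b ^+ 2 + 2 * dotp k a.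
  by have -> : b = a - k by [rewrite /a /b /k /push_step; vring]; exact: sqE.
have aE : a = (M j.+1 - M 0) - (X j.+1 - X 0) by rewrite /a /pushing; vring.
have kM : dotp k (M j.+1 - M 0) <= q * w.
  by apply: le_trans (dotp_le _ _) _; rewrite ler_wpM2l ?enorm_ge0// Mw.
have Xa : enorm (X 0 - X j.+1) <= enorm a + w.
  have -> : X 0 - X j.+1 = a - (M j.+1 - M 0) by rewrite aE; vring.
  by apply: le_trans (enormB _ _) _; rewrite lerD2l Mw.
have Xd1 : enorm (X 0 - X j.+1) <= delta by rewrite enorm_distC Xd.
have := scheme_ineq sch j (scheme_dom sch 0%N).
rewrite -/(pushing X M j) -/(pushing X M j.+1) -/(push_step X M j) -/k -/q.
have := psi_growth S (scheme_dom sch 0%N) (scheme_dom sch j.+1).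
rewrite ler_norml => /andP[_]; set e := enorm (X 0 - X j.+1) in Xa Xd1 *.
move=> hp hi.
have e0 : 0 <= e by exact: enorm_ge0.
have q0 : 0 <= q by exact: enorm_ge0.
have a0 : 0 <= enorm a by exact: enorm_ge0.
have e1 := ler_wpM2l L0 Xd1.
have e2 : h * (psi (X 0) - psi (X j.+1)) <= h * (L + L * delta).
  by rewrite ler_wpM2l ?(ltW h0)//; lra.
have sq1 : e ^+ 2 <= delta ^+ 2 by rewrite ler_pXn2r ?nnegrE// ltW.
have sq2 : e ^+ 2 <= 2 * enorm a ^+ 2 + 2 * w ^+ 2.
  have : e ^+ 2 <= (enorm a + w) ^+ 2 by rewrite ler_pXn2r ?nnegrE// addr_ge0.
  by have := sqr_ge0 (enorm a - w); lra.
have e3 := ler_wpM2l (mulr_ge0 r0 (ltW h0)) sq1.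
have e4 := ler_wpM2l (mulr_ge0 g0 q0) sq2.
have ka : dotp k a = dotp k (M j.+1 - M 0) + dotp k (X 0 - X j.+1).
  by rewrite aE -dotpDr; congr dotp; vring.
have -> : j.+1%:R = j%:R + 1 :> R by rewrite natr1.
rewrite /C2 in IH *; lra.
Qed.

(** The variation bound needs X to stay within delta of X_0, and the energy bound needs the
    variation. A bootstrap over the index closes the circle, with constants depending neither on the
    step nor on the starting point. *)
Lemma scheme_modulus : exists V0 C eta : R,
  [/\ 0 < V0, 0 <= C, 0 < eta &
  forall h X M, discrete_scheme rho gamma D psi h X M ->
  forall n (w : R), (forall l, (l <= n)%N -> enorm (M l - M 0) <= w) ->
    (forall l, (l < n)%N -> enorm (push_step X M l) <= eta) ->
    w + n%:R * h <= eta ->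
    (forall l, (l <= n)%N -> enorm (X l - X 0) ^+ 2 <= C * (w + n%:R * h)) /\
    push_var X M n <= V0].
Proof.
have L0 := L_ge0 S; have r0 := rho_ge0 S; have g0 := gamma_ge0 S.
have d0 := delta_gt0 S; have s0 := sigma_gt0 S.
pose C1 := 3 * L + 4 * rho.
have C10 : 0 <= C1 by rewrite /C1; lra.
pose C2 := L + L * delta + rho * delta ^+ 2.
have C20 : 0 <= C2.
  have := mulr_ge0 L0 (ltW d0); have := mulr_ge0 r0 (sqr_ge0 delta).
  by rewrite /C2; lra.
(* In the window |K_n - K_0| <= w + delta, and w and n h are at most 1. *)
pose V0 := (delta + 1 + C1) / sigma.
have V00 : 0 < V0 by rewrite divr_gt0//; lra.
pose E := expR (8 * gamma * V0).
have E1 : 1 <= E.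
  by rewrite -expR0 ler_expR; apply: mulr_ge0; [lra|exact: ltW].
pose C3 := 2 * V0 + 2 * C2 + 4 * gamma * V0.
have gV : 0 <= gamma * V0 by rewrite mulr_ge0// ltW.
have C30 : 0 <= C3 by rewrite /C3; lra.
pose C := 2 * C3 * E + 2.
have CE : 0 <= C3 * E by apply: mulr_ge0 => //; lra.
have C0 : 0 <= C by rewrite /C; lra.
(* The second bound makes the Gronwall weights 4 gamma |dK| at most 1/2. The last two serve the
   bootstrap: C eta <= delta^2 / 4 keeps X within delta / 2, and three terms of size delta / 6 pay
   for one more step. *)
pose eta := Num.min 1 (Num.min (8 * gamma + 1)^-1 (Num.min (delta / 6) (delta ^+ 2 / (4 * (C + 1))))).
have g8 : 0 < (8 * gamma + 1)^-1 by rewrite invr_gt0; lra.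
have eta0 : 0 < eta.
  rewrite !lt_min ltr01 g8 !divr_gt0// ?exprn_gt0//.
  by rewrite mulr_gt0//; lra.
exists V0, C, eta; split => // h X M sch n w Mw jump wn.
have h0 := scheme_step sch.
have w0 : 0 <= w by apply: le_trans (enorm_ge0 _) (Mw _ (leq0n _)).
have nh0 : 0 <= n%:R * h by rewrite mulr_ge0// ltW.
have := lexx eta; rewrite {2}/eta !le_min => /andP[eta1 /andP[eta2 /andP[eta3 eta4]]].
clearbody eta.
have window j : (j <= n)%N ->
    (forall l, (l <= j)%N -> enorm (X l - X 0) <= delta) ->
    (forall l, (l <= j)%N -> enorm (X l - X 0) ^+ 2 <= C * (w + n%:R * h)) /\
    push_var X M j <= V0.
  move=> jn near0.
  have jh : j%:R * h <= n%:R * h by rewrite ler_wpM2r ?(ltW h0)// ler_nat.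
  have jh0 : 0 <= j%:R * h by rewrite mulr_ge0// ltW.
  have Mw' l : (l <= j)%N -> enorm (M l - M 0) <= w.
    by move=> lj; apply: Mw; exact: leq_trans jn.
  have Vj : push_var X M j <= V0.
    rewrite /V0 ler_pdivlMr// mulrC.
    apply: le_trans (scheme_var_bound sch _) _; first by move=> l lj; exact: near0.
    have -> : pushing X M j - pushing X M 0 = (M j - M 0) - (X j - X 0).
      by rewrite /pushing; vring.
    have := enormB (M j - M 0) (X j - X 0).
    have := Mw' j (leqnn _); have := near0 j (leqnn _).
    have : j%:R * h <= 1 by lra.
    move=> /(ler_wpM2l C10); rewrite -/C1; lra.
  split => // l lj.
  have V0j := push_var_ge0 X M j.
  pose al := 2 * w * push_var X M j + 2 * (j%:R * h) * C2
     + 4 * gamma * w ^+ 2 * push_var X M j.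
  have gw : 0 <= gamma * w ^+ 2 by rewrite mulr_ge0// sqr_ge0.
  have al0 : 0 <= al.
    have := mulr_ge0 w0 V0j; have := mulr_ge0 jh0 C20; have := mulr_ge0 gw V0j.
    by rewrite /al; lra.
  have := @discrete_gronwall R (fun l => enorm (pushing X M l - pushing X M 0) ^+ 2)
    (fun l => 4 * gamma * enorm (push_step X M l)) al j al0.
  move=> /(_ (fun l => sqr_ge0 _)).
  have b0 i : 0 <= 4 * gamma * enorm (push_step X M i).
    by rewrite mulr_ge0 ?enorm_ge0//; lra.
  move=> /(_ b0).
  have b2 i : (i < j)%N -> 4 * gamma * enorm (push_step X M i) <= 2^-1.
    move=> ij; have := jump i (leq_trans ij jn) => h1.
    have h2 : enorm (push_step X M i) <= (8 * gamma + 1)^-1 by exact: le_trans h1 _.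
    have h3 : (8 * gamma) * (8 * gamma + 1)^-1 <= 1.
      by rewrite ler_pdivrMr; lra.
    have := ler_wpM2l g0 h2; lra.
  move=> /(_ b2 (scheme_energy_bound sch near0 Mw') l lj) /=.
  set a := enorm _ ^+ 2; rewrite -big_distrr /=.
  have -> : 2 * (4 * gamma * \sum_(i < l) enorm (push_step X M i)) =
    8 * gamma * push_var X M l by rewrite /push_var; ring.
  move=> ha.
  have Vl : push_var X M l <= V0 by exact: le_trans (push_var_le _ _ lj) Vj.
  have hE : expR (8 * gamma * push_var X M l) <= E.
    by rewrite ler_expR ler_wpM2l//; lra.
  have ha2 : a <= al * E by apply: le_trans ha _; rewrite ler_wpM2l.
  clear L0 r0 d0 s0 C10 g8 eta0 h0 eta2 eta3 eta4 ha hE b0 b2 near0 Mw jump Vl.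
  have hal : al <= C3 * (w + n%:R * h).
    have w1 : w <= 1 by lra.
    have ww : w ^+ 2 <= w by rewrite expr2 ler_piMr.
    have f1 := ler_wpM2l w0 Vj; have f2 := ler_wpM2r C20 jh.
    have f3 := ler_pM gw V0j (ler_wpM2l g0 ww) Vj.
    have f4 := mulr_ge0 w0 C20; have f5 := mulr_ge0 nh0 (ltW V00).
    have f6 := mulr_ge0 gV nh0.
    clear - f1 f2 f3 f4 f5 f6; rewrite /al /C3; lra.
  have ha3 : a <= C3 * (w + n%:R * h) * E.
    by apply: le_trans ha2 _; rewrite ler_wpM2r//; lra.
  have -> : X l - X 0 = (M l - M 0) - (pushing X M l - pushing X M 0).
    by rewrite /pushing; vring.
  have Ml := Mw' _ lj.
  have h1 : enorm ((M l - M 0) - (pushing X M l - pushing X M 0)) ^+ 2 <=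
      2 * w ^+ 2 + 2 * a.
    have h2 := enormB (M l - M 0) (pushing X M l - pushing X M 0).
    set u := enorm (_ - _) in h2 *; rewrite /a.
    have u0 : 0 <= u by exact: enorm_ge0.
    set p := enorm (pushing X M l - _) in h2 *.
    have h3 : u <= w + p by lra.
    have p0 : 0 <= p by exact: enorm_ge0.
    have : u ^+ 2 <= (w + p) ^+ 2 by rewrite ler_pXn2r ?nnegrE// addr_ge0.
    by have := sqr_ge0 (w - p); lra.
  apply: le_trans h1 _.
  have ww : w ^+ 2 <= w by rewrite expr2 ler_piMr//; lra.
  rewrite /C; lra.
(* Up to index j the estimate gives delta / 2; the step to j + 1 adds at most two displacements of M
   and one jump of K, again delta / 2 in all. *)
have near0 j : (j <= n)%N -> forall l, (l <= j)%N -> enorm (X l - X 0) <= delta.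
  elim: j => [_ l|j IH jn l].
    by rewrite leqn0 => /eqP ->; rewrite subrr enorm0 ltW.
  have IHj := IH (ltnW jn).
  rewrite leq_eqVlt => /predU1P[->|]; last by rewrite ltnS; exact: IHj.
  have [/(_ j (leqnn _)) h1 _] := window j (ltnW jn) IHj.
  have h2 : enorm (X j - X 0) <= delta / 2.
    rewrite -(@ler_pXn2r _ 2)// ?nnegrE ?enorm_ge0 ?divr_ge0// ?(ltW d0)//.
    apply: le_trans h1 _.
    have h3 := ler_wpM2l C0 wn.
    have h4 : (C + 1) * eta <= delta ^+ 2 / 4.
      have -> : delta ^+ 2 / 4 = (C + 1) * (delta ^+ 2 / (4 * (C + 1))).
        by field; apply/eqP; lra.
      by rewrite ler_wpM2l//; lra.
    rewrite exprMn; lra.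
  have -> : X j.+1 - X 0 = (X j - X 0) + ((M j.+1 - M 0) - (M j - M 0) - push_step X M j).
    by rewrite /push_step /pushing; vring.
  have := enormD (X j - X 0) ((M j.+1 - M 0) - (M j - M 0) - push_step X M j).
  have := enormB ((M j.+1 - M 0) - (M j - M 0)) (push_step X M j).
  have := enormB (M j.+1 - M 0) (M j - M 0).
  have := Mw _ jn; have := Mw _ (ltnW jn); have := jump _ jn; lra.
by apply: window => //; exact: near0.
Qed.

(** Windows of [q] steps last at most tau, and at least tau / 2 because h <= tau / 2; hence at most
    2 N h / tau full windows and one remainder. *)
Lemma scheme_var_total h X M (V0 tau : R) (N : nat) : 0 <= V0 ->
  discrete_scheme rho gamma D psi h X M -> 0 < tau -> h <= tau / 2 ->
  (forall i n, (i + n <= N)%N -> n%:R * h <= tau ->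
    push_var (fun j => X (i + j)%N) (fun j => M (i + j)%N) n <= V0) ->
  push_var X M N <= V0 * (1 + 2 * (N%:R * h) / tau).
Proof.
move=> V00 sch tau0 htau win; have h0 := scheme_step sch.
pose q := Num.truncn (tau / h).
have th : 0 <= tau / h by rewrite divr_ge0// ltW.
have /andP[q1 q2] := truncn_itv th.
have {}q1 : q%:R * h <= tau by rewrite -ler_pdivlMr.
have {}q2 : tau < (q%:R + 1) * h by rewrite natr1 -ltr_pdivrMr.
have q0 : (0 < q)%N by rewrite lt0n; apply/eqP => q0; rewrite q0 in q2; lra.
suff H k : forall i, (i + k <= N)%N -> push_var (fun j => X (i + j)%N)
    (fun j => M (i + j)%N) k <= V0 * (1 + 2 * (k%:R * h) / tau).
  by have := H N 0%N; rewrite add0n => /(_ (leqnn _)).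
elim/ltn_ind: k => k IH i ik.
have k0 : 0 <= k%:R * h / tau by rewrite divr_ge0 ?mulr_ge0// ltW.
have [kq|qk] := ltnP k q.
  have : k%:R * h <= tau.
    by apply: le_trans q1; rewrite ler_wpM2r ?(ltW h0)// ler_nat ltnW.
  move=> /win => /(_ _ ik) H; apply: le_trans H _.
  by rewrite ler_peMr//; lra.
have kE : k = (q + (k - q))%N by rewrite subnKC.
have lt1 : (k - q < k)%N by rewrite ltn_subrL q0 (leq_trans q0 qk).
have := IH _ lt1 (i + q)%N; rewrite -addnA -kE => /(_ ik) h1.
have h2 : push_var (fun j => X (i + j)%N) (fun j => M (i + j)%N) q <= V0.
  by apply: win => //; apply: leq_trans ik; rewrite leq_add2l.
rewrite {1}kE push_var_shift /=.
have -> : (fun j => X (i + (q + j))%N) = (fun j => X (i + q + j)%N).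
  by apply/funext => j; rewrite addnA.
have -> : (fun j => M (i + (q + j))%N) = (fun j => M (i + q + j)%N).
  by apply/funext => j; rewrite addnA.
have qh : tau / 2 <= q%:R * h by lra.
have -> : k%:R * h = q%:R * h + (k - q)%:R * h :> R by rewrite {1}kE natrD mulrDl.
have : 1 <= 2 * (q%:R * h) / tau by rewrite ler_pdivlMr//; lra.
move=> /(ler_wpM2l V00); move: h1; rewrite !mulrDr !mulrDl !mulrDr; lra.
Qed.

(* Minimizing the tilted function [H psi - <U, .> + 2 c0 W |. - p|^2] gives a
   point [z] close to [p] at which [U] is almost a subgradient, so that
   [psi_selfimprove] replaces the variation [V] by [enorm U]. *)
Lemma variation_to_increment (H V eps P : R) (p U : 'rV[R]_d) (n : nat) (Y : 'I_n -> 'rV[R]_d) :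
  0 < H -> 0 < eps <= 1 -> enorm U <= V -> D p ->
  (forall i, D (Y i)) -> (forall i, enorm (Y i - p) <= eps ^+ 2) ->
  P * n%:R = H * \sum_(i < n) psi (Y i) -> (0 < n)%N ->
  (forall y, D y -> dotp U (y - p) + P <= H * psi y +
     (rho * H + gamma * V) * (enorm (y - p) + eps ^+ 2) ^+ 2 + eps ^+ 2 * V) ->
  forall y, D y -> dotp U (y - p) + P <= H * psi y +
     (rho * H + gamma * enorm U) * enorm (y - p) ^+ 2 +
     (rho + gamma + 1) * (108 + 256 * gamma) * eps * (H + V) * (1 + enorm (y - p)) ^+ 2.
Proof.
move=> H0 /andP[eps0 eps1] UV Dp DY Yp PE n0 hyp y Dy.
have r0 := rho_ge0 S; have g0 := gamma_ge0 S.
set c0 := rho + gamma + 1.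
have c0E : c0 = rho + gamma + 1 by [].
have c01 : 1 <= c0 by lra.
clearbody c0.
set k := enorm U in UV *; have k0 : 0 <= k by exact: enorm_ge0.
have kE : enorm U = k by []; clearbody k.
set W := H + V; have WE : W = H + V by []; clearbody W.
set eta := eps ^+ 2 in Yp hyp; have eta0 : 0 <= eta by exact: sqr_ge0.
have etaE : eps ^+ 2 = eta by []; clearbody eta.
have eta1 : eta <= eps by rewrite -etaE expr2 ler_piMr// ltW.
have V0 : 0 <= V by exact: le_trans UV.
have W0 : 0 < W by lra.
have c0W : 0 < c0 * W by apply: mulr_gt0 => //; lra.
have coef : rho * H + gamma * V <= c0 * W.
  have := mulr_ge0 r0 V0; have := mulr_ge0 g0 (ltW H0).
  by rewrite c0E WE; lra.
have etasq : eta ^+ 2 <= eta by rewrite expr2 ler_piMr//; lra.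
have hyp' w : D w -> dotp U (w - p) + P <= H * psi w +
    c0 * W * (3 / 2 * enorm (w - p) ^+ 2 + 3 * eta) + eta * W.
  move=> Dw; apply: le_trans (hyp w Dw) _.
  have e0 := enorm_ge0 (w - p).
  have h1 : (enorm (w - p) + eta) ^+ 2 <= 3 / 2 * enorm (w - p) ^+ 2 + 3 * eta.
    have := sqr_ge0 (enorm (w - p) - 2 * eta).
    by lra.
  have h2 : eta * V <= eta * W by rewrite ler_wpM2l//; lra.
  have h3 := ler_pM _ (sqr_ge0 (enorm (w - p) + eta)) coef h1.
  have : 0 <= rho * H + gamma * V by rewrite addr_ge0// mulr_ge0// ltW.
  by move=> /h3; lra.
(* The coefficient 2 c0 W exceeds the 3/2 c0 W lost in [hyp']; the surplus forces the minimizer to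
   lie within 4 eps of [p]. *)
have c2 : 0 < 2 * (c0 * W) by lra.
have [z Dz hz] := minimizer_scaled S U p Dp H0 c2.
set e := enorm (z - p) in hz.
have e0 : 0 <= e by exact: enorm_ge0.
have eZ : enorm (z - p) = e by []; clearbody e.
(* [P] is H times the mean of psi over the points [Y i], and psi may jump between [p] and these
   points. So [z] is compared with each [Y i] and the inequalities are averaged. *)
have avg : H * psi z - dotp U z + 2 * (c0 * W) * e ^+ 2 <=
    P - dotp U p + k * eta + 2 * (c0 * W) * eta.
  have n0' : (0 : R) < n%:R by rewrite ltr0n.
  rewrite -(ler_pM2r n0').
  have -> : (P - dotp U p + k * eta + 2 * (c0 * W) * eta) * n%:R =
    H * \sum_(i < n) psi (Y i) +
    (- dotp U p + k * eta + 2 * (c0 * W) * eta) * n%:R by rewrite -PE; ring.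
  have : \sum_(i < n) (H * psi z - dotp U z + 2 * (c0 * W) * e ^+ 2) <=
      \sum_(i < n) (H * psi (Y i) + (- dotp U p + k * eta + 2 * (c0 * W) * eta)).
    apply: ler_sum => i _; apply: le_trans (hz _ (DY i)) _.
    have h1 := dotp_ge U (Y i - p); have h2 := ler_wpM2l k0 (Yp i).
    have h3 : enorm (Y i - p) ^+ 2 <= eta.
      by apply: le_trans etasq; rewrite ler_pXn2r ?nnegrE ?enorm_ge0.
    have h4 := ler_wpM2l (ltW c2) h3.
    move: h1; rewrite dotpDr dotpNr kE; lra.
  have sumc (c : R) : \sum_(i < n) c = c * n%:R.
    by rewrite sumr_const card_ord mulr_natr.
  by move=> h; rewrite mulr_sumr -!sumc -big_split.
have hz' := hyp' z Dz; rewrite eZ in hz'.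
have keta : k * eta <= W * eta by rewrite ler_wpM2r//; lra.
have eE : e <= 4 * eps.
  rewrite -(@ler_pXn2r _ 2)// ?nnegrE ?mulr_ge0// ?(ltW eps0)//.
  have : W * (c0 * e ^+ 2) <= W * (c0 * (16 * eta)).
    have h1 : W * eta <= c0 * W * eta by rewrite ler_wpM2r// ler_peMl// ltW.
    have h2 : 0 <= c0 * W * eta by rewrite mulr_ge0// ltW.
    move: hz'; rewrite dotpDr dotpNr; lra.
  rewrite ler_pM2l// ler_pM2l; last lra.
  by rewrite exprMn etaE; lra.
(* The slope at the minimizer: [U] corrected by the gradient of the added quadratic, hence by at
   most 4 c0 W e. *)
pose U' := U - (4 * (c0 * W)) *: (z - p).
have tilt : dotp U' (y - z) + H * psi z <=
    H * psi y + (rho * H + gamma * enorm U') * enorm (y - z) ^+ 2.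
  apply: (selfimprove_scaled S (c := 2 * (c0 * W))) => // w Dw.
  have := hz w Dw; rewrite /U' -eZ !enorm_sqr !dotpE.
  rewrite (dotpC p z) (dotpC p w) (dotpC w z); lra.
have U'n : enorm U' <= k + 4 * (c0 * W) * e.
  apply: le_trans (enormB _ _) _; rewrite enormZ kE eZ ger0_norm//; lra.
have U'y : dotp U (y - z) - 4 * (c0 * W) * e * enorm (y - z) <= dotp U' (y - z).
  rewrite /U' dotpDl dotpNl dotpZl.
  have h := dotp_le (z - p) (y - z); rewrite eZ in h.
  have c4 : 0 <= 4 * (c0 * W) by lra.
  have := ler_wpM2l c4 h; lra.
set r := enorm (y - p); set s := 1 + r.
have rr0 : 0 <= r by exact: enorm_ge0.
set q := enorm (y - z) in tilt U'y.
have q0 : 0 <= q by exact: enorm_ge0.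
have qr : q <= r + e by rewrite /q /r -eZ (enorm_distC z) enorm_dist_tri.
have kV : rho * H + gamma * k <= c0 * W.
  by apply: le_trans coef; rewrite lerD2l ler_wpM2l.
have WW : W <= c0 * W by rewrite ler_peMl// ltW.
have := increment_error r0 g0 (ltW H0) k0 eps0 eps1 etaE c0W kV WW e0 eE rr0 q0 qr U'n.
have ypE : dotp U (y - p) = dotp U (y - z) + dotp U (z - p).
  by rewrite -dotpDr; congr dotp; vring.
have -> : c0 * (108 + 256 * gamma) * eps * W * s ^+ 2 =
  (108 + 256 * gamma) * (c0 * W * (eps * s ^+ 2)) by ring.
clear hz avg hyp hyp' coef keta WW kV eE U'n qr etasq eta1 c01 c0E c2 c0W.
rewrite ypE; move: hz' tilt U'y; rewrite -/s; lra.
Qed.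

End Scheme.

(** * Continuous functions on R_+ and Stieltjes integrals *)

Definition rcont (R : realType) (g : R -> R) : Prop :=
  forall t : R, 0 <= t -> forall e : R, 0 < e -> exists2 r : R, 0 < r &
    forall s : R, 0 <= s -> `|s - t| < r -> `|g s - g t| < e.

Definition rnondec (R : realType) (F : R -> R) : Prop :=
  forall s t : R, 0 <= s -> s <= t -> F s <= F t.

Section RealCurves.
Variable R : realType.
Implicit Types (g F : R -> R).

Lemma max0_contraction (s t : R) : `|Num.max 0 s - Num.max 0 t| <= `|s - t|.
Proof.
have := ler_norm (t - s); have := ler_norm (s - t); rewrite (distrC t s).
rewrite ler_norml !maxEle; case: ifP => h1; case: ifP => h2; lra.
Qed.

Lemma rcont_cst (c : R) : rcont (fun=> c).
Proof. by move=> t t0 e e0; exists 1 => // s _ _; rewrite subrr normr0. Qed.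

(** Values at negative times are arbitrary; composing with max(0, .) replaces them by g(0) and makes
    results about continuous functions on R applicable. *)
Lemma rcont_ext g : rcont g -> continuous (g \o Num.max 0).
Proof.
move=> cg t; apply/cvgrPdist_lt => e e0.
have m0 (s : R) : 0 <= Num.max 0 s by rewrite le_max lexx.
have [r r0 hr] := cg _ (m0 t) e e0.
apply/nbhs_ballP; exists r => // s ts; rewrite /= distrC; apply: hr => //.
by apply: le_lt_trans ts; rewrite -[leRHS]distrC max0_contraction.
Qed.

Lemma rcont_ext_eq g (t : R) : 0 <= t -> (g \o Num.max 0) t = g t.
Proof. by move=> t0; rewrite /= max_r. Qed.

Lemma rcont_measurable g (D : set R) : measurable D ->
  (forall t, D t -> 0 <= t) -> rcont g -> measurable_fun D g.
Proof.
move=> mD D0 cg; apply: (eq_measurable_fun (g \o Num.max 0)).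
  by move=> t /set_mem /D0; exact: rcont_ext_eq.
apply: measurable_funS (continuous_measurable_fun (rcont_ext cg)) => //.
Qed.

Lemma rcont_unif g (T : R) : rcont g -> forall e : R, 0 < e ->
  exists2 r : R, 0 < r & forall s t : R, 0 <= s <= T -> 0 <= t <= T ->
    `|s - t| <= r -> `|g s - g t| < e.
Proof.
move=> cg; apply: (@segment_unif_continuous R (fun s t => `|g s - g t|)).
- by move=> s t; rewrite distrC.
- by move=> r s t; exact: ler_distD.
- move=> t /andP[t0 _] e e0; have [r r0 hr] := cg t t0 e e0.
  by exists r => // s /andP[s0 _]; exact: hr.
Qed.

Lemma rcont_bounded g (T : R) : rcont g ->
  exists2 C : R, 0 <= C & forall t : R, 0 <= t <= T -> `|g t| <= C.
Proof.
move=> cg; have [T0|T0] := leP 0 T; last first.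
  by exists 0 => // t /andP[h1 h2]; lra.
have cg' : {within `[0, T], continuous (fun t => `|(g \o Num.max 0) t|)}.
  apply: continuous_subspaceT => t; apply: cvg_norm; exact: rcont_ext.
have [c _ hc] := EVT_max T0 cg'.
exists (`|(g \o Num.max 0) c|) => // t tT.
have /hc : t \in `[0, T] by rewrite in_itv.
by rewrite rcont_ext_eq//; case/andP: tT.
Qed.

Lemma rcontD f g : rcont f -> rcont g -> rcont (fun t => f t + g t).
Proof.
move=> cf cg t t0 e e0; have e2 : 0 < e / 2 by lra.
have [r1 r10 h1] := cf t t0 _ e2; have [r2 r20 h2] := cg t t0 _ e2.
exists (Num.min r1 r2) => [|s s0]; first by rewrite lt_min r10.
rewrite lt_min => /andP[/(h1 _ s0) a1 /(h2 _ s0) a2].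
have -> : f s + g s - (f t + g t) = (f s - f t) + (g s - g t) by ring.
by apply: le_lt_trans (ler_normD _ _) _; lra.
Qed.

Lemma rcontZ (c : R) g : rcont g -> rcont (fun t => c * g t).
Proof.
move=> cg t t0 e e0.
have c1 : 0 < `|c| + 1 by rewrite ltr_wpDl.
have [r r0 h] := cg t t0 _ (divr_gt0 e0 c1).
exists r => // s s0 /(h _ s0); rewrite -mulrBr normrM ltr_pdivlMr// mulrC.
by move=> h1; apply: le_lt_trans h1; rewrite ler_wpM2r//; lra.
Qed.

Lemma rcontB f g : rcont f -> rcont g -> rcont (fun t => f t - g t).
Proof.
move=> cf cg; have := rcontD cf (rcontZ (-1) cg).
by congr rcont; apply/funext => t; rewrite mulN1r.
Qed.

Lemma rcont_sum (I : Type) (r : seq I) (f : I -> R -> R) :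
  (forall i, rcont (f i)) -> rcont (fun t => \sum_(i <- r) f i t).
Proof.
move=> cf; elim: r => [|i r IH].
  by move: (rcont_cst 0); congr rcont; apply/funext => t; rewrite big_nil.
have := rcontD (cf i) IH; congr rcont; apply/funext => t.
by rewrite big_cons.
Qed.

Lemma rcont_id : rcont (fun t : R => t).
Proof. by move=> t _ e e0; exists e. Qed.

Definition stint (a b : R) g F : R := \int[stieltjes F]_(r in `]a, b]) g r.

Section Stieltjes.
Variable F : R -> R.
Hypotheses (ndF : rnondec F) (cF : rcont F).

Lemma stieltjes_itv (a b : R) : 0 <= a -> a <= b ->
  stieltjes F (`]a, b]%classic : set R) = (F b - F a)%:E.
Proof.
move=> a0 ab; rewrite /stieltjes; case: pselect => [h|]; last first.
  case; split.
    move=> s t st; apply: ndF; first by rewrite le_max lexx.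
    by rewrite ge_max !le_max lexx st orbT.
  move=> t; apply: cvg_at_right_filter; exact: rcont_ext.
rewrite [LHS](_ : _ = wlength (cumul h) `]a, b]%classic); last first.
  by apply: (measurable_mu_extE (wlength (cumul h))); exact: is_ocitv.
rewrite wlength_itv_bnd// /cumul /= !max_r//; first exact: le_trans ab.
Qed.

Lemma stint_integrable (a b : R) g : 0 <= a -> a <= b -> rcont g ->
  (stieltjes F).-integrable (`]a, b]%classic : set R) (EFin \o g).
Proof.
move=> a0 ab cg; apply: measurable_bounded_integrable => //.
- by rewrite stieltjes_itv// ltry.
- apply: rcont_measurable => // t /=; rewrite in_itv/= => /andP[at_ _].
  by apply: le_trans a0 (ltW at_).
- have [C _ hC] := rcont_bounded b cg.
  exists C; split; first exact: num_real.
  move=> x Cx t /=; rewrite in_itv/= => /andP[at_ tb].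
  apply: le_trans (ltW Cx); apply: hC; rewrite tb andbT.
  by apply: le_trans a0 (ltW at_).
Qed.

Lemma stint_split (a c b : R) g : 0 <= a -> a <= c -> c <= b -> rcont g ->
  stint a b g F = stint a c g F + stint c b g F.
Proof.
move=> a0 ac cb cg; rewrite /stint -Rintegral_setU//.
- by congr Rintegral; rewrite -itv_bndbnd_setU// bnd_simp.
- rewrite -itv_bndbnd_setU ?bnd_simp//.
  by apply: stint_integrable => //; exact: le_trans cb.
- apply: lt_disjoint => x y; rewrite !in_itv/= => /andP[_ xc] /andP[cy _].
  exact: le_lt_trans cy.
Qed.

(** The Riemann-Stieltjes error of one cell, through which integrals are compared with increments of
    F. *)
Lemma stint_approx (a b : R) g (c e : R) : 0 <= a -> a <= b -> rcont g ->
  (forall r : R, a < r <= b -> `|g r - c| <= e) ->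
  `|stint a b g F - c * (F b - F a)| <= e * (F b - F a).
Proof.
move=> a0 ab cg hg.
have cc := rcont_cst.
have cst k : \int[stieltjes F]_(r in `]a, b]) (fun=> k) r = k * (F b - F a).
  by rewrite Rintegral_cst// stieltjes_itv.
have h1 : stint a b g F <= (c + e) * (F b - F a).
  rewrite -cst; apply: le_Rintegral => //; try exact: stint_integrable.
  move=> r /=; rewrite in_itv/= => /hg; rewrite ler_norml => /andP[]; lra.
have h2 : (c - e) * (F b - F a) <= stint a b g F.
  rewrite -cst; apply: le_Rintegral => //; try exact: stint_integrable.
  move=> r /=; rewrite in_itv/= => /hg; rewrite ler_norml => /andP[]; lra.
rewrite ler_norml; lra.
Qed.

Lemma stint_le (a b : R) g (c : R) : 0 <= a -> a <= b -> rcont g ->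
  (forall r : R, a < r <= b -> g r <= c) -> stint a b g F <= c * (F b - F a).
Proof.
move=> a0 ab cg hg.
have cc := rcont_cst c.
have -> : c * (F b - F a) = \int[stieltjes F]_(r in `]a, b]) (fun=> c) r.
  by rewrite Rintegral_cst// stieltjes_itv.
apply: le_Rintegral => //; try exact: stint_integrable.
Qed.

End Stieltjes.

End RealCurves.

(** * Total variation of real and vector curves, and integrals against them *)

Section ScalarVariation.
Variable R : realType.
Implicit Types (g k : R -> R).

Lemma rcont_eq g k : (forall t : R, 0 <= t -> g t = k t) -> rcont g -> rcont k.
Proof.
move=> gk cg t t0 e e0; have [r r0 h] := cg t t0 e e0.
by exists r => // s s0 st; rewrite -!gk//; exact: h.
Qed.

Lemma rnondec_eq g k : (forall t : R, 0 <= t -> g t = k t) -> rnondec g -> rnondec k.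
Proof.
by move=> gk ng s t s0 st; rewrite -!gk//; [exact: ng|exact: le_trans st].
Qed.

Lemma rcont_within k (b : R) : rcont k -> {within `[0, b], continuous k}.
Proof.
move=> ck; apply/subspace_continuousP => t; rewrite /= in_itv/= => /andP[t0 tb].
apply/cvgrPdist_lt => e e0; have [r r0 h] := ck t t0 e e0.
apply/(nbhs_ballP t); exists r => // s /= ts.
by rewrite in_itv/= => /andP[s0 _]; rewrite distrC; apply: h => //; rewrite distrC.
Qed.

Lemma within_rcont k : (forall b : R, 0 < b -> {within `[0, b], continuous k}) ->
  rcont k.
Proof.
move=> ck t t0 e e0; have t1 : 0 < t + 1 by rewrite ltr_wpDl.
have tI : [set` `[0, t + 1]] t by rewrite /= in_itv/= t0 lerDl ler01.
move: (ck _ t1) => /subspace_continuousP /(_ t tI) /cvgrPdist_lt /(_ e e0).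
move=> /(nbhs_ballP t)[r /= r0 tr].
exists (Num.min r 1) => [|s s0]; first by rewrite lt_min r0/=.
rewrite lt_min => /andP[sr s1]; rewrite distrC; apply: tr.
  by rewrite /ball/= distrC.
rewrite /= in_itv/= s0/=; move: s1; rewrite ltr_norml; lra.
Qed.

Definition tv k (t : R) : R := fine (total_variation 0 t k).

Section BV.
Variable k : R -> R.
Hypothesis ck : rcont k.
Hypothesis bvk : forall t : R, 0 <= t -> (total_variation 0 t k < +oo)%E.

Lemma tv_fin (t : R) : 0 <= t -> total_variation 0 t k \is a fin_num.
Proof. by move=> t0; rewrite ge0_fin_numE ?bvk// total_variation_ge0. Qed.

Lemma tv_fin2 (s t : R) : 0 <= s -> s <= t -> total_variation s t k \is a fin_num.
Proof.
move=> s0 st; have t0 : 0 <= t by exact: le_trans st.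
rewrite ge0_fin_numE ?total_variation_ge0//; apply: le_lt_trans (bvk t0).
by rewrite (total_variationD k s0 st) leeDr// total_variation_ge0.
Qed.

Lemma tv_split (s t : R) : 0 <= s -> s <= t ->
  tv k t = tv k s + fine (total_variation s t k).
Proof.
move=> s0 st; rewrite /tv (total_variationD k s0 st) fineD//; first exact: tv_fin.
exact: tv_fin2.
Qed.

Lemma tv_incr (s t : R) : 0 <= s -> s <= t -> `|k t - k s| <= tv k t - tv k s.
Proof.
move=> s0 st; rewrite (tv_split s0 st) addrAC subrr add0r.
by rewrite -lee_fin fineK ?tv_fin2// total_variation_ge.
Qed.

Lemma tv_nondec : rnondec (tv k).
Proof. by move=> s t s0 st; have := normr_ge0 (k t - k s); have := tv_incr s0 st; lra. Qed.

Lemma tv_rcont : rcont (tv k).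
Proof.
apply: within_rcont => b b0; apply: total_variation_continuous => //.
  exact: rcont_within.
by apply/bounded_variationP; [exact: ltW|exact/tv_fin/ltW].
Qed.

Lemma neg_tvE (t : R) : 0 <= t -> (fine \o neg_tv 0 k) t = (tv k t - k t) / 2.
Proof.
by move=> t0; rewrite /= /neg_tv -(fineK (tv_fin t0)) -EFinB -EFinM.
Qed.

Lemma pos_tvE (t : R) : 0 <= t -> (fine \o pos_tv 0 k) t = (tv k t + k t) / 2.
Proof.
move=> t0; rewrite /= /pos_tv /neg_tv total_variationN -(fineK (tv_fin t0)).
by rewrite -EFinB -EFinM /= opprK.
Qed.

Lemma neg_tv_good : rnondec (fine \o neg_tv 0 k) /\ rcont (fine \o neg_tv 0 k).
Proof.
split.
  apply: (rnondec_eq (fun t t0 => esym (neg_tvE t0))) => s t s0 st.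
  have := tv_incr s0 st; rewrite ler_norml => /andP[]; lra.
apply: (rcont_eq (fun t t0 => esym (neg_tvE t0))).
have := rcontZ 2^-1 (rcontB tv_rcont ck); congr rcont.
by apply/funext => t; rewrite mulrC.
Qed.

Lemma pos_tv_good : rnondec (fine \o pos_tv 0 k) /\ rcont (fine \o pos_tv 0 k).
Proof.
split.
  apply: (rnondec_eq (fun t t0 => esym (pos_tvE t0))) => s t s0 st.
  have := tv_incr s0 st; rewrite ler_norml => /andP[]; lra.
apply: (rcont_eq (fun t t0 => esym (pos_tvE t0))).
have := rcontZ 2^-1 (rcontD tv_rcont ck); congr rcont.
by apply/funext => t; rewrite mulrC.
Qed.

Lemma bv_int_split (a c b : R) g : 0 <= a -> a <= c -> c <= b -> rcont g ->
  bv_int a b g k = bv_int a c g k + bv_int c b g k.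
Proof.
move=> a0 ac cb cg; have [n1 n2] := neg_tv_good; have [p1 p2] := pos_tv_good.
have E (x y : R) : bv_int x y g k = stint x y g (fine \o pos_tv 0 k) -
  stint x y g (fine \o neg_tv 0 k) by [].
rewrite !E (stint_split n1 n2 a0 ac cb cg) (stint_split p1 p2 a0 ac cb cg).
by move: (stint a c) (stint c b) => I J; rewrite opprD addrACA.
Qed.

(** The positive and negative variations differ by k and add up to [tv k]: main terms subtract to
    the increment of k, errors add to that of [tv k]. *)
Lemma bv_int_approx (a b : R) g (c e : R) : 0 <= a -> a <= b -> rcont g ->
  (forall r : R, a < r <= b -> `|g r - c| <= e) ->
  `|bv_int a b g k - c * (k b - k a)| <= e * (tv k b - tv k a).
Proof.
move=> a0 ab cg hg; have b0 : 0 <= b by exact: le_trans ab.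
have [n1 n2] := neg_tv_good; have [p1 p2] := pos_tv_good.
have -> : bv_int a b g k = stint a b g (fine \o pos_tv 0 k) -
  stint a b g (fine \o neg_tv 0 k) by [].
have := stint_approx n1 n2 a0 ab cg hg; have := stint_approx p1 p2 a0 ab cg hg.
rewrite (pos_tvE a0) (pos_tvE b0) (neg_tvE a0) (neg_tvE b0).
move: (stint a b) => I; rewrite !ler_norml => /andP[h1 h2] /andP[h3 h4]; lra.
Qed.

End BV.
End ScalarVariation.

Section VectorVariation.
Variables (R : realType) (d : nat).
Implicit Types (k g : R -> 'rV[R]_d).

Lemma continuousRplus_coord k i : continuousRplus k -> rcont (fun t => k t ord0 i).
Proof.
move=> /continuousRplusP ck t t0 e e0; have [r r0 h] := ck t t0 e e0.
exists r => // s s0 st; apply: le_lt_trans (h s s0 st).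
by have := coord_le_enorm (k s - k t) i; rewrite !mxE.
Qed.

Lemma continuousRplus_unif k (T : R) : continuousRplus k -> forall e : R, 0 < e ->
  exists2 r : R, 0 < r & forall s t : R, 0 <= s <= T -> 0 <= t <= T ->
    `|s - t| <= r -> enorm (k s - k t) < e.
Proof.
move=> /continuousRplusP ck; apply: (@segment_unif_continuous R (fun s t => enorm (k s - k t))).
- by move=> s t; rewrite enorm_distC.
- by move=> r s t; exact: enorm_dist_tri.
- move=> t /andP[t0 _] e e0; have [r r0 hr] := ck t t0 e e0.
  by exists r => // s /andP[s0 _]; exact: hr.
Qed.

Lemma continuousRplus_enorm k : continuousRplus k -> rcont (fun t => enorm (k t)).
Proof.
move=> /continuousRplusP ck t t0 e e0; have [r r0 h] := ck t t0 e e0.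
exists r => // s s0 st; apply: le_lt_trans (h s s0 st).
rewrite ler_norml enorm_sub_ge andbT.
by have := enorm_sub_ge (k t) (k s); rewrite enorm_distC; lra.
Qed.

Lemma continuousRplus_enorm2 k : continuousRplus k -> rcont (fun t => enorm (k t) ^+ 2).
Proof.
move=> ck t t0 e e0.
have [C C0 hC] := rcont_bounded (t + 1) (continuousRplus_enorm ck).
have c1 : 0 < 2 * C + 1 by lra.
have [r r0 h] := continuousRplus_enorm ck t0 (divr_gt0 e0 c1).
exists (Num.min r 1) => [|s s0]; first by rewrite lt_min r0/=.
rewrite lt_min => /andP[sr s1].
have := h s s0 sr; rewrite ltr_pdivlMr//.
have Ct := hC t; have Cs := hC s.
have {}Ct : enorm (k t) <= C.
  by rewrite -(ger0_norm (enorm_ge0 (k t))) Ct// t0 lerDl ler01.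
have {}Cs : enorm (k s) <= C.
  rewrite -(ger0_norm (enorm_ge0 (k s))) Cs// s0/=.
  by move: s1; rewrite ltr_norml; lra.
rewrite subr_sqr normrM; apply: le_lt_trans; rewrite ler_wpM2l//.
by rewrite ger0_norm ?addr_ge0 ?enorm_ge0//; lra.
Qed.

Lemma continuousRplusB k g : continuousRplus k -> continuousRplus g ->
  continuousRplus (fun t => k t - g t).
Proof.
move=> /continuousRplusP ck /continuousRplusP cg; apply/continuousRplusP => t t0 e e0.
have e2 : 0 < e / 2 by lra.
have [r1 r10 h1] := ck t t0 _ e2; have [r2 r20 h2] := cg t t0 _ e2.
exists (Num.min r1 r2) => [|s s0]; first by rewrite lt_min r10.
rewrite lt_min => /andP[/(h1 _ s0) a1 /(h2 _ s0) a2].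
have -> : k s - g s - (k t - g t) = (k s - k t) - (g s - g t).
  by apply/rowP => i; rewrite !mxE; ring.
by apply: le_lt_trans (enormB _ _) _; lra.
Qed.

(** The recursive form of [vvariation], suited to induction on a partition. *)
Fixpoint chain_var k (x : R) (s : seq R) : R :=
  if s is y :: s' then enorm (k y - k x) + chain_var k y s' else 0.

Lemma vvariationE k (a b : R) s : vvariation a b k s = chain_var k a s.
Proof.
elim: s a => [|y s IH] a; first by rewrite /vvariation big_nil.
rewrite /= -IH /vvariation /= big_nat_recl//.
Qed.

Lemma chain_var_coord k (a b : R) s : itv_partition a b s ->
  chain_var k a s <= \sum_(i < d) variation a b (fun t => k t ord0 i) s.
Proof.
move=> _; rewrite -(vvariationE k a b) /vvariation /variation exchange_big /=.
apply: ler_sum => n _; apply: le_trans (enorm_le_sum _) _.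
by apply: ler_sum => i _; rewrite !mxE.
Qed.

Lemma coord_chain_var k (a b : R) s i :
  variation a b (fun t => k t ord0 i) s <= chain_var k a s.
Proof.
rewrite -(vvariationE k a b) /vvariation /variation.
apply: ler_sum => n _; have := coord_le_enorm
  ((k \o nth b (a :: s)) n.+1 - (k \o nth b (a :: s)) n) i.
by rewrite !mxE.
Qed.

Lemma chain_var_rcons k (x y : R) s :
  chain_var k x (rcons s y) = chain_var k x s + enorm (k y - k (last x s)).
Proof. by elim: s x => [|z s IH] x /=; rewrite ?add0r ?addr0// IH addrA. Qed.

(** Two variations are kept. [ctv] measures errors of [vbv_int], which integrates coordinate by
    coordinate, and transfers continuity from the scalar case; [vtv] is the Euclidean variation
    required in the final inequality. *)
Definition ctv k (t : R) := \sum_(i < d) tv (fun r => k r ord0 i) t.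
Definition vtv k (t : R) : R := fine (vtotal_variation t k).

Section BV.
Variable k : R -> 'rV[R]_d.
Hypotheses (ck : continuousRplus k) (bvk : BVloc k).

Lemma BVloc_coord i (t : R) : 0 <= t ->
  (total_variation 0 t (fun r => k r ord0 i) < +oo)%E.
Proof.
move=> t0; apply: le_lt_trans (bvk t0).
apply: ge_ereal_sup => _ [_ [s st <-] <-]; apply: (@le_trans _ _ (vvariation 0 t k s)%:E).
  by rewrite lee_fin vvariationE coord_chain_var.
by apply: ereal_sup_ubound; exists s.
Qed.

Lemma ctv_nondec : rnondec (ctv k).
Proof.
move=> s t s0 st; apply: ler_sum => i _.
by apply: tv_nondec => // r; exact: BVloc_coord.
Qed.

Lemma ctv_rcont : rcont (ctv k).
Proof.
apply: rcont_sum => i; apply: tv_rcont; first exact: continuousRplus_coord.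
by move=> r; exact: BVloc_coord.
Qed.

Lemma vtotal_variation_ge0 (t : R) : 0 <= t -> (0 <= vtotal_variation t k)%E.
Proof.
rewrite le_eqVlt => /predU1P[<-|t0].
  apply: ereal_sup_ubound; exists [::]; first by split.
  by rewrite vvariationE.
apply: (@le_trans _ _ (vvariation 0 t k [:: t])%:E).
  by rewrite lee_fin vvariationE/= addr0 enorm_ge0.
by apply: ereal_sup_ubound; exists [:: t] => //; exact: itv_partition1.
Qed.

Lemma vtv_fineK (t : R) : 0 <= t -> (vtv k t)%:E = vtotal_variation t k.
Proof.
by move=> t0; rewrite fineK// ge0_fin_numE ?vtotal_variation_ge0// bvk.
Qed.

Lemma vtv_ge_chain (t : R) s : 0 <= t -> itv_partition 0 t s ->
  chain_var k 0 s <= vtv k t.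
Proof.
move=> t0 st; rewrite -lee_fin vtv_fineK// -(vvariationE k 0 t).
by apply: ereal_sup_ubound; exists s.
Qed.

Lemma vtv_le (t C : R) : 0 <= t ->
  (forall s, itv_partition 0 t s -> chain_var k 0 s <= C) -> vtv k t <= C.
Proof.
move=> t0 h; rewrite -lee_fin vtv_fineK//; apply: ge_ereal_sup => _ [s st <-].
by rewrite lee_fin vvariationE h.
Qed.

Lemma vtv_incr (a b : R) : 0 <= a -> a <= b ->
  enorm (k b - k a) <= vtv k b - vtv k a.
Proof.
move=> a0; rewrite le_eqVlt => /predU1P[<-|ab]; first by rewrite !subrr enorm0.
suff : vtv k a <= vtv k b - enorm (k b - k a) by lra.
apply: vtv_le => // s [ps /eqP ls].
have : chain_var k 0 (rcons s b) <= vtv k b.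
  apply: vtv_ge_chain; first by lra.
  by split; rewrite ?last_rcons// rcons_path ps ls.
by rewrite chain_var_rcons ls; lra.
Qed.

Lemma vtv_nondec : rnondec (vtv k).
Proof. by move=> a b a0 ab; have := vtv_incr a0 ab; have := enorm_ge0 (k b - k a); lra. Qed.

(** Inserting the point a into the partition can only increase the sum, by the triangle
    inequality. *)
Lemma chain_var_split (x a b : R) s : x <= a -> a <= b -> itv_partition x b s ->
  exists2 s1, itv_partition x a s1 &
    exists2 s2, itv_partition a b s2 &
      chain_var k x s <= chain_var k x s1 + chain_var k a s2.
Proof.
elim: s x => [|y s IH] x xa ab [/= p /eqP l].
  have ax : a = x by lra.
  by exists [::]; [split; rewrite //= ax|exists [::]; [split; rewrite //= ax l|rewrite /= addr0]].
case/andP: p => xy ps.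
have [ya|ay] := leP y a.
  have [s1 [p1 l1] [s2 P2 h]] := IH y ya ab (conj ps (introT eqP l)).
  exists (y :: s1); first by split => //=; rewrite xy.
  by exists s2 => //=; lra.
have [xa'|xa'] := eqVneq x a.
  exists [::]; first by split => //=; apply/eqP.
  exists (y :: s); first by split; rewrite //= -?xa' ?xy//; apply/eqP.
  by rewrite /= add0r xa'.
have xa2 : x < a by rewrite lt_neqAle xa' xa.
exists [:: a]; first exact: itv_partition1.
exists (y :: s); first by split; rewrite //= ?ay//; apply/eqP.
rewrite /= addr0 addrA lerD2r addrC; exact: enorm_dist_tri.
Qed.

(** Continuity of the Euclidean variation follows from this domination by the continuous function
    [ctv]. *)
Lemma vtv_ctv (a b : R) : 0 <= a -> a <= b ->
  vtv k b - vtv k a <= ctv k b - ctv k a.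
Proof.
move=> a0 ab; suff : vtv k b <= vtv k a + (ctv k b - ctv k a) by lra.
apply: vtv_le => [|s P]; first by lra.
have [s1 P1 [s2 P2 h]] := chain_var_split a0 ab P.
apply: le_trans h _; apply: lerD; first exact: vtv_ge_chain.
apply: le_trans (chain_var_coord _ P2) _; rewrite /ctv -sumrB; apply: ler_sum => i _.
have bi := @BVloc_coord i.
rewrite (tv_split bi a0 ab) addrAC subrr add0r -lee_fin fineK ?(tv_fin2 bi)//.
apply: ereal_sup_ubound; exists (variation a b (fun r => k r ord0 i) s2) => //.
exact: variations_variation.
Qed.

Lemma vtv_rcont : rcont (vtv k).
Proof.
move=> t t0 e e0; have [r r0 h] := ctv_rcont t0 e0.
exists r => // s s0 st; apply: le_lt_trans (h s s0 st).
have [ts|ts] := leP t s.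
  have := vtv_nondec t0 ts; have := ctv_nondec t0 ts; have := vtv_ctv t0 ts.
  move: (vtv k s) (vtv k t) (ctv k s) (ctv k t) => a b a' b' *.
  by rewrite !ger0_norm//; lra.
have := vtv_nondec s0 (ltW ts); have := ctv_nondec s0 (ltW ts); have := vtv_ctv s0 (ltW ts).
move: (vtv k s) (vtv k t) (ctv k s) (ctv k t) => a b a' b' *.
by rewrite !ler0_norm//; lra.
Qed.

Lemma dVarE : dVar k = stieltjes (vtv k). Proof. by []. Qed.

Lemma vbv_int_split (a c b : R) g : 0 <= a -> a <= c -> c <= b ->
  continuousRplus g -> vbv_int a b g k = vbv_int a c g k + vbv_int c b g k.
Proof.
move=> a0 ac cb cg; rewrite /vbv_int -big_split /=; apply: eq_bigr => i _.
apply: bv_int_split => //; first exact: continuousRplus_coord.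
- by move=> t; exact: BVloc_coord.
- exact: continuousRplus_coord.
Qed.

Lemma vbv_int_approx (a b : R) g (c : 'rV[R]_d) (e : R) : 0 <= a -> a <= b ->
  continuousRplus g -> (forall r : R, a < r <= b -> enorm (g r - c) <= e) ->
  `|vbv_int a b g k - dotp c (k b - k a)| <= e * (ctv k b - ctv k a).
Proof.
move=> a0 ab cg hg; rewrite /vbv_int /dotp -sumrB.
apply: le_trans (ler_norm_sum _ _ _) _.
rewrite /ctv -sumrB mulr_sumr; apply: ler_sum => i _.
rewrite !mxE; apply: bv_int_approx => //; try exact: continuousRplus_coord.
  by move=> t; exact: BVloc_coord.
move=> r hr; apply: le_trans (hg r hr).
by have := coord_le_enorm (g r - c) i; rewrite !mxE.
Qed.

End BV.
End VectorVariation.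

(** * Almost everywhere statements and Borel representatives *)

Section AeIntegral.
Import HBNNSimple.
Context d (T : measurableType d) (R : realType).
Variable mu : {measure set T -> \bar R}.
Local Open Scope ereal_scope.

Lemma aeS2 (P Q S : T -> Prop) : (forall t, P t -> Q t -> S t) ->
  {ae mu, forall t, P t} -> {ae mu, forall t, Q t} -> {ae mu, forall t, S t}.
Proof. by move=> PQS aP aQ; apply: filterS2 aP aQ. Qed.

Lemma aeS1 (P Q : T -> Prop) : (forall t, P t -> Q t) ->
  {ae mu, forall t, P t} -> {ae mu, forall t, Q t}.
Proof. by move=> PQ; apply: filterS. Qed.

Lemma ae_all (P : T -> Prop) : (forall t, P t) -> {ae mu, forall t, P t}.
Proof. by move=> h; apply: filterS filterT => t _. Qed.

Lemma negligible_bigcup_count (I : countType) (F : I -> set T) :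
  (forall i, mu.-negligible (F i)) -> mu.-negligible (\bigcup_i F i).
Proof.
move=> nF; pose G n := if (unpickle n : option I) is Some i then F i else set0.
apply: (@negligibleS _ _ _ _ (\bigcup_n G n)).
  by move=> t [i _ it]; exists (pickle i) => //; rewrite /G pickleK.
apply: negligible_bigcup => n; rewrite /G; case: unpickle => [i//|].
exact: negligible_set0.
Qed.

Lemma ae_forall_count (I : countType) (P : I -> T -> Prop) :
  (forall i, {ae mu, forall t, P i t}) -> {ae mu, forall t, forall i, P i t}.
Proof.
move=> aP; apply: (@negligibleS _ _ _ mu (\bigcup_i ~` [set t | P i t])).
  move=> t /= h; apply: contrapT => h2; apply: h => i.
  by apply: contrapT => h3; apply: h2; exists i.
exact: negligible_bigcup_count.
Qed.

(* [f] itself need not be measurable: for the lower integral of the library it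
   is enough that [f] agree with a measurable function up to a null set. *)
Lemma ge0_ae_integral (D : set T) (f h : T -> \bar R) : measurable D ->
  (forall x, 0 <= f x) -> (forall x, 0 <= h x) -> measurable_fun D h ->
  {ae mu, forall x, D x -> f x = h x} ->
  \int[mu]_(x in D) f x = \int[mu]_(x in D) h x.
Proof.
move=> mD f0 h0 mh [N [mN N0 fhN]].
have fh x : ~ N x -> (f \_ D) x = (h \_ D) x.
  move=> Nx; rewrite /patch; case: ifPn => // /set_mem Dx.
  by apply: contrapT => fhx; apply: Nx; apply: fhN => /= /(_ Dx).
have f'0 x : 0 <= (f \_ D) x by apply: erestrict_ge0 => y _.
have h'0 x : 0 <= (h \_ D) x by apply: erestrict_ge0 => y _.
have mh' : measurable_fun setT (h \_ D) by apply: (measurable_restrictT h mD).1.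
apply/eqP; rewrite eq_le; apply/andP; split.
  rewrite ge0_integralE//; apply: ge_ereal_sup => _ [s /= sf <-].
  rewrite -integralT_nnsfun [X in _ <= X]integral_mkcond.
  have ms : measurable_fun setT (EFin \o s) by exact/measurable_EFinP/measurable_funPT.
  rewrite (ge0_negligible_integral mN measurableT ms _ N0); last first.
    by move=> x _; rewrite lee_fin.
  rewrite (ge0_negligible_integral mN measurableT mh' _ N0)//.
  apply: ge0_le_integral => //.
  - exact: measurableD.
  - by move=> x _; rewrite lee_fin.
  - exact: measurable_funS ms.
  - exact: measurable_funS mh'.
  - by move=> x [_ Nx]; rewrite -(fh x Nx); exact: sf.
rewrite integral_mkcond (ge0_negligible_integral mN measurableT mh' _ N0)//.
rewrite !ge0_integralE//; apply: ge_ereal_sup => _ [s /= sh <-].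
apply: ereal_sup_ubound; exists s => //= x.
apply: le_trans (sh x) _; rewrite {1}/patch; case: ifPn => [|_ //].
by move=> /set_mem[_ Nx]; rewrite fh.
Qed.

Lemma ae_integral (D : set T) (f h : T -> \bar R) : measurable D ->
  measurable_fun D h -> {ae mu, forall x, D x -> f x = h x} ->
  \int[mu]_(x in D) f x = \int[mu]_(x in D) h x.
Proof.
move=> mD mh fh; rewrite integralE [RHS]integralE; congr (_ - _).
  apply: ge0_ae_integral => //; first exact: measurable_funepos.
  by apply: filterS fh => x fhx Dx; rewrite !funeposE fhx.
apply: ge0_ae_integral => //; first exact: measurable_funeneg.
by apply: filterS fh => x fhx Dx; rewrite !funenegE fhx.
Qed.

Lemma ae_le_integral (D : set T) (f h : T -> \bar R) : measurable D ->
  mu.-integrable D f -> mu.-integrable D h ->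
  {ae mu, forall x, D x -> f x <= h x} ->
  \int[mu]_(x in D) f x <= \int[mu]_(x in D) h x.
Proof.
move=> mD If Ih [N [mN N0 hN]].
rewrite (negligible_integral mN mD If N0) (negligible_integral mN mD Ih N0).
have mDN : measurable (D `\` N) by exact: measurableD.
apply: le_integral => //.
- by apply: integrableS If => // t [].
- by apply: integrableS Ih => // t [].
- move=> t /set_mem [Dt Nt]; apply: contrapT => h0.
  by apply: Nt; apply: hN => /= /(_ Dt).
Qed.

End AeIntegral.

Section AeBorel.
Variable R : realType.
Notation mu := (@lebesgue_measure R).

(** The field is Lebesgue measurable in time whereas integrals are taken over the Borel
    sigma-algebra; a Borel representative bridges the two and survives almost everywhere limits. *)
Definition aeborel (u : R -> R) : Prop :=
  exists2 v : R -> R, measurable_fun setT v &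
    {ae mu, forall t : R, 0 <= t -> u t = v t}.

Lemma measurable_fun_rat (v : R -> R) :
  (forall q : rat, measurable [set t | ratr q < v t]) -> measurable_fun setT v.
Proof.
move=> h; apply: (measurability _ (RGenOInfty.measurableE R)).
move=> _ [_ [a ->] <-]; rewrite setTI.
rewrite (_ : _ @^-1` _ = \bigcup_q
   (if a < ratr q then [set t | ratr q < v t] else set0)).
  by apply: bigcupT_measurable_rat => q; case: ifP.
apply/seteqP; split => t /=.
  rewrite in_itv/= andbT => /rat_in_itvoo[q]; rewrite in_itv/= => /andP[aq qv].
  by exists q => //; rewrite aq.
move=> [q _]; case: ifP => // aq /= qv.
by rewrite in_itv/= andbT (lt_trans aq).
Qed.

(** For each rational q the set where u > q is Borel up to a null Borel set. Outside the union of
    these countably many null sets all such level sets are Borel. *)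
Lemma lebesgue_measurable_aeborel (u : R -> R) :
  lebesgue_measurable_fun `[0, +oo[ u -> aeborel u.
Proof.
move=> mu_u.
have mD : (mu_ext (@wlength R idfun)).-cara.-measurable `[0, +oo[%classic.
  exact: sub_caratheodory.
have hq (q : rat) : exists XN : set R * set R, [/\ measurable XN.1,
    measurable XN.2, mu XN.2 = 0%E, XN.1 `<=` `[0, +oo[ `&` [set t | ratr q < u t] &
    `[0, +oo[ `&` [set t | ratr q < u t] `<=` XN.1 `|` XN.2].
  have mE := mu_u mD `]ratr q, +oo[%classic (measurable_itv _).
  move: mE; rewrite -completed_caratheodory_measurable g_sigma_completed_algebra_genE => -[X mX [N [B [mB B0 NB]] XN]].
  have E : `[0, +oo[ `&` [set t | ratr q < u t] = X `|` N.
    rewrite XN; apply/seteqP; split => t /= [t0 ut]; split => //; move: ut;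
    by rewrite in_itv/= andbT.
  exists (X, B) => /=; split => //; rewrite E.
  - by move=> t; left.
  - by move=> t [|/NB]; [left|right].
have [XN hXN] := choice hq.
pose B := \bigcup_q (XN q).2.
have mB : measurable B by apply: bigcupT_measurable_rat => q; have [] := hXN q.
have B0 : mu B = 0%E.
  have /negligibleP -> // : mu.-negligible B.
  apply: negligible_bigcup_count => q; apply/negligibleP => //; by have [] := hXN q.
pose P := `[0, +oo[%classic `\` B.
have mP : measurable P by exact: measurableD.
exists (u \_ P); last first.
  exists B; split => // t /= ht; apply: contrapT => Bt; apply: ht => t0.
  by rewrite patchT// inE; split => //=; rewrite in_itv/= t0.
apply: measurable_fun_rat => q; have [mX _ _ X1 X2] := hXN q.
(* The representative is 0 outside [P], so for q < 0 the complement of [P] joins the level set. *)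
rewrite (_ : [set _ | _] = ((XN q).1 `\` B) `|` (if ratr q < 0 :> R then ~` P else set0)).
  apply: measurableU; first exact: measurableD.
  by case: ifP => // _; exact: measurableC.
apply/seteqP; split => t /=; rewrite /patch.
  case: ifPn => [|]; rewrite ?inE ?notin_setE.
    move=> [t0 Bt] qu; left; split => //.
    by have [//|Nt] := X2 t (conj t0 qu); exfalso; apply: Bt; exists q.
  by move=> Pt q0; right; rewrite q0.
move=> [[/X1[t0 qu] Bt]|]; first by rewrite mem_set.
by case: ifP => // q0 Pt; rewrite memNset.
Qed.

Lemma measurable_fun_partition (W : R -> nat) (F : nat -> R -> R) :
  (forall j, measurable [set t | W t = j]) -> (forall j, measurable_fun setT (F j)) ->
  measurable_fun setT (fun t => F (W t) t).
Proof.
move=> mW mF _ B mB; rewrite setTI.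
rewrite (_ : _ @^-1` _ = \bigcup_j ([set t | W t = j] `&` (F j @^-1` B))).
  apply: bigcup_measurable => j _; apply: measurableI => //.
  by rewrite -[X in measurable X]setTI; exact: mF.
apply/seteqP; split => t /=; first by move=> FB; exists (W t).
by move=> [j _ [<-]].
Qed.

Lemma measurable_trunc (h : R) : 0 < h ->
  forall j, measurable [set t : R | Num.truncn (t / h) = j].
Proof.
move=> h0 [|j].
  (* [Num.truncn] vanishes on negative numbers, so index 0 covers the whole half-line below h. *)
  rewrite (_ : [set _ | _] = `]-oo, h[%classic)//.
  apply/seteqP; split => t /=; rewrite in_itv/=.
    by move/truncn0Pn; rewrite -ltNge ltr_pdivrMr// mul1r.
  by move=> th; apply/truncn0Pn; rewrite -ltNge ltr_pdivrMr// mul1r.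
rewrite (_ : [set _ | _] = `[j.+1%:R * h, j.+2%:R * h[%classic)//.
apply/seteqP; split => t /=; rewrite in_itv/=.
  move=> tj; have t0 : 0 <= t / h.
    by rewrite leNgt; apply/negP => t0; have : Num.truncn (t / h) = 0%N by [apply/truncn0Pn; rewrite -ltNge; lra]; rewrite tj.
  by have := truncn_itv t0; rewrite tj ler_pdivlMr// ltr_pdivrMr.
move=> tj; apply: truncn_def; by rewrite ler_pdivlMr// ltr_pdivrMr.
Qed.

Lemma aeborel_lim (u_ : nat -> R -> R) (u : R -> R) : (forall n, aeborel (u_ n)) ->
  {ae mu, forall t : R, 0 <= t -> u_ ^~ t @ \oo --> u t} -> aeborel u.
Proof.
move=> bu hu.
have /choice[v hv] : forall n, exists v : R -> R, measurable_fun setT v /\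
    {ae mu, forall t : R, 0 <= t -> u_ n t = v t}.
  by move=> n; have [v] := bu n; exists v.
exists (fun t => fine (limn_esup (fun n => (v n t)%:E))).
  apply: measurableT_comp => //; apply: measurable_fun_limn_esup => n.
  by apply/measurable_EFinP; have [] := hv n.
have := ae_foralln (fun n => (hv n).2); apply: aeS2 hu => t h1 h2 t0.
have := h1 t0; have -> : u_ ^~ t = v ^~ t by apply/funext => n; exact: h2.
move=> vu; have /cvg_limn_einf_sup[_ ->//] : (fun n => (v n t)%:E) @ \oo --> (u t)%:E.
by apply: cvg_EFin => //; exact: nearW.
Qed.

End AeBorel.

(** * Locally integrable functions on R_+, up to null sets *)

Section LocallyIntegrable.
Variable R : realType.
Notation mu := (@lebesgue_measure R).
Implicit Types (u v w : R -> R).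

(** Integrability through a Borel representative, so that integrands such as f(t, x(t)), known to be
    Borel only up to a null set, can be treated. *)
Definition locint u : Prop := exists v, [/\ measurable_fun setT v,
  forall T : R, 0 <= T -> mu.-integrable `[0, T] (EFin \o v) &
  {ae mu, forall t : R, 0 <= t -> u t = v t}].

Definition Int (a b : R) u : R := \int[mu]_(r in `]a, b]) u r.

Lemma Int_ae (a b : R) u v : 0 <= a -> measurable_fun setT v ->
  {ae mu, forall t : R, 0 <= t -> u t = v t} -> Int a b u = Int a b v.
Proof.
move=> a0 mv uv; rewrite /Int /Rintegral; congr fine; apply: ae_integral => //.
  by apply/measurable_EFinP; exact: measurable_funS mv.
apply: aeS1 uv => t h /=.
by rewrite in_itv/= => /andP[at_ _]; rewrite h// (le_trans a0)// ltW.
Qed.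

Lemma Int_closed (a b : R) u : locint u -> 0 <= a ->
  (\int[mu]_(r in `[a, b]) u r)%R = Int a b u.
Proof.
move=> [v [mv _ uv]] a0; rewrite (Int_ae b a0 mv uv) /Int /Rintegral.
congr fine; rewrite [LHS](@ae_integral _ _ _ mu _ _ (EFin \o v))//.
- rewrite integral_itv_obnd_cbnd//.
  by apply/measurable_EFinP; exact: measurable_funS mv.
- by apply/measurable_EFinP; exact: measurable_funS mv.
- apply: aeS1 uv => t h /=.
  by rewrite in_itv/= => /andP[at_ _]; rewrite h// (le_trans a0).
Qed.

Lemma integrable_sub v (a b : R) : (forall T : R, 0 <= T -> mu.-integrable `[0, T] (EFin \o v)) ->
  0 <= a -> mu.-integrable `]a, b] (EFin \o v).
Proof.
move=> iv a0; have [b0|b0] := leP 0 b.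
  apply: integrableS (iv b b0) => // t /=; rewrite !in_itv/= => /andP[at_ ->].
  by rewrite andbT (le_trans a0)// ltW.
by rewrite set_itv_ge ?integrable_set0// bnd_simp -leNgt; lra.
Qed.

Lemma Int_split (a c b : R) u : locint u -> 0 <= a -> a <= c -> c <= b ->
  Int a b u = Int a c u + Int c b u.
Proof.
move=> [v [mv iv uv]] a0 ac cb; have c0 : 0 <= c by exact: le_trans ac.
rewrite !(Int_ae _ _ mv uv)// /Int -Rintegral_setU//.
- by congr Rintegral; rewrite -itv_bndbnd_setU// bnd_simp.
- by rewrite -itv_bndbnd_setU ?bnd_simp//; exact: integrable_sub.
- apply: lt_disjoint => x y; rewrite !in_itv/= => /andP[_ xc] /andP[cy _].
  exact: le_lt_trans cy.
Qed.

Lemma Intxx (a : R) u : Int a a u = 0.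
Proof. by rewrite /Int set_itv_ge ?Rintegral_set0// bnd_simp ltxx. Qed.

Lemma Int_sub (a b : R) u : locint u -> 0 <= a -> a <= b ->
  Int a b u = Int 0 b u - Int 0 a u.
Proof. by move=> lu a0 ab; rewrite (Int_split lu (lexx 0) a0 ab) addrAC subrr add0r. Qed.

(** The comparison is asked on the open interval only, because step functions change their index at
    the right end of a grid cell. *)
Lemma Int_le (a b : R) u w : locint u -> locint w -> 0 <= a ->
  {ae mu, forall t : R, a < t < b -> u t <= w t} -> Int a b u <= Int a b w.
Proof.
move=> [v [mv iv uv]] [v' [mv' iv' wv]] a0 uw.
rewrite (Int_ae b a0 mv uv) (Int_ae b a0 mv' wv).
have [ab|ba] := ltP a b; last first.
  by rewrite /Int set_itv_ge ?Rintegral_set0// bnd_simp -leNgt.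
have vv : {ae mu, forall t : R, `]a, b[%classic t -> (v t <= v' t)%R}.
  have H := aeS2 (fun t h1 h2 => conj h1 h2) uv wv.
  apply: aeS2 uw H => t h1 [h2 h3] /=; rewrite in_itv/= => abt.
  have t0 : 0 <= t by case/andP: abt => at_ _; rewrite (le_trans a0)// ltW.
  by rewrite -h2// -h3// h1.
rewrite /Int /Rintegral fine_le//.
- by apply: integrable_fin_num => //; exact: integrable_sub.
- by apply: integrable_fin_num => //; exact: integrable_sub.
- rewrite -!integral_itv_bndo_bndc; try by apply/measurable_EFinP; exact: measurable_funS mv || exact: measurable_funS mv'.
  have I1 : mu.-integrable `]a, b[ (EFin \o v).
    by apply: integrableS (integrable_sub b iv a0) => //; apply: subset_itvl; rewrite bnd_simp.
  have I2 : mu.-integrable `]a, b[ (EFin \o v').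
    by apply: integrableS (integrable_sub b iv' a0) => //; apply: subset_itvl; rewrite bnd_simp.
  exact: ae_le_integral.
Qed.

Lemma Int_eq (a b : R) u w : locint u -> locint w -> 0 <= a ->
  {ae mu, forall t : R, a < t < b -> u t = w t} -> Int a b u = Int a b w.
Proof.
move=> lu lw a0 uw; apply/eqP; rewrite eq_le !Int_le//;
by apply: aeS1 uw => t h abt; rewrite h.
Qed.

Lemma locintD u w : locint u -> locint w -> locint (fun t => u t + w t).
Proof.
move=> [v [mv iv uv]] [v' [mv' iv' wv]]; exists (v \+ v'); split.
- exact: measurable_funD.
- move=> T T0; rewrite (_ : EFin \o _ = (EFin \o v) \+ (EFin \o v'))%E//.
  by apply: integrableD => //; [exact: iv|exact: iv'].
- by apply: aeS2 uv wv => t h1 h2 t0; rewrite h1// h2.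
Qed.

Lemma IntD (a b : R) u w : locint u -> locint w -> 0 <= a ->
  Int a b (fun t => u t + w t) = Int a b u + Int a b w.
Proof.
move=> [v [mv iv uv]] [v' [mv' iv' wv]] a0.
rewrite (Int_ae b a0 mv uv) (Int_ae b a0 mv' wv).
rewrite (@Int_ae a b _ (v \+ v'))//; last 2 first.
- exact: measurable_funD.
- by apply: aeS2 uv wv => t h1 h2 t0; rewrite h1// h2.
by rewrite /Int RintegralD//; exact: integrable_sub.
Qed.

Lemma locintZ (c : R) u : locint u -> locint (fun t => c * u t).
Proof.
move=> [v [mv iv uv]]; exists (fun t => c * v t); split.
- exact: measurable_funM.
- move=> T T0; rewrite (_ : EFin \o _ = (fun t => c%:E * (EFin \o v) t)%E)//.
  by apply: integrableZl => //; exact: iv.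
- by apply: aeS1 uv => t h1 t0; rewrite h1.
Qed.

Lemma IntZ (a b c : R) u : locint u -> 0 <= a ->
  Int a b (fun t => c * u t) = c * Int a b u.
Proof.
move=> [v [mv iv uv]] a0.
rewrite (Int_ae b a0 mv uv) (@Int_ae a b _ (fun t => c * v t))//.
- by rewrite /Int RintegralZl//; exact: integrable_sub.
- exact: measurable_funM.
- by apply: aeS1 uv => t h1 t0; rewrite h1.
Qed.

Lemma locint0 : locint (fun=> 0).
Proof.
exists (fun=> 0); split; [exact: measurable_cst| |exact: ae_all].
by move=> T T0; exact: integrable0.
Qed.

Lemma Int0 (a b : R) : Int a b (fun=> 0) = 0.
Proof. by rewrite /Int /Rintegral integral0. Qed.

Lemma locint_sum (I : Type) (r : seq I) (u : I -> R -> R) :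
  (forall i, locint (u i)) -> locint (fun t => \sum_(i <- r) u i t).
Proof.
move=> lu; elim: r => [|i r IH].
  by under eq_fun do rewrite big_nil; exact: locint0.
by under eq_fun do rewrite big_cons; exact: locintD.
Qed.

Lemma Int_sum (a b : R) (I : Type) (r : seq I) (u : I -> R -> R) : 0 <= a ->
  (forall i, locint (u i)) ->
  Int a b (fun t => \sum_(i <- r) u i t) = \sum_(i <- r) Int a b (u i).
Proof.
move=> a0 lu; elim: r => [|i r IH].
  by under eq_fun do rewrite big_nil; rewrite big_nil Int0.
under eq_fun do rewrite big_cons.
by rewrite IntD ?IH ?big_cons//; exact: locint_sum.
Qed.

Lemma Int_ge0 (a b : R) u : 0 <= a -> (forall t : R, 0 <= t -> 0 <= u t) -> 0 <= Int a b u.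
Proof.
move=> a0 u0; apply: Rintegral_ge0 => t /=; rewrite in_itv/= => /andP[at_ _].
by apply: u0; rewrite (le_trans a0)// ltW.
Qed.

(** The Borel representatives satisfy the bound only almost everywhere; setting the one of u to 0
    where it fails makes domination hold everywhere. *)
Lemma locint_dom u g : aeborel u -> locint g ->
  {ae mu, forall t : R, 0 <= t -> `|u t| <= g t} -> locint u.
Proof.
move=> [v mv uv] [v' [mv' iv' gv]] ug.
pose A := [set t : R | `|v t| <= v' t].
have mA : measurable A.
  rewrite /A -[X in measurable X]setTI; apply: measurable_fun_le => //.
  exact: measurableT_comp.
exists (v \_ A); split.
- apply: (measurable_restrictT v mA).1; exact: measurable_funS mv.
- move=> T T0; apply: le_integrable (iv' T T0) => //.
    apply/measurable_EFinP; apply: measurable_funTS.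
    apply: (measurable_restrictT v mA).1; exact: measurable_funS mv.
  move=> t _ /=; rewrite lee_fin /patch; case: ifPn => [/set_mem At|_].
    by rewrite (le_trans At)// ler_norm.
  by rewrite normr0.
- have H := aeS2 (fun t h1 h2 => conj h1 h2) uv gv.
  apply: aeS2 ug H => t h1 [h2 h3] t0; rewrite h2// patchT// inE /A/=.
  by rewrite -h2// -h3// h1.
Qed.

Lemma locint_norm_le (a b : R) u g : locint u -> locint g -> 0 <= a ->
  {ae mu, forall t : R, a < t < b -> `|u t| <= g t} ->
  `|Int a b u| <= Int a b g.
Proof.
move=> lu lg a0 ug; rewrite ler_norml; apply/andP; split; last first.
  apply: Int_le => //; apply: aeS1 ug => t h /h.
  by apply: le_trans; exact: ler_norm.
rewrite -mulN1r -IntZ//; apply: Int_le => //; first exact: locintZ.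
apply: aeS1 ug => t h /h.
by rewrite mulN1r lerNl -normrN; apply: le_trans; exact: ler_norm.
Qed.

Lemma Int_cst (a b c : R) : a <= b -> Int a b (fun=> c) = c * (b - a).
Proof.
move=> ab; have H : mu (`]a, b]%classic : set R) = (b - a)%:E.
  rewrite lebesgue_measure_itv/= lte_fin; case: ltP => // ba.
  by have -> : b = a by [lra]; rewrite subrr.
by rewrite /Int Rintegral_cst//; congr (c * _); exact: (congr1 fine H).
Qed.

Lemma rcont_locint u : rcont u -> locint u.
Proof.
move=> cu; exists (u \o Num.max 0); split.
- exact: continuous_measurable_fun (rcont_ext cu).
- move=> T T0; apply: continuous_compact_integrable.
    exact: segment_compact.
  exact/continuous_subspaceT/rcont_ext.
- by apply: ae_all => t t0; rewrite rcont_ext_eq.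
Qed.

Lemma locint_norm u : locint u -> locint (fun t => `|u t|).
Proof.
move=> [v [mv iv uv]]; exists (fun t => `|v t|); split.
- exact: measurableT_comp.
- move=> T T0; apply: le_integrable (iv T T0) => //.
    by apply/measurable_EFinP; apply: measurable_funTS; exact: measurableT_comp.
  by move=> t _ /=; rewrite lee_fin normr_id.
- by apply: aeS1 uv => t h t0; rewrite h.
Qed.

Lemma L1loc_locint u : L1loc (EFin \o u) -> locint u.
Proof.
move=> Lu.
have mn n : measurable_fun `[0, n%:R : R] u.
  by have /integrableP[/measurable_EFinP + _] := Lu n%:R (ler0n _ n).
have mu0 : measurable_fun (`[0, +oo[%classic : set R) u.
  rewrite (_ : `[0, +oo[%classic = \bigcup_n `[0, n%:R]%classic).
    by apply/measurable_fun_bigcup => // n; exact: mn.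
  apply/seteqP; split => t /=; rewrite in_itv/= ?andbT.
    move=> t0; exists (Num.truncn t).+1 => //=; rewrite in_itv/= t0/=.
    by apply/ltW; have /andP[] := truncn_itv t0.
  by move=> [n _] /=; rewrite in_itv/= => /andP[].
exists (u \_ `[0, +oo[); split.
- exact: (measurable_restrictT u (measurable_itv _)).1.
- move=> T T0; apply: eq_integrable (Lu T T0) => // t /set_mem /=.
  rewrite in_itv/= => /andP[t0 _]; rewrite /= patchT// inE/= in_itv/= t0.
  by [].
- by apply: ae_all => t t0; rewrite patchT// inE/= in_itv/= t0.
Qed.

Lemma Int_rcont u : locint u -> rcont (fun t => Int 0 t u).
Proof.
move=> [v [mv iv uv]]; apply: within_rcont => b b0.
have lv : locint v by exists v; split => //; exact: ae_all.
have -> : (Int 0)^~ u = (parameterized_integral mu 0)^~ v.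
  apply/funext => x; rewrite /parameterized_integral Int_closed//.
  exact: Int_ae.
exact: parameterized_integral_continuous (ltW b0) (iv b (ltW b0)).
Qed.

End LocallyIntegrable.

Section DominatedConvergence.
Variable R : realType.
Notation mu := (@lebesgue_measure R).

Lemma Int_cvg (a b : R) (u_ : nat -> R -> R) (u g : R -> R) : 0 <= a ->
  (forall n, locint (u_ n)) -> locint u -> locint g ->
  (forall n, {ae mu, forall t : R, 0 <= t -> `|u_ n t| <= g t}) ->
  {ae mu, forall t : R, 0 <= t -> u_ ^~ t @ \oo --> u t} ->
  (fun n => Int a b (u_ n)) @ \oo --> Int a b u.
Proof.
move=> a0 lu_ [v [mv iv uv]] [w [mw iw gw]] ug uu.
have /choice[v_ hv_] := lu_.
have Iv n := integrable_sub b (let: And3 _ i _ := hv_ n in i) a0.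
have -> : (fun n => Int a b (u_ n)) = (fun n => Int a b (v_ n)).
  by apply/funext => n; have [mvn _ uvn] := hv_ n; exact: Int_ae.
rewrite (Int_ae b a0 mv uv) /Int /Rintegral.
have ae_n : {ae mu, forall t : R, forall n, 0 <= t -> u_ n t = v_ n t}.
  by apply: ae_foralln => n; have [] := hv_ n.
have [] := @dominated_convergence _ _ _ mu `]a, b]%classic _
  (fun n => EFin \o v_ n) (EFin \o v) (EFin \o w).
- exact: measurable_itv.
- by move=> n; apply/measurable_EFinP; have [m _ _] := hv_ n; exact: measurable_funS m.
- by apply/measurable_EFinP; exact: measurable_funS mv.
- have H := aeS2 (fun t h1 h2 => conj h1 h2) ae_n uv.
  apply: aeS2 uu H => t h1 [h2 h3] /=; rewrite in_itv/= => /andP[at_ _].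
  have t0 : 0 <= t by rewrite (le_trans a0)// ltW.
  apply: cvg_EFin; first exact: nearW.
  have -> : fine \o (fun n => (v_ n t)%:E) = u_ ^~ t.
    by apply/funext => n /=; rewrite h2.
  by rewrite /= -h3//; exact: h1.
- exact: integrable_sub.
- have ug' := ae_foralln ug.
  have H := aeS2 (fun t h1 h2 => conj h1 h2) ae_n gw.
  apply: aeS2 ug' H => t h1 [h2 h3] n /=; rewrite in_itv/= => /andP[at_ _].
  have t0 : 0 <= t by rewrite (le_trans a0)// ltW.
  by rewrite lee_fin -h2// -h3//; exact: h1.
move=> _ _ H; apply: fine_cvg; rewrite fineK//.
by apply: integrable_fin_num => //; exact: integrable_sub.
Qed.

End DominatedConvergence.

(** * The vector field: domination and substitution of curves *)

(** For each rational centre and each radius 1/(n+1), a point of D in that ball is chosen when there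
    is one. A rational centre close to x then yields a point close to x. *)
Lemma dense_sequence (R : realType) (d : nat) (D : set 'rV[R]_d) : D !=set0 ->
  exists p : nat -> 'rV[R]_d, (forall n, D (p n)) /\
    forall x, D x -> forall e : R, 0 < e -> exists n, enorm (p n - x) < e.
Proof.
move=> [x1 Dx1].
have /choice[c hc] : forall qn : 'rV[rat]_d * nat, exists y, D y /\
    ((exists2 x, D x & enorm (x - map_mx ratr qn.1) < qn.2.+1%:R^-1) ->
     enorm (y - map_mx ratr qn.1) < qn.2.+1%:R^-1).
  move=> qn; have [[x Dx xq]|nx] := pselect (exists2 x, D x &
    enorm (x - map_mx ratr qn.1) < qn.2.+1%:R^-1); first by exists x.
  by exists x1.
pose p n := if (unpickle n : option ('rV[rat]_d * nat)%type) is Some qn then c qn else x1.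
exists p; split => [n|x Dx e e0].
  by rewrite /p; case: unpickle => [qn|//]; have [] := hc qn.
have e2 : 0 < e / 2 by lra.
have [N /(_ N (leqnn N)) hN] := invS_small e2.
have k0 : 0 < N.+1%:R^-1 / d.+1%:R :> R by rewrite divr_gt0// ?invr_gt0 ltr0n.
have /choice[q hq] : forall i : 'I_d, exists q : rat,
    `|x ord0 i - ratr q| < N.+1%:R^-1 / d.+1%:R.
  move=> i; have := @rat_in_itvoo _ (x ord0 i - N.+1%:R^-1 / d.+1%:R) (x ord0 i + N.+1%:R^-1 / d.+1%:R).
  rewrite ltrD2l gtrN// => /(_ isT)[q]; rewrite in_itv/= => qx; exists q.
  by rewrite ltr_distlC.
pose qn := (\row_i q i, N).
have xq : enorm (x - map_mx ratr qn.1) < N.+1%:R^-1.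
  apply: le_lt_trans (enorm_le_sum _) _.
  apply: (@le_lt_trans _ _ (\sum_(i < d) (N.+1%:R^-1 / d.+1%:R))).
    by apply: ler_sum => i _; rewrite !mxE ltW.
  rewrite sumr_const card_ord -[_ *+ d]mulr_natr mulrAC ltr_pdivrMr ?ltr0n//.
  by rewrite ltr_pM2l ?invr_gt0 ?ltr0n// ltr_nat.
exists (pickle qn); rewrite /p pickleK; have [_ h] := hc qn.
have {}h := h (ex_intro2 _ _ x Dx xq).
apply: le_lt_trans (enorm_dist_tri (map_mx ratr qn.1) _ _) _.
rewrite (enorm_distC _ x).
have h' : enorm (c qn - map_mx ratr qn.1) < e / 2 := lt_trans h hN.
have xq' : enorm (x - map_mx ratr qn.1) < e / 2 := lt_trans xq hN.
lra.
Qed.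

Section VectorField.
Variables (R : realType) (d : nat) (D : set 'rV[R]_d).
Variable f : R -> 'rV[R]_d -> 'rV[R]_d.
Notation mu := (@lebesgue_measure R).
Hypothesis D0 : D !=set0.
Hypothesis f_meas : forall x i, lebesgue_measurable_fun `[0, +oo[ (fun t => f t x ord0 i).
Hypothesis f_cont : {ae mu, forall t : R, 0 <= t -> continuous (f t)}.
Hypothesis f_bound : forall T : R, 0 <= T ->
  (\int[mu]_(s in `[0%R, T]) ereal_sup [set (enorm (f s x))%:E | x in D] < +oo)%E.

Lemma continuous_enorm (g : 'rV[R]_d -> 'rV[R]_d) x : continuous g ->
  forall e : R, 0 < e -> exists2 r : R, 0 < r & forall y, enorm (y - x) < r ->
    enorm (g y - g x) < e.
Proof.
move=> cg e e0; have : nbhs (g x) [set y | enorm (y - g x) < e].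
  by apply/nbhs_enormP; exists e.
by move=> /(cg x) /nbhs_enormP.
Qed.

(** The supremum defining f^# runs over an uncountable set. Continuity in x lets it be replaced, for
    almost every t, by the supremum over a dense sequence, which has a Borel representative with the
    same integral. *)
Lemma vector_field_dominated : exists g : R -> R,
  [/\ locint g, forall t, 0 <= g t &
   {ae mu, forall t : R, 0 <= t -> forall x, D x -> enorm (f t x) <= g t}].
Proof.
have [p [Dp p_dense]] := dense_sequence D0.
have /choice[F hF] : forall ni : nat * 'I_d, exists v : R -> R,
    measurable_fun setT v /\
    {ae mu, forall t : R, 0 <= t -> f t (p ni.1) ord0 ni.2 = v t}.
  move=> ni; have [v mv fv] := lebesgue_measurable_aeborel (f_meas (p ni.1) ni.2).
  by exists v.
pose E n t := enorm (\row_i F (n, i) t).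
have mE n : measurable_fun setT (E n).
  rewrite /E /enorm; apply: measurableT_comp.
    by apply: continuous_measurable_fun => x; exact: sqrt_continuous.
  rewrite /dotp; apply: measurable_sum => i.
  by under eq_fun do rewrite mxE; apply: measurable_funM; have [] := hF (n, i).
pose G t := esups (fun n => (E n t)%:E) 0.
have mG : measurable_fun setT G.
  by apply: measurable_fun_esups => n; apply/measurable_EFinP.
have EG n t : ((E n t)%:E <= G t)%E by apply: ereal_sup_ubound; exists n.
have G0 t : (0 <= G t)%E by apply: le_trans (EG 0%N t); rewrite lee_fin enorm_ge0.
have aeF : {ae mu, forall t : R, forall n, 0 <= t -> E n t = enorm (f t (p n))}.
  apply: ae_foralln => n.
  have H : {ae mu, forall t : R, forall i : 'I_d, 0 <= t ->
      f t (p n) ord0 i = F (n, i) t}.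
    by apply: ae_forall_count => i; have [_] := hF (n, i).
  apply: aeS1 H => t h t0.
  by rewrite /E; congr enorm; apply/rowP => i; rewrite mxE h.
have fG : {ae mu, forall t : R, 0 <= t -> forall x, D x -> ((enorm (f t x))%:E <= G t)%E}.
  apply: aeS2 aeF f_cont => t h1 h2 t0 x Dx; apply/lee_addgt0Pr => e e0.
  have [r r0 hr] := continuous_enorm x (h2 t0) e0.
  have [n pn] := p_dense x Dx r r0.
  apply: (@le_trans _ _ ((E n t)%:E + e%:E)%E); last by rewrite leeD2r.
  rewrite -EFinD lee_fin h1//; have := hr _ pn.
  by have := enorm_sub_ge (f t x) (f t (p n)); rewrite enorm_distC; lra.
have iG T : 0 <= T -> mu.-integrable `[0, T] G.
  move=> T0; apply/integrableP; split; first exact: measurable_funS mG.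
  under eq_integral do rewrite gee0_abs//.
  apply: le_lt_trans (f_bound T0).
  rewrite [X in (_ <= X)%E](@ae_integral _ _ _ mu _ _ G)//.
    exact: measurable_funS mG.
  apply: aeS2 aeF fG => t h1 h2 /=; rewrite in_itv/= => /andP[t0 _].
  apply/eqP; rewrite eq_le; apply/andP; split.
    by apply: ge_ereal_sup => _ [x Dx <-]; exact: h2.
  apply: ge_ereal_sup => _ [n _ <-] /=; rewrite h1//.
  by apply: ereal_sup_ubound; exists (p n).
have Gfin : {ae mu, forall t : R, 0 <= t -> G t \is a fin_num}.
  have H : {ae mu, forall t : R, forall n, `[0, n%:R]%classic t -> G t \is a fin_num}.
    by apply: ae_foralln => n; apply: integrable_ae => //; exact: iG.
  apply: aeS1 H => t h t0.
  apply: (h (Num.truncn t).+1); rewrite /= in_itv/= t0/=.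
  by apply/ltW; have /andP[] := truncn_itv t0.
exists (fine \o G); split.
- exists (fine \o G); split; [exact: measurableT_comp| |exact: ae_all].
  move=> T T0; apply: le_integrable (iG T T0) => //.
    apply/measurable_EFinP; apply: measurable_funTS; exact: measurableT_comp.
  move=> t _ /=; have := G0 t; case: (G t) => [r| |]//= r0.
  by rewrite normr0 leey.
- by move=> t /=; rewrite fine_ge0.
- apply: aeS2 fG Gfin => t h1 h2 t0 x Dx.
  by rewrite -lee_fin /= fineK ?h2//; exact: h1.
Qed.

Section Substitution.
Variables (g : R -> R) (lg : locint g).
Hypothesis fg : {ae mu, forall t : R, 0 <= t -> forall x, D x -> enorm (f t x) <= g t}.

Lemma field_coord_le (xi : R -> 'rV[R]_d) i : (forall t : R, 0 <= t -> D (xi t)) ->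
  {ae mu, forall t : R, 0 <= t -> `|f t (xi t) ord0 i| <= g t}.
Proof.
move=> Dxi; apply: aeS1 fg => t h t0.
by apply: le_trans (coord_le_enorm _ _) _; apply: h => //; exact: Dxi.
Qed.

Lemma field_step_locint (X : nat -> 'rV[R]_d) (h : R) i : 0 < h -> (forall j, D (X j)) ->
  locint (fun t => f t (X (Num.truncn (t / h))) ord0 i).
Proof.
move=> h0 DX; apply: (locint_dom _ lg); last exact: field_coord_le.
have /choice[F hF] : forall j, exists v : R -> R, measurable_fun setT v /\
    {ae mu, forall t : R, 0 <= t -> f t (X j) ord0 i = v t}.
  by move=> j; have [v mv fv] := lebesgue_measurable_aeborel (f_meas (X j) i); exists v.
exists (fun t => F (Num.truncn (t / h)) t).
  apply: (@measurable_fun_partition R (fun t => Num.truncn (t / h))).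
    exact: measurable_trunc.
  by move=> j; have [] := hF j.
have := ae_foralln (fun j => (hF j).2).
by move=> H; apply: aeS1 H => t ht t0; rewrite ht.
Qed.

Section Limit.
Variables (X : nat -> nat -> 'rV[R]_d) (h : nat -> R) (xi : R -> 'rV[R]_d).
Hypothesis h0 : forall n, 0 < h n.
Hypothesis DX : forall n j, D (X n j).
Hypothesis Dxi : forall t : R, 0 <= t -> D (xi t).
Hypothesis Xxi : forall t : R, 0 <= t -> forall e : R, 0 < e ->
  exists N, forall n, (N <= n)%N -> enorm (X n (Num.truncn (t / h n)) - xi t) < e.

Lemma field_step_cvg i : {ae mu, forall t : R, 0 <= t ->
  (fun n => f t (X n (Num.truncn (t / h n))) ord0 i) @ \oo --> f t (xi t) ord0 i}.
Proof.
apply: aeS1 f_cont => t cf t0.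
apply/cvgrPdist_lt => e e0; have [r r0 hr] := continuous_enorm (xi t) (cf t0) e0.
have [N hN] := Xxi t0 r0; exists N => // n /= Nn.
have := hr _ (hN n Nn); apply: le_lt_trans; rewrite distrC.
by have := coord_le_enorm (f t (X n (Num.truncn (t / h n))) - f t (xi t)) i; rewrite !mxE.
Qed.

Lemma field_limit_locint i : locint (fun t => f t (xi t) ord0 i).
Proof.
apply: (locint_dom _ lg); last exact: field_coord_le.
apply: (@aeborel_lim R (fun n t => f t (X n (Num.truncn (t / h n))) ord0 i)).
  move=> n; have [v [mv _ uv]] := field_step_locint i (h0 n) (DX n).
  by exists v.
exact: field_step_cvg.
Qed.

End Limit.

(** Carathéodory's argument: x is the limit of its step interpolations, for which the substituted
    field is glued from countably many functions f(., a), and continuity in x passes to the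
    limit. *)
Lemma field_curve_locint (x : R -> 'rV[R]_d) i : continuousRplus x ->
  (forall t : R, 0 <= t -> D (x t)) -> locint (fun t => f t (x t) ord0 i).
Proof.
move=> /continuousRplusP cx Dx.
pose h n : R := n.+1%:R^-1.
have h0 n : 0 < h n by rewrite invr_gt0 ltr0n.
apply: (@field_limit_locint (fun n j => x (j%:R * h n)) h) => //.
  by move=> n j; apply: Dx; rewrite mulr_ge0// ltW.
move=> t t0 e e0; have [r r0 hr] := cx t t0 e e0.
have [N hN] := invS_small r0.
exists N => n Nn; apply: hr; first by rewrite mulr_ge0// ltW.
have hn : h n < r by exact: hN.
have th : 0 <= t / h n by rewrite divr_ge0// ltW.
have /andP[] := truncn_itv th; rewrite ler_pdivlMr// ltr_pdivrMr// -natr1 mulrDl mul1r => a1 a2.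
rewrite ltr_norml; have := h0 n; move: a1 a2 hn; set y := _%:R * _; lra.
Qed.

End Substitution.
End VectorField.

(** * Additive functions of intervals and vector-valued integrals *)

(** This replaces Riemann sums: an integral inequality whose two sides are additive in the interval
    needs checking only on cells of length at most r. *)
Lemma additive_le0 (R : realType) (H : R -> R -> R) (s t r : R) : 0 < r -> s <= t ->
  (forall a b c, s <= a -> a <= c -> c <= b -> b <= t -> H a b = H a c + H c b) ->
  (forall a b, s <= a -> a <= b -> b <= t -> b - a <= r -> H a b <= 0) ->
  H s t <= 0.
Proof.
move=> r0 st Hadd Hle.
suff H0 n : forall a, s <= a -> a <= t -> t - a <= n%:R * r -> H a t <= 0.
  apply: (H0 (Num.truncn ((t - s) / r)).+1) => //.
  rewrite -ler_pdivrMr//; apply/ltW; exact: truncnS_gt.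
elim: n => [|n IH] a sa at_ tn.
  by apply: Hle => //; move: tn; rewrite mul0r; lra.
have [tr|tr] := leP (t - a) r; first exact: Hle.
have h1 : H (a + r) t <= 0.
  by apply: IH; [lra|lra|move: tn; rewrite -natr1 mulrDl mul1r; lra].
have h2 : H a (a + r) <= 0 by apply: Hle => //; lra.
rewrite (Hadd a t (a + r)) //; lra.
Qed.

Lemma le_small (R : realType) (A B C : R) : 0 <= C ->
  (forall e : R, 0 < e -> A <= B + 2 * e * C) -> A <= B.
Proof.
move=> C0 h; apply/ler_addgt0Pr => /= e e0.
have e1 : 0 < e / (2 * (C + 1)) by rewrite divr_gt0//; lra.
apply: le_trans (h _ e1) _; rewrite lerD2l.
have -> : 2 * (e / (2 * (C + 1))) * C = e * (C / (C + 1)).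
  by field; apply/eqP; lra.
by rewrite ler_piMr ?(ltW e0)// ler_pdivrMr; lra.
Qed.

Section VectorIntegral.
Variables (R : realType) (d : nat).
Notation mu := (@lebesgue_measure R).

Definition vInt (a b : R) (w : R -> 'rV[R]_d) : 'rV[R]_d :=
  \row_i Int a b (fun t => w t ord0 i).

Lemma vint_vInt (t : R) (w : R -> 'rV[R]_d) :
  (forall i, locint (fun t => w t ord0 i)) -> vint t w = vInt 0 t w.
Proof. by move=> lw; apply/rowP => i; rewrite !mxE Int_closed. Qed.

Lemma vInt_split (a c b : R) (w : R -> 'rV[R]_d) :
  (forall i, locint (fun t => w t ord0 i)) -> 0 <= a -> a <= c -> c <= b ->
  vInt a b w = vInt a c w + vInt c b w.
Proof. by move=> lw a0 ac cb; apply/rowP => i; rewrite !mxE (Int_split (lw i) a0 ac cb). Qed.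

Lemma locint_dotp (c : 'rV[R]_d) (w : R -> 'rV[R]_d) :
  (forall i, locint (fun t => w t ord0 i)) -> locint (fun t => dotp c (w t)).
Proof. by move=> lw; apply: locint_sum => i; exact: locintZ. Qed.

Lemma dotp_vInt (a b : R) (c : 'rV[R]_d) (w : R -> 'rV[R]_d) : 0 <= a ->
  (forall i, locint (fun t => w t ord0 i)) ->
  dotp c (vInt a b w) = Int a b (fun t => dotp c (w t)).
Proof.
move=> a0 lw; rewrite /dotp Int_sum// => [|i]; last exact: locintZ.
by apply: eq_bigr => i _; rewrite mxE IntZ.
Qed.

(** Pairing the integral v with itself gives |v|^2 = int <v, w> <= |v| int g, so the Euclidean norm
    costs no dimensional constant. *)
Lemma vInt_norm_le (a b : R) (w : R -> 'rV[R]_d) (g : R -> R) : 0 <= a ->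
  (forall i, locint (fun t => w t ord0 i)) -> locint g ->
  {ae mu, forall t : R, a < t < b -> enorm (w t) <= g t} ->
  enorm (vInt a b w) <= Int a b g.
Proof.
move=> a0 lw lg wg; set v := vInt a b w.
have [v0|v0] := eqVneq v 0.
  rewrite v0 enorm0 -(Int0 a b); apply: Int_le => //; first exact: locint0.
  by apply: aeS1 wg => t h /h; apply: le_trans; exact: enorm_ge0.
have n0 : 0 < enorm v by rewrite lt_neqAle eq_sym enorm_eq0 v0 enorm_ge0.
rewrite -(ler_pM2l n0) -expr2 enorm_sqr {2}/v dotp_vInt// -IntZ//.
apply: Int_le => //; [exact: locint_dotp|exact: locintZ|].
apply: aeS1 wg => t h /h wt.
by apply: le_trans (dotp_le _ _) _; rewrite ler_wpM2l// ltW.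
Qed.

End VectorIntegral.

(** * Uniqueness of the solution *)

Section Uniqueness.
Variables (R : realType) (d : nat) (rho gamma : R) (phi : 'rV[R]_d -> \bar R).
Variables (x0 : 'rV[R]_d) (f : R -> 'rV[R]_d -> 'rV[R]_d) (m : R -> 'rV[R]_d).
Variables (g nu : R -> R).
Notation mu := (@lebesgue_measure R).
Hypotheses (rho0 : 0 <= rho) (gamma0 : 0 <= gamma).
Hypotheses (lg : locint g) (lnu : locint nu) (nu0 : forall t, 0 <= nu t).
Hypothesis g0 : forall t, 0 <= g t.
Let D := closure (edom phi).
Hypothesis f_loc : forall (x : R -> 'rV[R]_d) i, continuousRplus x ->
  (forall t : R, 0 <= t -> D (x t)) -> locint (fun t => f t (x t) ord0 i).
Hypothesis fg : {ae mu, forall t : R, 0 <= t -> forall x, D x -> enorm (f t x) <= g t}.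
Hypothesis f_mono : {ae mu, forall t : R, 0 <= t -> forall x y : 'rV[R]_d,
  dotp (x - y) (f t x - f t y) <= nu t * enorm (x - y) ^+ 2}.

(** Each solution serves as the test curve of the other; the two integrals of phi are finite and
    cancel in the sum. *)
Lemma subdiff_pair x k x' k' (s t Z : R) :
  driven_by_subdiff rho gamma phi x k -> driven_by_subdiff rho gamma phi x' k' ->
  0 <= s -> s <= t -> (forall r : R, s <= r <= t -> enorm (x r - x' r) ^+ 2 <= Z) ->
  vbv_int s t (fun r => x' r - x r) k + vbv_int s t (fun r => x r - x' r) k' <=
  Z * (2 * rho * (t - s) + gamma * (vtv k t - vtv k s + (vtv k' t - vtv k' s))).
Proof.
move=> [[cx ck] [Dx Lx] [bk k0] jx] [[cx' ck'] [Dx' Lx'] [bk' k0'] jx'] s0 st hZ.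
have h1 := jx s t x' s0 st cx'; have h2 := jx' s t x s0 st cx.
have t0 : 0 <= t by exact: le_trans st.
have fin (y : R -> 'rV[R]_d) : L1loc (phi \o y) ->
    (\int[mu]_(r in `[s, t]) phi (y r))%E \is a fin_num.
  move=> Ly; apply: integrable_fin_num => //; apply: integrableS (Ly t t0) => //.
  by move=> r /=; rewrite !in_itv/= => /andP[sr ->]; rewrite (le_trans s0).
have [A EA] : exists A : R, (\int[mu]_(r in `[s, t]) phi (x r))%E = A%:E.
  by exists (fine (\int[mu]_(r in `[s, t]) phi (x r))%E); rewrite fineK//; exact: fin.
have [B EB] : exists B : R, (\int[mu]_(r in `[s, t]) phi (x' r))%E = B%:E.
  by exists (fine (\int[mu]_(r in `[s, t]) phi (x' r))%E); rewrite fineK//; exact: fin.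
have fin_le (J K M N : R) : (J%:E + K%:E <= M%:E + N%:E)%E -> J + K <= M + N.
  by rewrite -!EFinD lee_fin.
rewrite EA EB in h1; rewrite EA EB in h2.
move: {h1 h2} (fin_le _ _ _ _ h1) (fin_le _ _ _ _ h2).
move=> h1 h2.
have e1 : \int[mu]_(r in `[s, t]) (enorm (x' r - x r) ^+ 2) <= Z * (t - s).
  have cz := continuousRplus_enorm2 (continuousRplusB cx' cx).
  rewrite Int_closed//; last exact: rcont_locint.
  rewrite -Int_cst//; apply: Int_le => //; first exact: rcont_locint.
    by apply: rcont_locint; exact: rcont_cst.
  apply: ae_all => r /andP[sr rt]; rewrite enorm_distC; apply: hZ.
  by rewrite (ltW sr) (ltW rt).
have e2 : \int[mu]_(r in `[s, t]) (enorm (x r - x' r) ^+ 2) <= Z * (t - s).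
  by under eq_Rintegral do rewrite enorm_distC.
have e3 : \int[dVar k]_(r in `]s, t]) (enorm (x' r - x r) ^+ 2) <= Z * (vtv k t - vtv k s).
  apply: (stint_le (vtv_nondec bk) (vtv_rcont ck bk) s0 st).
    exact: continuousRplus_enorm2 (continuousRplusB cx' cx).
  by move=> r /andP[sr rt]; rewrite enorm_distC; apply: hZ; rewrite (ltW sr).
have e4 : \int[dVar k']_(r in `]s, t]) (enorm (x r - x' r) ^+ 2) <= Z * (vtv k' t - vtv k' s).
  apply: (stint_le (vtv_nondec bk') (vtv_rcont ck' bk') s0 st).
    exact: continuousRplus_enorm2 (continuousRplusB cx cx').
  by move=> r /andP[sr rt]; apply: hZ; rewrite (ltW sr).
move: e1 e2 e3 e4 h1 h2.
move: (\int[mu]_(r in `[s, t]) (enorm (x' r - x r) ^+ 2))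
  (\int[mu]_(r in `[s, t]) (enorm (x r - x' r) ^+ 2))
  (\int[dVar k]_(r in `]s, t]) (enorm (x' r - x r) ^+ 2))
  (\int[dVar k']_(r in `]s, t]) (enorm (x r - x' r) ^+ 2))
  (vbv_int s t (fun r => x' r - x r) k) (vbv_int s t (fun r => x r - x' r) k')
  (vtv k t) (vtv k s) (vtv k' t) (vtv k' s) => I1 I2 I3 I4 J1 J2 V1 V2 V3 V4 e1 e2 e3 e4 h1 h2.
have := ler_wpM2l rho0 e1; have := ler_wpM2l rho0 e2.
have := ler_wpM2l gamma0 e3; have := ler_wpM2l gamma0 e4; lra.
Qed.

Opaque Int vtv ctv vbv_int.

Definition gronwall_weight (k k' : R -> 'rV[R]_d) (t : R) : R :=
  2 * rho * t + gamma * (vtv k t + vtv k' t) + Int 0 t nu.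

(** A chain rule for |z|^2 along a curve of which only the increments are known, obtained cell by
    cell with an error that vanishes with the oscillation of z. *)
Lemma difference_estimate x k x' k' (s t Z : R) :
  skorohod_solution rho gamma phi x0 f m x k ->
  skorohod_solution rho gamma phi x0 f m x' k' ->
  0 <= s -> s <= t -> (forall r : R, s <= r <= t -> enorm (x r - x' r) ^+ 2 <= Z) ->
  enorm (x t - x' t) ^+ 2 - enorm (x s - x' s) ^+ 2 <=
  2 * Z * (gronwall_weight k k' t - gronwall_weight k k' s).
Proof.
move=> [ex dx] [ex' dx'] s0 st hZ.
have [[cx ck] [Dx Lx] [bk k0] _] := dx.
have [[cx' ck'] [Dx' Lx'] [bk' k0'] _] := dx'.
have t0 : 0 <= t by exact: le_trans st.
have Z0 : 0 <= Z by apply: le_trans (hZ s _); rewrite ?sqr_ge0// lexx.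
pose z r := x r - x' r.
have cz : continuousRplus z by exact: continuousRplusB.
have cz' : continuousRplus (fun r => x' r - x r) by exact: continuousRplusB.
have lf i := f_loc i cx Dx; have lf' i := f_loc i cx' Dx'.
pose w r := f r (x r) - f r (x' r).
have lw i : locint (fun r => w r ord0 i).
  have := locintD (lf i) (locintZ (-1) (lf' i)).
  by congr locint; apply/funext => r; rewrite !mxE mulN1r.
have wE (a b : R) : 0 <= a -> vInt a b w = vInt a b (fun r => f r (x r)) - vInt a b (fun r => f r (x' r)).
  move=> a0; apply/rowP => i; rewrite !mxE -mulN1r -IntZ// -IntD//; last exact: locintZ.
  by congr Int; apply/funext => r; rewrite !mxE mulN1r.
pose C := ctv k t - ctv k s + (ctv k' t - ctv k' s) + 2 * Int s t g.
have C0 : 0 <= C.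
  have := ctv_nondec bk s0 st; have := ctv_nondec bk' s0 st.
  have := Int_ge0 t s0 (fun r _ => g0 r); rewrite /C; lra.
have key (e : R) : 0 < e -> enorm (z t) ^+ 2 - enorm (z s) ^+ 2 <=
    2 * (vbv_int s t (fun r => x' r - x r) k + vbv_int s t z k') +
    2 * Z * Int s t nu + 2 * e * C.
  move=> e0; have [r r0 hr] := continuousRplus_unif t cz e0.
  (* The allowance 2 e (...) is itself additive, so the errors of all cells sum to 2 e C however
     fine the cells are. *)
  pose H a b := enorm (z b) ^+ 2 - enorm (z a) ^+ 2 -
    2 * (vbv_int a b (fun r => x' r - x r) k + vbv_int a b z k') -
    2 * Z * Int a b nu - 2 * e * (ctv k b - ctv k a + (ctv k' b - ctv k' a) + 2 * Int a b g).
  suff : H s t <= 0.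
    rewrite /H /C; move: (vbv_int s t _ k) (vbv_int s t z k') (Int s t nu) (Int s t g) => *; lra.
  apply: (additive_le0 r0 st) => [a b c sa ac cb bt|a b sa ab bt bar].
    have a0 : 0 <= a by exact: le_trans sa.
    rewrite /H (vbv_int_split ck bk a0 ac cb cz') (vbv_int_split ck' bk' a0 ac cb cz).
    rewrite (Int_split lnu a0 ac cb) (Int_split lg a0 ac cb).
    move: (vbv_int a c _ k) (vbv_int c b _ k) (vbv_int a c z k') (vbv_int c b z k').
    move: (Int a c nu) (Int c b nu) (Int a c g) (Int c b g) (ctv k) (ctv k').
    by move: (enorm (z a)) (enorm (z b)) (enorm (z c)) => *; ring.
  have a0 : 0 <= a by exact: le_trans sa.
  have b0 : 0 <= b by exact: le_trans ab.
  have zE : z b - z a = - (k b - k a) + (k' b - k' a) + vInt a b w.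
    have xk y ky : (forall t, 0 <= t -> y t + ky t = x0 + vint t (fun s => f s (y s)) + m t) ->
      (forall i, locint (fun t => f t (y t) ord0 i)) ->
      y b - y a = (m b - m a) + vInt a b (fun r => f r (y r)) - (ky b - ky a).
      move=> ey ly; have := ey b b0; have := ey a a0.
      rewrite !vint_vInt// (vInt_split ly (lexx 0) a0 ab).
      move=> /(canRL (addrK _)) -> /(canRL (addrK _)) ->; vring.
    have -> : z b - z a = (x b - x a) - (x' b - x' a) by rewrite /z; vring.
    by rewrite (xk _ _ ex lf) (xk _ _ ex' lf') wE//; vring.
  have osc u : a <= u <= b -> forall v, a <= v <= b -> enorm (z u - z v) <= e.
    move=> /andP[au ub] v /andP[av vb]; apply/ltW/hr.
    - by rewrite (le_trans a0)//=; lra.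
    - by rewrite (le_trans a0)//=; lra.
    - by rewrite ler_norml; lra.
  have bI : a <= b <= b by rewrite lexx andbT.
  have aI : a <= a <= b by rewrite lexx.
  have kpart c : a <= c <= b -> - dotp (z c) (k b - k a) <=
      vbv_int a b (fun r => x' r - x r) k + e * (ctv k b - ctv k a).
    move=> cI; have := @vbv_int_approx _ _ k ck bk a b _ (- z c) e a0 ab cz'.
    have h : forall r0 : R, a < r0 <= b -> enorm (x' r0 - x r0 - - z c) <= e.
      move=> u /andP[au ub]; have -> : x' u - x u - - z c = z c - z u by rewrite /z; vring.
      by apply: osc => //; rewrite (ltW au).
    by move=> /(_ h); rewrite dotpNl ler_norml => /andP[]; lra.
  have kpart' c : a <= c <= b -> dotp (z c) (k' b - k' a) <=
      vbv_int a b z k' + e * (ctv k' b - ctv k' a).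
    move=> cI; have := @vbv_int_approx _ _ k' ck' bk' a b _ (z c) e a0 ab cz.
    have h : forall r0 : R, a < r0 <= b -> enorm (z r0 - z c) <= e.
      by move=> u /andP[au ub]; apply: osc => //; rewrite (ltW au).
    by move=> /(_ h); rewrite ler_norml => /andP[]; lra.
  have wpart c : a <= c <= b -> dotp (z c) (vInt a b w) <=
      Z * Int a b nu + 2 * e * Int a b g.
    move=> cI; rewrite dotp_vInt// -!IntZ// -IntD//; try exact: locintZ.
    apply: Int_le => //; first exact: locint_dotp.
      by apply: locintD; exact: locintZ.
    apply: aeS2 f_mono fg => u h1 h2 /andP[au ub].
    have u0 : 0 <= u by rewrite (le_trans a0)// ltW.
    have uI : a <= u <= b by rewrite (ltW au) (ltW ub).
    have wn : enorm (w u) <= 2 * g u.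
      apply: le_trans (enormB _ _) _.
      by have := h2 u0 _ (Dx u u0); have := h2 u0 _ (Dx' u u0); lra.
    have -> : z c = z u + (z c - z u) by vring.
    rewrite dotpDl; have := h1 u0 (x u) (x' u); rewrite -/(w u) -/(z u) => h3.
    have h4 := dotp_le (z c - z u) (w u).
    have h5 := ler_pM (enorm_ge0 _) (enorm_ge0 _) (osc c cI u uI) wn.
    have h6 : nu u * enorm (z u) ^+ 2 <= nu u * Z.
      by rewrite ler_wpM2l//; apply: hZ; lra.
    lra.
  (* The increment of |z|^2 is exactly the pairing of dz with both end values; hence the estimates
     at c = a and at c = b. *)
  have sqB (u v : 'rV[R]_d) : enorm u ^+ 2 - enorm v ^+ 2 = dotp u (u - v) + dotp v (u - v).
    by rewrite !enorm_sqr !dotpE (dotpC v u); ring.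
  have dE c : dotp c (z b - z a) =
      - dotp c (k b - k a) + dotp c (k' b - k' a) + dotp c (vInt a b w).
    have tri (u v y : 'rV[R]_d) : dotp c (- u + v + y) = - dotp c u + dotp c v + dotp c y.
      by rewrite !dotpDr dotpNr.
    by rewrite zE tri.
  rewrite /H sqB !dE.
  have := kpart a aI; have := kpart b bI; have := kpart' a aI; have := kpart' b bI.
  have := wpart a aI; have := wpart b bI.
  move: (vbv_int a b _ k) (vbv_int a b z k') (Int a b nu) (Int a b g) (vInt a b w).
  by move=> *; lra.
have pair := subdiff_pair dx dx' s0 st hZ.
have -> : 2 * Z * (gronwall_weight k k' t - gronwall_weight k k' s) =
   2 * (Z * (2 * rho * (t - s) + gamma * (vtv k t - vtv k s + (vtv k' t - vtv k' s)))) +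
   2 * Z * Int s t nu.
  by rewrite /gronwall_weight (Int_sub lnu s0 st); ring.
apply: (le_small C0) => e e0; have := key e e0; move: pair; rewrite -/z /z.
move: (vbv_int s t _ k) (vbv_int s t _ k') => I1 I2 h1 h2; lra.
Qed.

Lemma skorohod_unique x k x' k' :
  m 0 = 0 ->
  skorohod_solution rho gamma phi x0 f m x k ->
  skorohod_solution rho gamma phi x0 f m x' k' ->
  forall t, 0 <= t -> x' t = x t /\ k' t = k t.
Proof.
move=> m0 Sx Sx'.
have [ex [[cx ck] [Dx Lx] [bk k0] _]] := Sx.
have [ex' [[cx' ck'] [Dx' Lx'] [bk' k0'] _]] := Sx'.
have lf i := f_loc i cx Dx; have lf' i := f_loc i cx' Dx'.
have start y ky : (forall t, 0 <= t -> y t + ky t = x0 + vint t (fun s => f s (y s)) + m t) ->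
   (forall i, locint (fun t => f t (y t) ord0 i)) -> ky 0 = 0 -> y 0 = x0.
  move=> ey ly ky0; have := ey 0 (lexx 0); rewrite ky0 m0 !addr0 vint_vInt// => ->.
  by rewrite (_ : vInt _ _ _ = 0) ?addr0//; apply/rowP => i; rewrite !mxE Intxx.
have z0 : x 0 - x' 0 = 0 by rewrite (start _ _ ex lf k0) (start _ _ ex' lf' k0') subrr.
have cQ : rcont (gronwall_weight k k').
  apply: rcontD; last exact: Int_rcont.
  apply: rcontD; first by apply: rcontZ; exact: rcont_id.
  by apply: rcontZ; apply: rcontD; exact: vtv_rcont.
have zT (T : R) : 0 <= T -> x T = x' T.
  (* On steps on which the weight varies by less than 1/4, the difference estimate reads Z <= 2 Z /
     4 and forces Z = 0. *)
  move=> T0; have q4 : (0 : R) < 4^-1 by rewrite invr_gt0.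
  have [r r0 hr] := rcont_unif T cQ q4.
  suff H n : forall t : R, 0 <= t <= T -> t <= n%:R * r -> x t = x' t.
    apply: (H (Num.truncn (T / r)).+1); first by rewrite T0 lexx.
    by rewrite -ler_pdivrMr//; apply/ltW; exact: truncnS_gt.
  elim: n => [|n IH] t /andP[t0 tT] tn.
    have -> : t = 0 by move: tn; rewrite mul0r; lra.
    by apply/subr0_eq.
  have [tn'|tn'] := leP t (n%:R * r); first by apply: IH => //; rewrite t0.
  pose s := n%:R * r; have s0 : 0 <= s by rewrite mulr_ge0// ltW.
  have cz := @rcont_within R _ t (continuousRplus_enorm2 (continuousRplusB cx cx')).
  have cz' : {within `[s, t], continuous (fun r => enorm (x r - x' r) ^+ 2)}.
    apply: continuous_subspaceW cz => u /=; rewrite !in_itv/= => /andP[su ->].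
    by rewrite (le_trans s0).
  (* At a maximum point [c] of |x - x'|^2 on [s, t], its value is both the bound Z on [s, c] and the
     quantity being estimated. *)
  have [c cI hc] := EVT_max (ltW tn') cz'.
  move: cI; rewrite in_itv/= => /andP[sc ct].
  have xs : x s = x' s by apply: IH => //; rewrite s0/= ltW// (lt_le_trans tn').
  have := @difference_estimate x k x' k' s c (enorm (x c - x' c) ^+ 2) Sx Sx' s0 sc.
  have h : forall r1 : R, s <= r1 <= c -> enorm (x r1 - x' r1) ^+ 2 <= enorm (x c - x' c) ^+ 2.
    by move=> u /andP[su uc]; apply: hc; rewrite in_itv/= su (le_trans uc).
  move=> /(_ h); rewrite xs subrr enorm0 expr0n/= subr0.
  have := hr c s; rewrite s0 (le_trans s0 sc) (le_trans ct tT)/=.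
  have -> : s <= T by rewrite ltW// (lt_le_trans tn').
  have csr : `|c - s| <= r.
    by rewrite ger0_norm ?subr_ge0//; move: tn; rewrite /s -natr1 mulrDl mul1r; lra.
  move=> /(_ isT isT csr); rewrite ltr_norml => /andP[_ q1].
  set Z := enorm _ ^+ 2; have Z0 : 0 <= Z by exact: sqr_ge0.
  move=> ZZ; have Zle : Z <= 0.
    have := ler_wpM2l Z0 (ltW q1); lra.
  have := hc t; rewrite in_itv/= (ltW tn') lexx => /(_ isT).
  move=> /le_trans => /(_ _ Zle) ht.
  apply/subr0_eq/eqP; rewrite -enorm_eq0 -sqrf_eq0 eq_le ht sqr_ge0.
  by [].
move=> t t0; have xt := zT t t0; split; first by [].
have := ex t t0; have := ex' t t0.
have -> : vint t (fun s => f s (x' s)) = vint t (fun s => f s (x s)).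
  apply/rowP => i; rewrite !mxE; apply: eq_Rintegral => s.
  by rewrite inE/= in_itv/= => /andP[s0 _]; rewrite zT.
by rewrite xt => <- /addrI ->.
Qed.

End Uniqueness.

(** * The Euler scheme: grids, construction, compactness and limit *)

Section Grid.
Variable R : realType.

Lemma step_itv (h t : R) : 0 < h -> 0 <= t ->
  (Num.truncn (t / h))%:R * h <= t < (Num.truncn (t / h)).+1%:R * h.
Proof.
move=> h0 t0; have th : 0 <= t / h by rewrite divr_ge0// ltW.
by have := truncn_itv th; rewrite ler_pdivlMr// ltr_pdivrMr.
Qed.

Lemma step_leq (h s t : R) : 0 < h -> s <= t ->
  (Num.truncn (s / h) <= Num.truncn (t / h))%N.
Proof. by move=> h0 st; apply: le_truncn; rewrite ler_pM2r// invr_gt0. Qed.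

Lemma step_gap (h s t : R) : 0 < h -> 0 <= s -> s <= t ->
  (Num.truncn (t / h))%:R * h - (Num.truncn (s / h))%:R * h <= t - s + h.
Proof.
move=> h0 s0 st; have /andP[h1 _] := step_itv h0 (le_trans s0 st).
have /andP[_] := step_itv h0 s0; rewrite -natr1 mulrDl mul1r; lra.
Qed.

Lemma grid_truncn (h : R) j : 0 < h -> Num.truncn (j%:R * h / h) = j.
Proof. by move=> h0; rewrite mulfK ?gt_eqF// natrK. Qed.

Variable h : nat -> R.
Hypothesis h0 : forall n, 0 < h n.
Hypothesis h_cvg : forall e : R, 0 < e -> \forall n \near \oo, h n <= e.

Lemma grid_cvg (t e : R) : 0 <= t -> 0 < e ->
  \forall n \near \oo, `|(Num.truncn (t / h n))%:R * h n - t| <= e.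
Proof.
move=> t0 e0; apply: filterS (h_cvg e0) => n hn.
have /andP[h1] := step_itv (h0 n) t0; rewrite -natr1 mulrDl mul1r => h2.
rewrite ler_norml; lra.
Qed.

(** Dominated convergence treats the fixed interval [0, b]; the piece between the last grid node and
    b is bounded by the integral of g, uniformly in n. *)
Lemma Int_grid_cvg (u_ : nat -> R -> R) (u g : R -> R) (b e : R) : 0 <= b -> 0 < e ->
  (forall n, locint (u_ n)) -> locint u -> locint g ->
  (forall n, {ae lebesgue_measure, forall t : R, 0 <= t -> `|u_ n t| <= g t}) ->
  {ae lebesgue_measure, forall t : R, 0 <= t -> u_ ^~ t @ \oo --> u t} ->
  \forall n \near \oo,
    `|Int 0 ((Num.truncn (b / h n))%:R * h n) (u_ n) - Int 0 b u| <= e.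
Proof.
move=> b0 e0 lu_ lu lg ug uu.
have e2 : 0 < e / 2 by lra.
have := @Int_cvg R 0 b u_ u g (lexx 0) lu_ lu lg ug uu.
move=> /cvgrPdist_le /(_ _ e2) H1.
have [r r0 hr] := Int_rcont lg b0 e2.
have r2 : 0 < r / 2 by lra.
have H2 := grid_cvg b0 r2.
apply: filterS2 H1 H2 => n /= H1 H2.
have /andP[tb _] := step_itv (h0 n) b0.
have t0 : 0 <= (Num.truncn (b / h n))%:R * h n by rewrite mulr_ge0// ltW.
move: H2 tb t0; move: (_%:R * h n) => t H2 tb t0.
have := hr t t0 (le_lt_trans H2 _) => /(_ ltac:(lra)); rewrite distrC => H3.
have H4 : `|Int 0 b (u_ n) - Int 0 t (u_ n)| <= `|Int 0 b g - Int 0 t g|.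
  rewrite -!Int_sub//; apply: le_trans (ler_norm _).
  apply: locint_norm_le => //.
  apply: aeS1 (ug n) => s h1 /andP[ts _].
  by apply: h1; rewrite (le_trans t0)// ltW.
move: H1 H3 H4; rewrite !ler_norml ltr_norml.
move: (Int _ _ _) (Int _ _ _) (Int _ _ _) (Int 0 b g) (Int 0 t g) => I1 I2 I3 I4 I5.
move=> /andP[? ?] /andP[? ?]; have := ler_norm (I4 - I5); case: ger0P => *; lra.
Qed.

(** All nodes within one step of t are allowed, because both the node before t and its successor
    occur below. *)
Lemma grid_curve_cvg (d : nat) (x : R -> 'rV[R]_d) (X : nat -> nat -> 'rV[R]_d) :
  continuousRplus x ->
  (forall T e : R, 0 < e -> \forall n \near \oo, forall j, j%:R * h n <= T ->
     enorm (X n j - x (j%:R * h n)) <= e) ->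
  forall t e : R, 0 <= t -> 0 < e ->
  \forall n \near \oo, forall j, `|j%:R * h n - t| <= h n -> enorm (X n j - x t) <= e.
Proof.
move=> /continuousRplusP cx Xx t e t0 e0; have e2 : 0 < e / 2 by lra.
have [r r0 hr] := cx t t0 (e / 2) e2.
have r2 : 0 < Num.min 1 (r / 2) by rewrite lt_min ltr01/=; lra.
apply: filterS2 (Xx (t + 1) _ e2) (h_cvg r2) => n a1.
rewrite le_min => /andP[a2 a3] j jt.
have t'0 : 0 <= j%:R * h n by rewrite mulr_ge0// ltW.
have jT : j%:R * h n <= t + 1 by move: jt; rewrite ler_norml; lra.
have jr : `|j%:R * h n - t| < r by lra.
have := hr _ t'0 jr; have := a1 _ jT; set t' := _ * h n.
by have := enorm_dist_tri (x t') (X n j) (x t); lra.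
Qed.

Lemma grid_step_cvg (d : nat) (x : R -> 'rV[R]_d) (X : nat -> nat -> 'rV[R]_d) :
  continuousRplus x ->
  (forall T e : R, 0 < e -> \forall n \near \oo, forall j, j%:R * h n <= T ->
     enorm (X n j - x (j%:R * h n)) <= e) ->
  forall t e : R, 0 <= t -> 0 < e ->
  \forall n \near \oo, enorm (X n (Num.truncn (t / h n)) - x t) <= e.
Proof.
move=> cx Xx t e t0 e0; apply: filterS (grid_curve_cvg cx Xx t0 e0) => n; apply.
have /andP[h1] := step_itv (h0 n) t0; rewrite -natr1 mulrDl mul1r => h2.
rewrite ler_norml; lra.
Qed.

End Grid.

Section Construction.
Variables (R : realType) (d : nat) (rho gamma L delta sigma : R).
Variables (D : set 'rV[R]_d) (psi : 'rV[R]_d -> R).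
Hypothesis S : skorohod_data rho gamma L delta sigma D psi.
Variables (x0 : 'rV[R]_d) (f : R -> 'rV[R]_d -> 'rV[R]_d) (m : R -> 'rV[R]_d) (g : R -> R).
Notation mu := (@lebesgue_measure R).
Hypothesis Dx0 : D x0.
Hypotheses (lg : locint g) (g0 : forall t, 0 <= g t).
Hypothesis fg : {ae mu, forall t : R, 0 <= t -> forall x, D x -> enorm (f t x) <= g t}.
Hypothesis f_meas : forall x i, lebesgue_measurable_fun `[0, +oo[ (fun t => f t x ord0 i).
Hypotheses (cm : continuousRplus m) (m0 : m 0 = 0).

Lemma field_cst_locint a i : D a -> locint (fun t => f t a ord0 i).
Proof.
move=> Da; apply: (locint_dom _ lg); first exact: lebesgue_measurable_aeborel.
by apply: (field_coord_le fg (xi := fun=> a)).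
Qed.

(** Explicit in the field and implicit in the subdifferential: on each cell f is evaluated at the
    left iterate, so the next data increment is known before the proximal step. *)
Definition euler_scheme (h : R) (X M : nat -> 'rV[R]_d) : Prop :=
  [/\ discrete_scheme rho gamma D psi h X M, X 0%N = x0 &
   forall j, M j = x0 + vInt 0 (j%:R * h) (fun s => f s (X (Num.truncn (s / h)))) +
                   m (j%:R * h)].

Lemma truncn_step (h s : R) j : 0 < h -> j%:R * h < s < j.+1%:R * h ->
  Num.truncn (s / h) = j.
Proof.
move=> h0 /andP[h1 h2]; apply: truncn_def.
by rewrite ler_pdivlMr// ltr_pdivrMr// (ltW h1).
Qed.

Lemma euler_scheme_exists (h : R) : 0 < h -> exists X M, euler_scheme h X M.
Proof.
move=> h0.
pose F j a := vInt (j%:R * h) (j.+1%:R * h) (fun s => f s a) + (m (j.+1%:R * h) - m (j%:R * h)).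
(* The implication stands under the existential so that the choice function is total; [DX] supplies
   its premise by induction. *)
have /choice[P hP] : forall ja : nat * 'rV[R]_d, exists z, D ja.2 ->
    [/\ D z, forall y, D y -> dotp (ja.2 + F ja.1 ja.2 - z) (y - z) + h * psi z <=
     h * psi y + (rho * h + gamma * enorm (ja.2 + F ja.1 ja.2 - z)) * enorm (y - z) ^+ 2 &
     enorm (ja.2 + F ja.1 ja.2 - z) ^+ 2 <= enorm (ja.2 + F ja.1 ja.2 - ja.2) ^+ 2 +
       2 * h * (psi ja.2 - psi z)].
  move=> [j a] /=; have [Da|nDa] := pselect (D a); last by exists 0.
  by have [z hz] := prox_step S (a + F j a) h0 Da; exists z.
pose X := fix X j := if j is j'.+1 then P (j', X j') else x0.
have DX j : D (X j).
  by elim: j => [//|j IH] /=; have [] := hP (j, X j) IH.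
pose M j := x0 + vInt 0 (j%:R * h) (fun s => f s (X (Num.truncn (s / h)))) + m (j%:R * h).
have lX i : locint (fun s => f s (X (Num.truncn (s / h))) ord0 i).
  exact: (field_step_locint f_meas lg fg).
have jh0 j : 0 <= j%:R * h by rewrite mulr_ge0// ltW.
have jh j : j%:R * h <= j.+1%:R * h by rewrite ler_pM2r// ler_nat.
have MS j : M j.+1 - M j = F j (X j).
  rewrite /M (vInt_split lX (lexx 0) (jh0 j) (jh j)) /F.
  have -> : vInt (j%:R * h) (j.+1%:R * h) (fun s => f s (X (Num.truncn (s / h)))) =
     vInt (j%:R * h) (j.+1%:R * h) (fun s => f s (X j)).
    apply/rowP => i; rewrite !mxE; apply: Int_eq => //; first exact: field_cst_locint.
    by apply: ae_all => s /(truncn_step h0) ->.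
  vring.
have pushE j : (M j.+1 - X j.+1) - (M j - X j) = X j + F j (X j) - X j.+1.
  by rewrite -MS; vring.
exists X, M; split => //; split => //.
- by move=> j y Dy; rewrite pushE; have [_ h1 _] := hP (j, X j) (DX j); exact: h1.
- move=> j; rewrite pushE MS; have [_ _] := hP (j, X j) (DX j) => /=.
  by have -> : X j + F j (X j) - X j = F j (X j) by [rewrite addrC addKr].
Qed.

Lemma euler_start h X M : euler_scheme h X M -> M 0%N = x0.
Proof.
move=> [_ _ ->]; rewrite mul0r m0 addr0 (_ : vInt _ _ _ = 0) ?addr0//.
by apply/rowP => i; rewrite !mxE Intxx.
Qed.

Lemma euler_M_incr h X M i j : euler_scheme h X M -> (i <= j)%N ->
  enorm (M j - M i) <= enorm (m (j%:R * h) - m (i%:R * h)) + (Int 0 (j%:R * h) g - Int 0 (i%:R * h) g).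
Proof.
move=> [sch _ ME] ij; have h0 := scheme_step sch.
have i0 : 0 <= i%:R * h by rewrite mulr_ge0// ltW.
have ijh : i%:R * h <= j%:R * h by rewrite ler_pM2r// ler_nat.
have lX c : locint (fun s => f s (X (Num.truncn (s / h))) ord0 c).
  exact: (field_step_locint f_meas lg fg _ h0 (scheme_dom sch)).
rewrite !ME (vInt_split lX (lexx 0) i0 ijh).
set A := vInt 0 _ _; set B := vInt _ _ _.
have -> : x0 + (A + B) + m (j%:R * h) - (x0 + A + m (i%:R * h)) =
  (m (j%:R * h) - m (i%:R * h)) + B by vring.
apply: le_trans (enormD _ _) _; rewrite lerD2l -(Int_sub lg i0 ijh).
apply: vInt_norm_le => //.
apply: aeS1 fg => t h1 /andP[it _].
by apply: h1; [rewrite (le_trans i0)// ltW|exact: scheme_dom sch _].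
Qed.

Lemma euler_M_modulus (T e : R) : 0 < e -> exists2 tau : R, 0 < tau &
  forall h X M i j, euler_scheme h X M -> (i <= j)%N -> j%:R * h <= T ->
    j%:R * h - i%:R * h <= tau -> enorm (M j - M i) <= e.
Proof.
move=> e0; have e2 : 0 < e / 2 by lra.
have [r1 r10 h1] := continuousRplus_unif T cm e2.
have [r2 r20 h2] := rcont_unif T (Int_rcont lg) e2.
exists (Num.min r1 r2) => [|h X M i j E ij jT]; first by rewrite lt_min r10.
rewrite le_min => /andP[a1 a2].
have [sch _ _] := E; have h0 := scheme_step sch.
have i0 : 0 <= i%:R * h by rewrite mulr_ge0// ltW.
have ijh : i%:R * h <= j%:R * h by rewrite ler_pM2r// ler_nat.
have aT : 0 <= i%:R * h <= T by rewrite i0 (le_trans ijh).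
have bT : 0 <= j%:R * h <= T by rewrite (le_trans i0 ijh).
have nE : `|j%:R * h - i%:R * h| = j%:R * h - i%:R * h by rewrite ger0_norm// subr_ge0.
have := euler_M_incr E ij.
have := h1 _ _ bT aT; rewrite nE => /(_ a1) b1.
have := h2 _ _ bT aT; rewrite nE => /(_ a2); rewrite ltr_norml => /andP[_ b2].
move: b1 b2; move: (Int _ _ _) (Int _ _ _) => I1 I2; lra.
Qed.

(** The data M have a modulus of continuity uniform in h, given by m and the integral of g. This
    makes [scheme_modulus] applicable to every short window, wherever it starts below time T. *)
Lemma euler_window : exists V0 C eta : R, [/\ 0 < V0, 0 <= C, 0 < eta &
  forall T e : R, 0 < e -> 2 * e <= eta -> exists2 tau : R, 0 < tau &
  exists2 hmax : R, 0 < hmax &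
  forall h X M, euler_scheme h X M -> h <= hmax ->
  forall i n, (i + n)%:R * h <= T -> n%:R * h <= tau ->
   (forall l, (l <= n)%N -> enorm (X (i + l)%N - X i) ^+ 2 <= C * (2 * e)) /\
   push_var (fun j => X (i + j)%N) (fun j => M (i + j)%N) n <= V0].
Proof.
have [V0 [C [eta [V00 C0 eta0 hmod]]]] := scheme_modulus S.
exists V0, C, eta; split => // T e e0 e_eta.
have [ej ej0 hjump] := scheme_jump S eta0.
have [t1 t10 h1] := euler_M_modulus T e0.
have [t2 t20 h2] := euler_M_modulus T ej0.
exists (Num.min t1 e); first by rewrite lt_min t10.
(* Both demands of [scheme_jump]: h <= [ej], and one step of M moves by at most [ej]. *)
exists (Num.min ej t2); first by rewrite lt_min ej0.
move=> h X M E; rewrite le_min => /andP[hej ht2] i n inT.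
rewrite le_min => /andP[nt1 ne].
have [sch _ _] := E; have h0 := scheme_step sch.
have sch' := scheme_shift i sch.
have le_T l : (l <= n)%N -> (i + l)%:R * h <= T.
  by move=> ln; apply: le_trans inT; rewrite ler_pM2r// ler_nat leq_add2l.
have := hmod _ _ _ sch' n e; rewrite addn0.
have a1 l : (l <= n)%N -> enorm (M (i + l)%N - M i) <= e.
  move=> ln; apply: (h1 h X M i (i + l)%N E (leq_addr _ _) (le_T l ln)).
  rewrite natrD mulrDl addrAC subrr add0r; apply: le_trans nt1.
  by rewrite ler_pM2r// ler_nat.
have a2 l : (l < n)%N -> enorm (push_step (fun j => X (i + j)%N) (fun j => M (i + j)%N) l) <= eta.
  move=> ln; apply: hjump sch' _ hej _ => /=.
  apply: (h2 h X M _ _ E _ (le_T _ ln)); first by rewrite addnS leqnSn.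
  by rewrite addnS -natr1 mulrDl mul1r addrAC subrr add0r.
have a3 : e + n%:R * h <= eta by lra.
move=> /(_ a1 a2 a3)[b1 b2]; split => // l ln.
apply: le_trans (b1 l ln) _; rewrite ler_wpM2l//; lra.
Qed.

Lemma euler_equicontinuous (T e : R) : 0 < e -> exists2 tau : R, 0 < tau &
  exists2 hmax : R, 0 < hmax & forall h X M, euler_scheme h X M -> h <= hmax ->
  forall i j, (i <= j)%N -> j%:R * h <= T -> j%:R * h - i%:R * h <= tau ->
    enorm (X j - X i) <= e.
Proof.
move=> e0; have [V0 [C [eta [V00 C0 eta0 hw]]]] := euler_window.
pose e1 := Num.min (eta / 2) (e ^+ 2 / (2 * (C + 1))).
have e10 : 0 < e1.
  by rewrite lt_min !divr_gt0 ?exprn_gt0//; apply: mulr_gt0 => //; lra.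
have e1eta : 2 * e1 <= eta.
  by have : e1 <= eta / 2 by [rewrite /e1 ge_min lexx]; lra.
have Ce1 : C * (2 * e1) <= e ^+ 2.
  have : e1 <= e ^+ 2 / (2 * (C + 1)) by rewrite /e1 ge_min lexx orbT.
  by rewrite ler_pdivlMr; [|lra]; lra.
have [tau tau0 [hm hm0 H]] := hw T e1 e10 e1eta.
exists tau => //; exists hm => // h X M E hh i j ij jT ijt.
have jE : j = (i + (j - i))%N by rewrite subnKC.
have := H h X M E hh i (j - i)%N; rewrite -jE natrB// mulrBl.
move=> /(_ jT ijt)[/(_ (j - i)%N (leqnn _)) + _]; rewrite -jE => h1.
rewrite -(@ler_pXn2r _ 2)// ?nnegrE ?enorm_ge0//; last exact: ltW.
exact: le_trans h1 _.
Qed.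

Lemma euler_variation (T : R) : 0 <= T -> exists2 V : R, 0 <= V &
  exists2 hmax : R, 0 < hmax & forall h X M, euler_scheme h X M -> h <= hmax ->
  forall j, j%:R * h <= T -> push_var X M j <= V.
Proof.
move=> T0; have [V0 [C [eta [V00 C0 eta0 hw]]]] := euler_window.
have e10 : 0 < eta / 2 by lra.
have e1eta : 2 * (eta / 2) <= eta by lra.
have [tau tau0 [hm hm0 H]] := hw T (eta / 2) e10 e1eta.
exists (V0 * (1 + 2 * T / tau)).
  by rewrite mulr_ge0 ?(ltW V00)// addr_ge0// divr_ge0 ?(ltW tau0)// mulr_ge0.
exists (Num.min hm (tau / 2)) => [|h X M E]; first by rewrite lt_min hm0 divr_gt0.
rewrite le_min => /andP[hhm htau] j jT.
have [sch _ _] := E; have h0 := scheme_step sch.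
apply: le_trans (scheme_var_total (ltW V00) sch tau0 htau _) _.
  move=> i n inj nt; have [|_ //] := H h X M E hhm i n _ nt.
  by apply: le_trans jT; rewrite ler_pM2r// ler_nat.
rewrite ler_pM2l// lerD2l ler_pM2r ?invr_gt0//; lra.
Qed.

Lemma euler_bounded (T : R) : 0 <= T -> exists2 B : R, 0 <= B &
  exists2 hmax : R, 0 < hmax & forall h X M, euler_scheme h X M -> h <= hmax ->
  forall j, j%:R * h <= T -> enorm (X j) <= B.
Proof.
move=> T0; have [V V0 [hm hm0 H]] := euler_variation T0.
have [B1 B10 hB1] := rcont_bounded T (continuousRplus_enorm cm).
have [B2 B20 hB2] := rcont_bounded T (Int_rcont lg).
exists (enorm x0 + (B1 + B2) + V); first by rewrite !addr_ge0// enorm_ge0.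
exists hm => // h X M E hh j jT; have [sch X0 _] := E; have h0 := scheme_step sch.
have jT0 : 0 <= j%:R * h <= T by rewrite mulr_ge0//= ltW.
have h1 := euler_M_incr E (leq0n j); rewrite mul0r m0 subr0 Intxx subr0 (euler_start E) in h1.
have h2 := le_trans (ler_norm _) (hB1 _ jT0); have h3 := le_trans (ler_norm _) (hB2 _ jT0).
have h4 := le_trans (push_le_var X M j) (H h X M E hh j jT).
have -> : X j = x0 + (M j - x0) - (pushing X M j - pushing X M 0).
  by rewrite /pushing X0 (euler_start E); vring.
have := enormB (x0 + (M j - x0)) (pushing X M j - pushing X M 0).
have := enormD x0 (M j - x0).
by move: h1 h2 h3 h4; move: (Int _ _ _) => I1; lra.
Qed.

Lemma euler_step_equicontinuous (T e : R) : 0 < e -> exists2 tau : R, 0 < tau &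
  exists2 hmax : R, 0 < hmax & forall h X M, euler_scheme h X M -> h <= hmax ->
  forall s t : R, 0 <= s -> s <= t -> t <= T -> t - s <= tau ->
    enorm (X (Num.truncn (t / h)) - X (Num.truncn (s / h))) <= e.
Proof.
move=> e0; have [tau tau0 [hm hm0 H]] := euler_equicontinuous T e0.
exists (tau / 2); first by lra.
exists (Num.min hm (tau / 2)) => [|h X M E]; first by rewrite lt_min hm0/=; lra.
rewrite le_min => /andP[hhm htau] s t s_ge0 st tT ts.
have [sch _ _] := E; have h0 := scheme_step sch.
apply: (H h X M E hhm); first exact: step_leq.
  by have /andP[/le_trans->] := step_itv h0 (le_trans s_ge0 st).
apply: le_trans (step_gap h0 s_ge0 st) _; lra.
Qed.

(** An Arzelà-Ascoli argument: pointwise limits along the ultrafilter, made locally uniform by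
    equicontinuity, and finally an ordinary subsequence. *)
Lemma euler_limit : exists (x : R -> 'rV[R]_d) (h : nat -> R) (X M : nat -> nat -> 'rV[R]_d),
  [/\ continuousRplus x, forall t, 0 <= t -> D (x t),
   forall n, euler_scheme (h n) (X n) (M n),
   forall e : R, 0 < e -> \forall n \near \oo, h n <= e &
   forall T e : R, 0 < e -> \forall n \near \oo, forall j, j%:R * h n <= T ->
     enorm (X n j - x (j%:R * h n)) <= e].
Proof.
pose hh n : R := n.+1%:R^-1.
have hh0 n : 0 < hh n by rewrite invr_gt0 ltr0n.
have hh_cvg (e : R) : 0 < e -> \forall n \near \oo, hh n <= e.
  move=> e0; have [N hN] := invS_small e0.
  by exists N => // n /hN /ltW.
have /choice[XM hXM] : forall n, exists XM : (nat -> 'rV[R]_d) * (nat -> 'rV[R]_d),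
    euler_scheme (hh n) XM.1 XM.2.
  by move=> n; have [X [M E]] := euler_scheme_exists (hh0 n);
     exists (X, M).
have [U UU U_oo] := ultra_oo.
have FU : ProperFilter U by exact: ultra_proper.
have U_near (P : nat -> Prop) : (\forall n \near \oo, P n) -> U [set n | P n].
  by move=> [N _ hN]; apply: filterS (U_oo N) => n; exact: hN.
pose xn n (t : R) := (XM n).1 (Num.truncn (t / hh n)).
have /choice[x hx] : forall t : R, exists l, 0 <= t -> forall e : R, 0 < e ->
    U [set n | enorm (xn n t - l) < e].
  move=> t; have [t0|t0] := leP 0 t; last by exists 0.
  have [B B0 [hm hm0 hB]] := euler_bounded t0.
  have [|l hl] := @ultra_row R d U (xn^~ t) B UU; last by exists l.
  apply: U_near; apply: filterS (hh_cvg _ hm0) => n hn.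
  by apply: hB (hXM n) hn _ _; have /andP[] := step_itv (hh0 n) t0.
have eqc (T e : R) : 0 < e -> exists2 tau : R, 0 < tau &
   (\forall n \near \oo, forall s t : R, 0 <= s -> s <= t -> t <= T -> t - s <= tau ->
      enorm (xn n t - xn n s) <= e) /\
   forall s t : R, 0 <= s -> s <= t -> t <= T -> t - s <= tau -> enorm (x t - x s) <= 3 * e.
  move=> e0; have [tau tau0 [hm hm0 H]] := euler_step_equicontinuous T e0.
  have H1 : \forall n \near \oo, forall s t : R, 0 <= s -> s <= t -> t <= T ->
      t - s <= tau -> enorm (xn n t - xn n s) <= e.
    by apply: filterS (hh_cvg _ hm0) => n hn; exact: H (hXM n) hn.
  exists tau => //; split => // s t s0 st tT ts.
  have [n [[a1 a2] a3]] := filter_ex (filterI (filterI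
    (hx s s0 e e0) (hx t (le_trans s0 st) e e0)) (U_near _ H1)).
  have := a3 s t s0 st tT ts.
  have := enorm_dist_tri (xn n t) (x t) (x s).
  have := enorm_dist_tri (xn n s) (xn n t) (x s).
  by move: a1 a2 => /=; rewrite (enorm_distC (xn n t) (x t)); lra.
have eqc_abs (T e : R) : 0 < e -> exists2 tau : R, 0 < tau &
   forall s t : R, 0 <= s <= T -> 0 <= t <= T -> `|t - s| <= tau -> enorm (x t - x s) <= e.
  move=> e0; have e3 : 0 < e / 3 by lra.
  have [tau tau0 [_ H]] := eqc T (e / 3) e3.
  exists tau => // s t /andP[s0 sT] /andP[t0 tT] ts.
  have [st|ts'] := leP s t.
    apply: le_trans (H s t s0 st tT _) _; last by lra.
    exact: le_trans (ler_norm _) ts.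
  rewrite enorm_distC; apply: le_trans (H t s t0 (ltW ts') sT _) _; last by lra.
  by apply: le_trans (ler_norm _) _; rewrite distrC.
have unif (T e : R) : 0 < e -> U [set n | forall j, j%:R * hh n <= T ->
     enorm ((XM n).1 j - x (j%:R * hh n)) <= e].
  move=> e0; have e5 : 0 < e / 5 by lra.
  have [tau tau0 [H1 H2]] := eqc T (e / 5) e5.
  (* A finite net of mesh [tau] covers [0, T]. From a node to the net one pays e/5 for the scheme,
     e/5 for convergence at the net point, and 3e/5 for x. *)
  pose P := (Num.truncn (T / tau)).+1.
  have H3 : U [set n | forall p : 'I_P, enorm (xn n (p%:R * tau) - x (p%:R * tau)) < e / 5].
    apply: filter_forall => p; apply: hx => //.
    by rewrite mulr_ge0// ltW.
  apply: filterS2 (U_near _ H1) H3 => n /= a1 a2 j jT.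
  have jh0 : 0 <= j%:R * hh n by rewrite mulr_ge0// ltW.
  have := step_itv tau0 jh0; set p := Num.truncn _ => /andP[b1 b2].
  have pP : (p < P)%N by rewrite ltnS; exact: step_leq.
  have p0 : 0 <= p%:R * tau by rewrite mulr_ge0// ltW.
  have pj : j%:R * hh n - p%:R * tau <= tau.
    by move: b2; rewrite -natr1 mulrDl mul1r; lra.
  have := a1 _ _ p0 b1 jT pj; rewrite {1}/xn grid_truncn//.
  have := H2 _ _ p0 b1 jT pj; have := a2 (Ordinal pP) => /=.
  set q := p%:R * tau; set t := j%:R * hh n.
  have := enorm_dist_tri (xn n q) ((XM n).1 j) (x t).
  have := enorm_dist_tri (x q) (xn n q) (x t).
  by rewrite (enorm_distC (x t) (x q)); lra.
(* The k-th term is chosen with error 1/(k+1) on [0, k], which turns convergence along the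
   ultrafilter into convergence along [nn]. *)
have /choice[nn hnn] : forall k : nat, exists n, (k <= n)%N /\
    forall j, j%:R * hh n <= k%:R -> enorm ((XM n).1 j - x (j%:R * hh n)) <= hh k.
  move=> k; have [n [a1 a2]] := filter_ex (filterI (U_oo k) (unif k%:R _ (hh0 k))).
  by exists n.
exists x, (hh \o nn), (fun k => (XM (nn k)).1), (fun k => (XM (nn k)).2).
have cx : continuousRplus x.
  apply/continuousRplusP => t t0 e e0; have e2 : 0 < e / 2 by lra.
  have [tau tau0 H] := eqc_abs (t + 1) (e / 2) e2.
  exists (Num.min tau 1); first by rewrite lt_min tau0/=.
  move=> s s0; rewrite lt_min => /andP[h1 h2].
  apply: le_lt_trans (H t s _ _ (ltW h1)) _; [|move: h2; rewrite ltr_norml|]; lra.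
split => //.
- move=> t t0; apply: (dom_closed S) => e e0.
  have [n /= hn] := filter_ex (hx t t0 e e0).
  by exists (xn n t) => //; have [sch _ _] := hXM n; exact: scheme_dom sch _.
- by move=> n; exact: hXM.
- move=> e e0; have [N _ hN] := hh_cvg e e0; exists N => // k /= Nk.
  by apply: hN; apply: leq_trans Nk _; have [] := hnn k.
- move=> T e e0; have [N _ hN] := hh_cvg e e0.
  exists (maxn N (Num.truncn T).+1) => // k /=; rewrite geq_max => /andP[Nk Tk] j jT.
  have [_ H] := hnn k; apply: le_trans (H j _) (hN _ Nk).
  apply: le_trans jT _; apply: le_trans (ltW (truncnS_gt T)) _.
  by rewrite ler_nat.
Qed.

Hypothesis f_cont : {ae mu, forall t : R, 0 <= t -> continuous (f t)}.

Section PushLimit.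
Variables (x : R -> 'rV[R]_d) (h : nat -> R) (X M : nat -> nat -> 'rV[R]_d).
Hypotheses (cx : continuousRplus x) (Dx : forall t, 0 <= t -> D (x t)).
Hypothesis E : forall n, euler_scheme (h n) (X n) (M n).
Hypothesis h_cvg : forall e : R, 0 < e -> \forall n \near \oo, h n <= e.
Hypothesis Xx : forall T e : R, 0 < e -> \forall n \near \oo, forall j,
  j%:R * h n <= T -> enorm (X n j - x (j%:R * h n)) <= e.

Lemma euler_push_cvg (t e : R) : 0 <= t -> 0 < e -> \forall n \near \oo,
  enorm (pushing (X n) (M n) (Num.truncn (t / h n)) -
    (x0 + vInt 0 t (fun s => f s (x s)) + m t - x t)) <= e.
Proof.
move=> t0 e0.
have h0 n : 0 < h n by have [sch _ _] := E n; exact: scheme_step sch.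
have DX n j : D (X n j) by have [sch _ _] := E n; exact: scheme_dom sch _.
have e3 : 0 < e / 3 by lra.
have H1 := grid_step_cvg h0 h_cvg cx Xx t0 e3.
have [r r0 hr] := (continuousRplusP m).1 cm t t0 (e / 3) e3.
have r2 : 0 < r / 2 by lra.
have rr : r / 2 < r by lra.
have H2 := grid_cvg h0 h_cvg t0 r2.
have ed : 0 < e / 3 / (d%:R + 1) by rewrite divr_gt0// ltr_wpDl.
have Xxi (u : R) : 0 <= u -> forall e : R, 0 < e ->
    exists N, forall n, (N <= n)%N -> enorm (X n (Num.truncn (u / h n)) - x u) < e.
  move=> u0 e1 e10; have e12 : 0 < e1 / 2 by lra.
  have [N _ hN] := grid_step_cvg h0 h_cvg cx Xx u0 e12.
  by exists N => n /hN /= hn; lra.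
have H3 : \forall n \near \oo, forall i : 'I_d,
    `|Int 0 ((Num.truncn (t / h n))%:R * h n) (fun s => f s (X n (Num.truncn (s / h n))) ord0 i) -
      Int 0 t (fun s => f s (x s) ord0 i)| <= e / 3 / (d%:R + 1).
  apply: filter_forall => i.
  apply: (Int_grid_cvg h0 h_cvg (u_ := fun n s => f s (X n (Num.truncn (s / h n))) ord0 i)
    (u := fun s => f s (x s) ord0 i) (g := g)) => //.
  - by move=> n; exact: (field_step_locint f_meas lg fg).
  - exact: (field_curve_locint f_meas f_cont lg fg).
  - by move=> n; apply: (field_coord_le fg) => s s0; exact: DX.
  - exact: (field_step_cvg f_cont).
apply: filterS2 (filterI H1 H2) H3 => n [a1 a2] a3.
have t'0 : 0 <= (Num.truncn (t / h n))%:R * h n by rewrite mulr_ge0// ltW.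
have a4 := hr _ t'0 (le_lt_trans a2 rr).
have [_ _ ME] := E n; rewrite /pushing ME.
move: a1 a4 a3; set j := Num.truncn _; set A := vInt 0 (_ * _) _; set B := vInt _ _ _ => a1 a4 a3.
have a5 : enorm (A - B) <= e / 3.
  apply: le_trans (enorm_le_sum _) _.
  apply: (@le_trans _ _ (\sum_(i < d) e / 3 / (d%:R + 1))).
    by apply: ler_sum => i _; rewrite !mxE; exact: a3.
  have d1 : d%:R + 1 != 0 :> R by rewrite gt_eqF// ltr_wpDl.
  rewrite sumr_const card_ord -(mulr_natr (e / 3 / (d%:R + 1)) d) -[leRHS](divfK d1).
  by rewrite ler_wpM2l ?(ltW ed)// lerDl.
have -> : x0 + A + m (j%:R * h n) - X n j - (x0 + B + m t - x t) =
  (A - B) + (m (j%:R * h n) - m t) - (X n j - x t) by vring.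
have := enormB ((A - B) + (m (j%:R * h n) - m t)) (X n j - x t).
have := enormD (A - B) (m (j%:R * h n) - m t); lra.
Qed.

End PushLimit.

End Construction.

(** * Sharp increment inequalities and their passage to the limit *)

Section Increment.
Variables (R : realType) (d : nat) (rho gamma L delta sigma : R).
Variables (D : set 'rV[R]_d) (psi : 'rV[R]_d -> R).
Hypothesis S : skorohod_data rho gamma L delta sigma D psi.

(** Summing the scheme inequality over a window on which X moves by at most eta: recentring at X_0
    costs eta |dK| per step and eta in the radius. The full variation appears, and the sharp form
    below trades it for the norm of the increment. *)
Lemma scheme_increment h X M n (eta : R) : discrete_scheme rho gamma D psi h X M ->
  0 <= eta -> (forall l, (l < n)%N -> enorm (X l.+1 - X 0%N) <= eta) ->
  forall y, D y ->
   dotp (pushing X M n - pushing X M 0) (y - X 0%N) + h * \sum_(l < n) psi (X l.+1) <=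
   n%:R * h * psi y +
   (rho * (n%:R * h) + gamma * push_var X M n) * (enorm (y - X 0%N) + eta) ^+ 2 +
   eta * push_var X M n.
Proof.
move=> sch eta0 Xeta y Dy; have h0 := scheme_step sch.
have rho0 := rho_ge0 S; have gamma0 := gamma_ge0 S.
rewrite push_sum dotp_suml mulr_sumr -big_split /=.
set Q := (enorm _ + eta) ^+ 2.
apply: (@le_trans _ _ (\sum_(l < n) (h * (psi y + rho * Q) +
  (gamma * Q + eta) * enorm (push_step X M l)))); last first.
  rewrite big_split /= sumr_const card_ord -mulr_sumr -/(push_var X M n).
  rewrite -(mulr_natr (h * _) n); move: (push_var X M n) => V; clear; nra.
apply: ler_sum => l _; have := scheme_ineq sch l Dy.
rewrite -/(pushing X M l.+1) -/(pushing X M l) -/(push_step X M l).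
set s := push_step X M l => h1.
have -> : dotp s (y - X 0%N) = dotp s (y - X l.+1) + dotp s (X l.+1 - X 0%N).
  by rewrite -dotpDr; congr dotp; vring.
have h2 := le_trans (dotp_le s (X l.+1 - X 0%N))
  (ler_wpM2l (enorm_ge0 s) (Xeta l (ltn_ord l))).
have h3 : enorm (y - X l.+1) ^+ 2 <= Q.
  rewrite ler_pXn2r// ?nnegrE ?enorm_ge0 ?addr_ge0 ?enorm_ge0//.
  apply: le_trans (enorm_dist_tri (X 0%N) _ _) _; rewrite lerD2l enorm_distC.
  exact: Xeta.
have h4 : 0 <= rho * h + gamma * enorm s.
  by rewrite addr_ge0// mulr_ge0// ?enorm_ge0// ltW.
have h5 := ler_wpM2l h4 h3.
move: h1 h2 h5; move: (enorm s) (enorm (y - X l.+1) ^+ 2) => v w.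
move: (dotp _ _) (dotp _ _) (psi _) (psi _) => d1 d2 p1 p2; lra.
Qed.

Lemma scheme_increment_sharp h X M n (eps : R) : discrete_scheme rho gamma D psi h X M ->
  (0 < n)%N -> 0 < eps <= 1 ->
  (forall l, (l < n)%N -> enorm (X l.+1 - X 0%N) <= eps ^+ 2) ->
  forall y, D y ->
   dotp (pushing X M n - pushing X M 0) (y - X 0%N) + h * \sum_(l < n) psi (X l.+1) <=
   n%:R * h * psi y +
   (rho * (n%:R * h) + gamma * enorm (pushing X M n - pushing X M 0)) *
     enorm (y - X 0%N) ^+ 2 +
   (rho + gamma + 1) * (108 + 256 * gamma) * eps * (n%:R * h + push_var X M n) *
     (1 + enorm (y - X 0%N)) ^+ 2.
Proof.
move=> sch n0 eps01 Xeps; have h0 := scheme_step sch.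
have DX := scheme_dom sch.
apply: (variation_to_increment S (Y := fun l : 'I_n => X l.+1)) => //.
- by rewrite mulr_gt0// ltr0n.
- exact: push_le_var.
- by move=> l; exact: Xeps.
- by move: (\sum_(l < n) _) => s; ring.
- by apply: (scheme_increment sch) => //; exact: sqr_ge0.
Qed.

End Increment.

Section EnormConvergence.
Variables (R : realType) (d : nat) (F : set_system nat).
Context {FF : Filter F}.

Definition ecvg (u_ : nat -> 'rV[R]_d) (u : 'rV[R]_d) := forall e : R, 0 < e -> \forall n \near F, enorm (u_ n - u) <= e.

Lemma ecvgD (u_ v_ : nat -> 'rV[R]_d) (u v : 'rV[R]_d) : ecvg u_ u -> ecvg v_ v -> ecvg (fun n => u_ n + v_ n) (u + v).
Proof.
move=> hu hv e e0; have e2 : 0 < e / 2 by lra.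
apply: filterS2 (hu _ e2) (hv _ e2) => n a1 a2.
have -> : u_ n + v_ n - (u + v) = (u_ n - u) + (v_ n - v) by vring.
by apply: le_trans (enormD _ _) _; lra.
Qed.

Lemma ecvgN (u_ : nat -> 'rV[R]_d) (u : 'rV[R]_d) : ecvg u_ u -> ecvg (fun n => - u_ n) (- u).
Proof.
move=> hu e e0; apply: filterS (hu _ e0) => n.
by rewrite -opprD enormN.
Qed.

Lemma ecvg_cst (u : 'rV[R]_d) : ecvg (fun=> u) u.
Proof. by move=> e e0; apply: nearW => n; rewrite subrr enorm0 ltW. Qed.

Lemma ecvg_enorm (u_ : nat -> 'rV[R]_d) (u : 'rV[R]_d) : ecvg u_ u -> (fun n => enorm (u_ n)) @ F --> enorm u.
Proof.
move=> hu; apply/cvgrPdist_le => e e0; apply: filterS (hu e e0) => n a1.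
have := enorm_sub_ge (u_ n) u; have := enorm_sub_ge u (u_ n).
by rewrite (enorm_distC u) ler_norml; lra.
Qed.

(** Polarization reduces convergence of inner products to convergence of norms. *)
Lemma dotp_polar (u v : 'rV[R]_d) : dotp u v = 4^-1 * (enorm (u + v) ^+ 2 - enorm (u - v) ^+ 2).
Proof.
rewrite !enorm_sqr !(dotpDl, dotpDr, dotpNl, dotpNr) (dotpC v u).
by move: (dotp u u) (dotp v v) (dotp u v) => a b c; field.
Qed.

Lemma ecvg_dotp (u_ v_ : nat -> 'rV[R]_d) (u v : 'rV[R]_d) : ecvg u_ u -> ecvg v_ v ->
  (fun n => dotp (u_ n) (v_ n)) @ F --> dotp u v.
Proof.
move=> hu hv; rewrite dotp_polar.
have -> : (fun n => dotp (u_ n) (v_ n)) =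
  (fun n => 4^-1 * (enorm (u_ n + v_ n) ^+ 2 - enorm (u_ n - v_ n) ^+ 2)).
  by apply/funext => n; exact: dotp_polar.
have h1 := ecvg_enorm (ecvgD hu hv).
have h2 := ecvg_enorm (ecvgD hu (ecvgN hv)).
by apply: cvgM; [exact: cvg_cst|apply: cvgB; apply: cvgM].
Qed.

End EnormConvergence.

Lemma continuousRplus_cst (R : realType) (d : nat) (c : 'rV[R]_d) :
  continuousRplus (fun=> c).
Proof.
by apply/continuousRplusP => t t0 e e0; exists 1 => // s _ _; rewrite subrr enorm0.
Qed.

Section LimitPassage.
Variables (R : realType) (d : nat) (rho gamma L delta sigma : R).
Variables (D : set 'rV[R]_d) (psi : 'rV[R]_d -> R).
Hypothesis S : skorohod_data rho gamma L delta sigma D psi.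
Notation mu := (@lebesgue_measure R).

Lemma psi_lsc_curve (y : R -> 'rV[R]_d) : continuousRplus y ->
  (forall t, 0 <= t -> D (y t)) ->
  measurable_fun setT (psi \o y \o Num.max (0 : R)).
Proof.
move=> /continuousRplusP cy Dy; apply/measurable_EFinP.
apply: lower_semicontinuous_measurable => t a /=; rewrite lte_fin => a_lt.
have t0 : 0 <= Num.max 0 t by rewrite le_max lexx.
have e0 : 0 < psi (y (Num.max 0 t)) - a by lra.
have [r r0 hr] := psi_lsc S (Dy _ t0) e0.
have [r' r'0 hr'] := cy _ t0 r r0.
exists (ball t r'); first exact: nbhsx_ballx.
move=> s; rewrite /ball /= => st; rewrite lte_fin.
have s0 : 0 <= Num.max 0 s by rewrite le_max lexx.
suff st' : `|Num.max 0 s - Num.max 0 t| < r'.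
  by have := hr _ (Dy _ s0) (hr' _ s0 st'); lra.
by rewrite distrC in st; apply: le_lt_trans st; exact: max0_contraction.
Qed.

Lemma psi_curve_le (y : R -> 'rV[R]_d) : (forall t, 0 <= t -> D (y t)) ->
  forall t, 0 <= t -> `|psi (y t)| <= (`|psi (y 0)| + L) + L * enorm (y t - y 0).
Proof.
move=> Dy t t0; have := psi_growth S (Dy t t0) (Dy 0 (lexx 0)).
have -> : psi (y t) = (psi (y t) - psi (y 0)) + psi (y 0) by ring.
by have := ler_normD (psi (y t) - psi (y 0)) (psi (y 0)); rewrite subrK; lra.
Qed.

Lemma psi_curve_locint (y : R -> 'rV[R]_d) : continuousRplus y ->
  (forall t, 0 <= t -> D (y t)) -> locint (fun t => psi (y t)).
Proof.
move=> cy Dy; apply: (@locint_dom _ _ (fun t => (`|psi (y 0)| + L) + L * enorm (y t - y 0))).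
- exists (psi \o y \o Num.max (0 : R)); first exact: psi_lsc_curve.
  by apply: ae_all => t t0 /=; rewrite max_r.
- apply: rcont_locint; apply: rcontD; first exact: rcont_cst.
  apply: rcontZ; apply: continuousRplus_enorm.
  by apply: (continuousRplusB cy); exact: continuousRplus_cst.
- by apply: ae_all => t t0; exact: psi_curve_le.
Qed.

Variables (x k : R -> 'rV[R]_d) (h : nat -> R) (X M : nat -> nat -> 'rV[R]_d).
Hypotheses (cx : continuousRplus x) (ck : continuousRplus k).
Hypothesis Dx : forall t, 0 <= t -> D (x t).
Hypothesis sch : forall n, discrete_scheme rho gamma D psi (h n) (X n) (M n).
Hypothesis h_cvg : forall e : R, 0 < e -> \forall n \near \oo, h n <= e.
Hypothesis Xx : forall T e : R, 0 < e -> \forall n \near \oo, forall j,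
  j%:R * h n <= T -> enorm (X n j - x (j%:R * h n)) <= e.
Hypothesis Kk : forall t e : R, 0 <= t -> 0 < e -> \forall n \near \oo,
  enorm (pushing (X n) (M n) (Num.truncn (t / h n)) - k t) <= e.
Hypothesis Vb : forall T : R, 0 <= T -> exists V : R, \forall n \near \oo,
  forall j, j%:R * h n <= T -> push_var (X n) (M n) j <= V.

Let h0 n : 0 < h n := scheme_step (sch n).
Let DX n j : D (X n j) := scheme_dom (sch n) j.
Let idx n (t : R) := Num.truncn (t / h n).
Let K n t := pushing (X n) (M n) (idx n t).
Let V n t := push_var (X n) (M n) (idx n t).

Lemma push_incr n (a b : R) : a <= b -> enorm (K n b - K n a) <= V n b - V n a.
Proof.
move=> ab; have ij : (idx n a <= idx n b)%N by exact: step_leq.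
rewrite /V -{1}(subnKC ij) push_var_shift [push_var _ _ (idx n a) + _]addrC addrK.
have := push_le_var (fun j => X n (idx n a + j)%N) (fun j => M n (idx n a + j)%N)
  (idx n b - idx n a).
by rewrite /pushing addn0 (subnKC ij).
Qed.

(** Lower semicontinuity of the variation, one partition at a time: only the finitely many points of
    the partition need convergence of K. *)
Lemma chain_push (s : seq R) (a e : R) : 0 <= a -> path <%R a s -> 0 < e ->
  \forall n \near \oo, chain_var k a s <= V n (last a s) - V n a + e.
Proof.
elim: s a e => [|b s IH] a e a0; first by move=> _ e0; apply: nearW => n /=; lra.
rewrite /= => /andP[ab bs] e0; have b0 : 0 <= b by rewrite (le_trans a0)// ltW.
have e3 : 0 < e / 3 by lra.
apply: filterS2 (filterI (Kk a0 e3) (Kk b0 e3)) (IH b _ b0 bs e3) => n [a1 a2] a3.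
have := push_incr n (ltW ab).
have := enorm_dist_tri (K n b) (k b) (k a); have := enorm_dist_tri (K n a) (K n b) (k a).
rewrite (enorm_distC (k b) (K n b)); move: a1 a2 a3; rewrite -/(K n a) -/(K n b); lra.
Qed.

Lemma limit_BVloc : BVloc k.
Proof.
move=> t t0; have [C hC] := Vb t0.
apply: (@le_lt_trans _ _ C%:E); last exact: ltry.
apply: ub_ereal_sup => _ [s [ts /eqP lst] <-]; rewrite lee_fin vvariationE.
apply/ler_addgt0Pr => e e0.
have [n [a1 a2]] := filter_ex (filterI hC (chain_push (lexx 0) ts e0)).
apply: le_trans a2 _; rewrite lst lerD2r.
have := a1 (idx n t); have /andP[-> _] := step_itv (h0 n) t0.
move=> /(_ isT); have := push_var_ge0 (X n) (M n) (idx n 0); rewrite /V; lra.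
Qed.

Let lpx : locint (fun t => psi (x t)) := psi_curve_locint cx Dx.

(** The minimum with psi(x(t)) forces convergence to psi(x(t)), since lower semicontinuity controls
    the scheme values only from below. The maximum with psi(x(t)) - 2 L gives domination; it changes
    nothing once the iterate is within 1 of x(t), by the growth bound. *)
Definition capped_psi n (t : R) : R :=
  Num.max (Num.min (psi (X n (Num.truncn (t / h n)).+1)) (psi (x t))) (psi (x t) - 2 * L).

Lemma capped_psi_itv n t : psi (x t) - 2 * L <= capped_psi n t <= psi (x t).
Proof.
have L0 := L_ge0 S; rewrite /capped_psi le_max lexx orbT ge_max ge_min lexx orbT /=.
by rewrite lerBlDr lerDl mulr_ge0.
Qed.

Lemma capped_psi_le n t : `|capped_psi n t| <= `|psi (x t)| + 2 * L.
Proof.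
have L0 := L_ge0 S; have := capped_psi_itv n t; move: (capped_psi n t) (psi (x t)) => c q.
have := ler_norm q; have := ler_norm (- q); rewrite normrN.
by move: `|q| => r; rewrite ler_norml; lra.
Qed.

Lemma capped_psi_locint n : locint (capped_psi n).
Proof.
have L0 := L_ge0 S.
apply: (@locint_dom _ _ (fun t => `|psi (x t)| + 2 * L)); last first.
- by apply: ae_all => t _; exact: capped_psi_le.
- apply: locintD; first exact: locint_norm.
  by apply: rcont_locint; exact: rcont_cst.
pose w := psi \o x \o Num.max (0 : R).
have mw : measurable_fun setT w by exact: psi_lsc_curve.
exists (((fun t => psi (X n (Num.truncn (t / h n)).+1)) \min w) \max (fun t => w t - 2 * L)).
  apply: measurable_maxr; last by apply: measurable_funB.
  apply: measurable_minr => //.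
  apply: (@measurable_fun_partition R (fun t => Num.truncn (t / h n))
    (fun j _ => psi (X n j.+1))) => //.
  exact: measurable_trunc.
apply: ae_all => t t0; have wE : w t = psi (x t) by rewrite /w /= max_r.
by rewrite /capped_psi /= wE.
Qed.

Lemma capped_psi_cvg (t : R) : 0 <= t -> capped_psi ^~ t @ \oo --> psi (x t).
Proof.
move=> t0; apply/cvgrPdist_le => e e0; have L0 := L_ge0 S.
have [r r0 hr] := psi_lsc S (Dx t0) e0.
have r2 : 0 < r / 2 by lra.
apply: filterS (grid_curve_cvg h0 h_cvg cx Xx t0 r2) => n hn.
have : enorm (X n (Num.truncn (t / h n)).+1 - x t) < r.
  apply: le_lt_trans (hn _ _) _; last by lra.
  have /andP[h1 h2] := step_itv (h0 n) t0.
  move: (h2); rewrite -natr1 mulrDl mul1r => h3; rewrite ler_norml; lra.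
move/(hr _ (DX _ _)) => pe.
have /andP[_ c1] := capped_psi_itv n t.
have c2 : psi (x t) - e <= capped_psi n t.
  by rewrite le_max le_min (ltW pe) lerBlDr lerDl (ltW e0).
move: c1 c2; move: (capped_psi n t) => c; rewrite ler_norml; lra.
Qed.

(* Fatou's lemma in the form of dominated convergence of the capped integrands:
   the energies are bounded below uniformly near the limit curve. *)
Lemma psi_Int_le (a b e : R) : 0 <= a -> a <= b -> 0 < e -> \forall n \near \oo,
  Int a b (fun t => psi (x t)) <=
  h n * \sum_(l < idx n b - idx n a) psi (X n (idx n a + l).+1) + e.
Proof.
move=> a0 ab e0; have L0 := L_ge0 S; have b0 := le_trans a0 ab.
have e2 : 0 < e / 2 by lra.
have lg : locint (fun t => `|psi (x t)| + 2 * L).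
  apply: locintD; first exact: locint_norm.
  by apply: rcont_locint; exact: rcont_cst.
have capE n : {ae mu, forall t : R, 0 <= t -> `|capped_psi n t| <= `|psi (x t)| + 2 * L}.
  by apply: ae_all => t _; exact: capped_psi_le.
have capC : {ae mu, forall t : R, 0 <= t -> capped_psi ^~ t @ \oo --> psi (x t)}.
  by apply: ae_all => t; exact: capped_psi_cvg.
have H1 := Int_grid_cvg h0 h_cvg a0 e2 capped_psi_locint lpx lg capE capC.
have H2 := Int_grid_cvg h0 h_cvg b0 e2 capped_psi_locint lpx lg capE capC.
have half : 0 < 1 / 2 :> R by lra.
have [r r0 hr] := continuousRplus_unif b cx half.
apply: filterS2 (filterI H1 H2) (filterI (Xx b half) (h_cvg r0)) => n [a1 a2] [a3 a4].
have ij : (idx n a <= idx n b)%N by exact: step_leq.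
have /andP[jb _] := step_itv (h0 n) b0.
move: a1 a2 ij jb; rewrite -/(idx n a) -/(idx n b).
set i := idx n a; set j := idx n b => a1 a2 ij jb.
have ih0 (l : nat) : 0 <= l%:R * h n by rewrite mulr_ge0// ltW.
have ihS (l : nat) : l.+1%:R * h n = l%:R * h n + h n by rewrite -natr1 mulrDl mul1r.
have step l : (l < j)%N ->
    Int (l%:R * h n) (l.+1%:R * h n) (capped_psi n) <= h n * psi (X n l.+1).
  move=> lj; have lb : l.+1%:R * h n <= b.
    by apply: le_trans jb; rewrite ler_pM2r// ler_nat.
  have -> : h n * psi (X n l.+1) =
      Int (l%:R * h n) (l.+1%:R * h n) (fun=> psi (X n l.+1)).
    by rewrite Int_cst ?ihS; [ring|rewrite lerDl ltW].
  apply: Int_le => //; first exact: capped_psi_locint.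
    by apply: rcont_locint; exact: rcont_cst.
  apply: ae_all => t /andP[t1 t2].
  have t0 : 0 <= t by rewrite (le_trans (ih0 l))// ltW.
  rewrite /capped_psi (@truncn_step _ _ t l (h0 n)) ?(ltW t1) ?t1//.
  have := hr (l.+1%:R * h n) t; rewrite ih0 lb t0 (le_trans (ltW t2) lb).
  have -> : `|l.+1%:R * h n - t| <= r by rewrite ler_norml; move: t1 t2; rewrite ihS; lra.
  move=> /(_ isT isT isT) c1; have c2 := a3 _ lb.
  have c3 := enorm_dist_tri (x (l.+1%:R * h n)) (X n l.+1) (x t).
  have c4 : enorm (X n l.+1 - x t) <= 1 by lra.
  have := psi_growth S (DX n l.+1) (Dx t0); rewrite ler_norml => /andP[c5 _].
  have c6 := ler_wpM2l L0 c4.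
  move: c5 c6; move: (psi _) (psi _) (enorm _) => p q w *.
  rewrite ge_max ge_min lexx /=; lra.
have sum_le p : (i + p <= j)%N ->
    Int (i%:R * h n) ((i + p)%:R * h n) (capped_psi n) <=
    h n * \sum_(l < p) psi (X n (i + l).+1).
  elim: p => [_|p IH pj]; first by rewrite addn0 Intxx big_ord0 mulr0.
  rewrite big_ord_recr /= mulrDr addnS.
  rewrite (Int_split (capped_psi_locint n) (ih0 i) (c := (i + p)%:R * h n)).
  - by apply: lerD; [apply: IH; apply: leq_trans pj; rewrite addnS|apply: step; rewrite -addnS].
  - by rewrite ler_pM2r// ler_nat leq_addr.
  - by rewrite ler_pM2r// ler_nat.
have := sum_le (j - i)%N; rewrite subnKC// leqnn => /(_ isT).
rewrite (Int_sub (capped_psi_locint n)) ?ih0 ?ler_pM2r ?ler_nat//.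
rewrite (Int_sub lpx)//; move: a1 a2; rewrite !ler_norml.
move: (Int _ _ _) (Int _ _ _) (Int _ _ _) (Int 0 a _) => I1 I2 I3 I4.
move: (h n * _) => P; lra.
Qed.

(** E(t) is the ultrafilter limit of the discrete variations, which replaces Helly's selection
    theorem. The error is eps times an increment of t + E(t), so over any subdivision it adds up to
    eps times a fixed quantity. *)
Lemma limit_piece : exists2 E : R -> R, rnondec E &
  forall T eps : R, 0 < eps <= 1 -> exists2 r : R, 0 < r &
  forall a b, 0 <= a -> a < b -> b <= T -> b - a <= r -> forall y, D y ->
   dotp (k b - k a) (y - x a) + Int a b (fun t => psi (x t)) <=
   (b - a) * psi y +
   (rho * (b - a) + gamma * enorm (k b - k a)) * enorm (y - x a) ^+ 2 +
   (rho + gamma + 1) * (108 + 256 * gamma) * eps * (b - a + (E b - E a)) *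
     (1 + enorm (y - x a)) ^+ 2.
Proof.
have [U UU U_oo] := ultra_oo.
have FU : ProperFilter U by exact: ultra_proper.
have U_near (P : nat -> Prop) : (\forall n \near \oo, P n) -> U [set n | P n].
  by move=> [N _ hN]; apply: filterS (U_oo N) => n; exact: hN.
have /choice[E hE] : forall t : R, exists l : R, 0 <= t -> V ^~ t @ U --> l.
  move=> t; have [t0|t0] := leP 0 t; last by exists 0.
  have [C hC] := Vb t0.
  have [|l hl] := @ultra_real R U (V ^~ t) C UU.
    apply: U_near; apply: filterS hC => n /(_ (idx n t)).
    have /andP[-> _] := step_itv (h0 n) t0.
    by rewrite ger0_norm ?push_var_ge0//; apply.
  exists l => _; apply/cvgrPdist_lt => e /hl.
  by apply: filterS => n /=; rewrite distrC.
exists E.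
  move=> s t s0 st; apply: (ler_cvg_to (hE s s0) (hE t (le_trans s0 st))).
  by apply: nearW => n; apply: push_var_le; exact: step_leq.
move=> T eps /andP[eps0 eps1].
(* Iterates of a window differ by at most two errors X - x and one oscillation of x, in all less
   than the eps^2 required by [scheme_increment_sharp]. *)
have ep4 : 0 < eps ^+ 2 / 4 by rewrite divr_gt0// exprn_gt0.
have [r r0 hr] := continuousRplus_unif T cx ep4.
exists (r / 2) => [|a b a0 ab bT bar y Dy]; first by lra.
have b0 := le_trans a0 (ltW ab).
apply/ler_addgt0Pr => e e0.
pose H n := (idx n b)%:R * h n - (idx n a)%:R * h n.
have Kcvg t : 0 <= t -> ecvg U (K ^~ t) (k t).
  by move=> t0 e1 e10; apply: U_near; exact: Kk.
have Ucvg : ecvg U (fun n => K n b - K n a) (k b - k a).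
  by apply: ecvgD; [exact: Kcvg|apply: ecvgN; exact: Kcvg].
have Ycvg : ecvg U (fun n => y - X n (idx n a)) (y - x a).
  apply: ecvgD; [exact: ecvg_cst|apply: ecvgN => e1 e10].
  by apply: U_near; exact: (grid_step_cvg h0 h_cvg cx Xx).
have icvg t : 0 <= t -> (fun n => (idx n t)%:R * h n) @ U --> t.
  move=> t0; apply/cvgrPdist_le => e1 e10; apply: U_near.
  by apply: filterS (grid_cvg h0 h_cvg t0 e10) => n; rewrite distrC.
have Hcvg : H @ U --> b - a by apply: cvgB; exact: icvg.
have C0 : (fun n : nat => Int a b (fun t => psi (x t)) - e) @ U --> Int a b (fun t => psi (x t)) - e.
  exact: cvg_cst.
rewrite -lerBlDr -addrA.
have L1 : (fun n => dotp (K n b - K n a) (y - X n (idx n a)) +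
    (Int a b (fun t => psi (x t)) - e)) @ U -->
  dotp (k b - k a) (y - x a) + (Int a b (fun t => psi (x t)) - e).
  by apply: cvgD => //; exact: ecvg_dotp.
have N1 : (fun n => enorm (K n b - K n a)) @ U --> enorm (k b - k a) by exact: ecvg_enorm.
have N2 : (fun n => enorm (y - X n (idx n a))) @ U --> enorm (y - x a) by exact: ecvg_enorm.
have cc (c : R) : (fun _ : nat => c) @ U --> c by exact: cvg_cst.
have VB : (fun n => V n b - V n a) @ U --> E b - E a by apply: cvgB; exact: hE.
have R1 : (fun n => H n * psi y) @ U --> (b - a) * psi y by exact: cvgM.
have R2 : (fun n => (rho * H n + gamma * enorm (K n b - K n a)) * enorm (y - X n (idx n a)) ^+ 2)
  @ U --> (rho * (b - a) + gamma * enorm (k b - k a)) * enorm (y - x a) ^+ 2.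
  by apply: cvgM; [apply: cvgD; exact: cvgM|exact: cvgM].
have R3 : (fun n => 1 + enorm (y - X n (idx n a))) @ U --> 1 + enorm (y - x a).
  exact: cvgD.
have R4 : (fun n => (rho + gamma + 1) * (108 + 256 * gamma) * eps * (H n + (V n b - V n a)) *
    (1 + enorm (y - X n (idx n a))) ^+ 2) @ U -->
  (rho + gamma + 1) * (108 + 256 * gamma) * eps * (b - a + (E b - E a)) *
    (1 + enorm (y - x a)) ^+ 2.
  by apply: cvgM; [apply: cvgM => //; exact: cvgD|exact: cvgM].
apply: (ler_cvg_to L1 (cvgD (cvgD R1 R2) R4)); apply: U_near.
clear L1 N1 N2 R1 R2 R3 R4 VB Ucvg Ycvg icvg Hcvg C0 cc Kcvg hE.
(* h <= (b - a) / 2 ensures that the window contains at least one step; h <= r / 2 keeps its length,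
   at most b - a + h, below r. *)
have ba2 : 0 < Num.min (r / 2) ((b - a) / 2) by rewrite lt_min; lra.
apply: filterS2 (filterI (Xx T ep4) (h_cvg ba2)) (psi_Int_le a0 (ltW ab) e0) => n [a1].
rewrite le_min => /andP[hr2 hba] a2 /=.
have ij : (idx n a <= idx n b)%N by apply: step_leq => //; exact: ltW.
have /andP[ia1 ia2] := step_itv (h0 n) a0.
have /andP[jb1 jb2] := step_itv (h0 n) b0.
have gap := step_gap (h0 n) a0 (ltW ab).
have HE : H n = (idx n b - idx n a)%:R * h n by rewrite natrB// mulrBl.
have ihS (l : nat) : l.+1%:R * h n = l%:R * h n + h n by rewrite -natr1 mulrDl mul1r.
have p0 : (0 < idx n b - idx n a)%N.
  rewrite subn_gt0 ltnNge; apply/negP => ji.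
  have : (idx n b).+1%:R * h n <= (idx n a).+1%:R * h n by rewrite ler_pM2r// ler_nat.
  move: ia1 ia2 jb1 jb2; rewrite -/(idx n a) -/(idx n b) !ihS; lra.
have iT : (idx n a)%:R * h n <= T by move: ia1; rewrite -/(idx n a); lra.
have ih0 (l : nat) : 0 <= l%:R * h n by rewrite mulr_ge0// ltW.
have near_i l : (l < idx n b - idx n a)%N ->
    enorm (X n (idx n a + l.+1)%N - X n (idx n a + 0)%N) <= eps ^+ 2.
  move=> lp; rewrite addn0.
  have lj : (idx n a + l.+1)%:R * h n <= (idx n b)%:R * h n.
    by rewrite ler_pM2r// ler_nat -(subnKC ij) leq_add2l.
  have lT : (idx n a + l.+1)%:R * h n <= T by move: jb1; rewrite -/(idx n b); lra.
  have il : (idx n a)%:R * h n <= (idx n a + l.+1)%:R * h n.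
    by rewrite ler_pM2r// ler_nat leq_addr.
  have c1 := a1 _ lT; have c2 := a1 _ iT.
  have := hr ((idx n a + l.+1)%:R * h n) ((idx n a)%:R * h n).
  rewrite !ih0 lT iT => /(_ isT isT) c3.
  have {}c3 := c3 ltac:(rewrite ger0_norm; [move: gap; rewrite -/(idx n a) -/(idx n b)|]; lra).
  move: c1 c2 c3; set u := x _; set v := x _.
  have := enorm_dist_tri u (X n (idx n a + l.+1)%N) (X n (idx n a)).
  have := enorm_dist_tri v u (X n (idx n a)); rewrite (enorm_distC v); lra.
have VE : V n b = V n a + push_var (fun j => X n (idx n a + j)%N)
    (fun j => M n (idx n a + j)%N) (idx n b - idx n a).
  by rewrite /V -{1}(subnKC ij) push_var_shift.
have := scheme_increment_sharp S (scheme_shift (idx n a) (sch n)) p0 _ near_i Dy.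
rewrite eps0 eps1 => /(_ isT); rewrite /pushing !addn0 (subnKC ij).
have -> : push_var (fun j => X n (idx n a + j)%N) (fun j => M n (idx n a + j)%N)
    (idx n b - idx n a) = V n b - V n a.
  by rewrite VE [RHS]addrC addKr.
rewrite -/(pushing (X n) (M n) (idx n b)) -/(pushing (X n) (M n) (idx n a)).
rewrite -/(K n b) -/(K n a) -HE.
under eq_bigr => l _ do rewrite addnS.
move: a2; move: (Int _ _ _) => I0.
set P := h n * _; clearbody P; move: (dotp _ _) => d0; move=> a2 c0.
apply: le_trans (le_trans c0 _) => //; lra.
Qed.

End LimitPassage.

(** * From short intervals to the variational inequality for curves in the domain *)

Section Variational.
Opaque Int vtv ctv vbv_int.
Variables (R : realType) (d : nat) (rho gamma L delta sigma : R).
Variables (D : set 'rV[R]_d) (psi : 'rV[R]_d -> R).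
Hypothesis S : skorohod_data rho gamma L delta sigma D psi.
Variables (x k : R -> 'rV[R]_d) (E : R -> R) (C : R).
Hypotheses (cx : continuousRplus x) (ck : continuousRplus k) (bvk : BVloc k).
Hypothesis Dx : forall t, 0 <= t -> D (x t).
Hypotheses (C0 : 0 <= C) (ndE : rnondec E).
Hypothesis piece : forall T eps : R, 0 < eps <= 1 -> exists2 r : R, 0 < r &
  forall a b, 0 <= a -> a < b -> b <= T -> b - a <= r -> forall y, D y ->
   dotp (k b - k a) (y - x a) + Int a b (fun t => psi (x t)) <=
   (b - a) * psi y +
   (rho * (b - a) + gamma * enorm (k b - k a)) * enorm (y - x a) ^+ 2 +
   C * eps * (b - a + (E b - E a)) * (1 + enorm (y - x a)) ^+ 2.

(** Applied to psi(y(.)), which need not be continuous: its value at a prescribed time may exceed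
    the mean, so a time is chosen at which it almost does not. *)
Lemma Int_mean_value (a b e : R) (u : R -> R) : 0 <= a -> a < b -> 0 < e -> locint u ->
  exists2 r : R, a <= r <= b & u r * (b - a) <= Int a b u + e * (b - a).
Proof.
move=> a0 ab e0 lu; apply: contrapT => hn.
pose c := Int a b u / (b - a) + e.
have ba : 0 < b - a by lra.
have h1 : Int a b (fun=> c) <= Int a b u.
  apply: Int_le => //; first by apply: rcont_locint; exact: rcont_cst.
  apply: ae_all => r /andP[ar rb]; rewrite leNgt; apply/negP => uc; apply: hn.
  exists r; first by rewrite (ltW ar) (ltW rb).
  have := ltW uc; rewrite /c -(ler_pM2r ba) mulrDl divfK// gt_eqF//.
move: h1; rewrite (Int_cst _ (ltW ab)) /c mulrDl divfK ?gt_eqF//.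
have := mulr_gt0 e0 ba; move: (Int _ _ _) => I1; lra.
Qed.

(** On a short cell [a, b] the local inequality is tested with the constant y(r), r from
    [Int_mean_value]. With q = y(r) - x(a), every integrand is compared with its value at q, and
    |k(b) - k(a)| is bounded by the increment of the variation of k. *)
Lemma variational_inequality (s t : R) (y : R -> 'rV[R]_d) : 0 <= s -> s <= t ->
  continuousRplus y -> (forall r, 0 <= r -> D (y r)) ->
  vbv_int s t (fun r => y r - x r) k + Int s t (fun r => psi (x r)) <=
  Int s t (fun r => psi (y r)) +
  (rho * Int s t (fun r => enorm (y r - x r) ^+ 2) +
   gamma * stint s t (fun r => enorm (y r - x r) ^+ 2) (vtv k)).
Proof.
move=> s0 st cy Dy; have t0 := le_trans s0 st.
have rho0 := rho_ge0 S; have gamma0 := gamma_ge0 S.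
pose z r := y r - x r.
have cz : continuousRplus z by exact: continuousRplusB.
have cz2 := continuousRplus_enorm2 cz.
have lx := psi_curve_locint S cx Dx; have ly := psi_curve_locint S cy Dy.
have lz := rcont_locint cz2.
have [B B0 hB] := rcont_bounded t (continuousRplus_enorm cz).
have zB r : 0 <= r <= t -> enorm (z r) <= B by move=> /hB; apply: le_trans; exact: ler_norm.
have cV := vtv_rcont ck bvk; have nV := vtv_nondec bvk.
(* Since z and q differ by at most 2 eps and |z| + |q| <= 2 B + 1, eps [c3] bounds the error of the
   squares; [Q] bounds (1 + |q|)^2. The weight [w] collects the coefficients of all errors. *)
pose c3 := 2 * (2 * B + 1); pose Q := (2 + B) ^+ 2.
pose w r := (1 + rho * c3 + C * Q) * r + gamma * c3 * vtv k r + 2 * ctv k r + C * Q * E r.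
suff main eps : 0 < eps <= 1 ->
    vbv_int s t z k + Int s t (fun r => psi (x r)) - Int s t (fun r => psi (y r)) -
    rho * Int s t (fun r => enorm (z r) ^+ 2) -
    gamma * stint s t (fun r => enorm (z r) ^+ 2) (vtv k) - eps * (w t - w s) <= 0.
  apply/ler_addgt0Pr => e e0; set G := w t - w s in main.
  have G1 : 0 < `|G| + 1 by have := normr_ge0 G; lra.
  have ep0 : 0 < Num.min 1 (e / (`|G| + 1)) by rewrite lt_min ltr01 divr_gt0.
  have := main (Num.min 1 (e / (`|G| + 1))).
  rewrite ep0 ge_min lexx => /(_ isT).
  have h1 : Num.min 1 (e / (`|G| + 1)) * G <= e.
    apply: le_trans (ler_wpM2l (ltW ep0) (ler_norm G)) _.
    apply: (@le_trans _ _ (e / (`|G| + 1) * `|G|)).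
      by rewrite ler_wpM2r// ge_min lexx orbT.
    by rewrite mulrAC ler_pdivrMr// ler_wpM2l ?(ltW e0)//; lra.
  move: h1; rewrite -/(z _); move: (Num.min _ _ * G) => c.
  move: (vbv_int _ _ _ _) (Int _ _ _) (Int _ _ _) (Int _ _ _) (stint _ _ _ _).
  by move=> v1 v2 v3 v4 v5; lra.
move=> /andP[eps0 eps1].
have [r1 r10 h1] := continuousRplus_unif t cx eps0.
have [r2 r20 h2] := continuousRplus_unif t cy eps0.
have [r3 r30 h3] := piece t (eps := eps) (introT andP (conj eps0 eps1)).
pose H a b := vbv_int a b z k + Int a b (fun r => psi (x r)) - Int a b (fun r => psi (y r)) -
    rho * Int a b (fun r => enorm (z r) ^+ 2) -
    gamma * stint a b (fun r => enorm (z r) ^+ 2) (vtv k) - eps * (w b - w a).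
have Hadd a b c : s <= a -> a <= c -> c <= b -> b <= t -> H a b = H a c + H c b.
  move=> sa ac cb bt; have a0 := le_trans s0 sa.
  rewrite /H (vbv_int_split ck bvk a0 ac cb cz) (Int_split lx a0 ac cb).
  rewrite (Int_split ly a0 ac cb) (Int_split lz a0 ac cb) (stint_split nV cV a0 ac cb cz2).
  by ring.
have r0 : 0 < Num.min r1 (Num.min r2 r3) by rewrite !lt_min r10 r20.
apply: (@additive_le0 _ H s t _ r0 st Hadd) => a b sa ab bt.
rewrite !le_min => /and3P[br1 br2 br3].
have a0 := le_trans s0 sa; have b0 := le_trans a0 ab.
move: ab; rewrite le_eqVlt => /predU1P[abE|ab].
  (* On a degenerate cell additivity alone gives H = 0. *)
  by have := Hadd a a a sa (lexx a) (lexx a) _; rewrite abE => /(_ bt); lra.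
have ba : 0 < b - a by lra.
have [r /andP[ar rb] hr] := Int_mean_value a0 ab eps0 ly.
have aT : 0 <= a <= t by rewrite a0 (le_trans (ltW ab)).
have inT u : a <= u <= b -> 0 <= u <= t.
  by move=> /andP[au ub]; rewrite (le_trans a0 au) (le_trans ub bt).
have near u v : a <= u <= b -> a <= v <= b -> `|u - v| <= b - a.
  by move=> ? ?; rewrite ler_norml; lra.
have rab : a <= r <= b by rewrite ar rb.
have aab : a <= a <= b by rewrite lexx ltW.
pose q := y r - x a.
have zq u : a <= u <= b -> enorm (z u - q) <= 2 * eps.
  move=> uab; have -> : z u - q = (y u - y r) - (x u - x a) by rewrite /z /q; vring.
  have c1 := h1 u a (inT u uab) aT (le_trans (near u a uab aab) br1).
  have c2 := h2 u r (inT u uab) (inT r rab) (le_trans (near u r uab rab) br2).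
  by apply: le_trans (enormB _ _) _; lra.
have qB : enorm q <= B + 1.
  have -> : q = z r + (x r - x a) by rewrite /z /q; vring.
  have c1 := h1 r a (inT r rab) aT (le_trans (near r a rab aab) br1).
  by apply: le_trans (enormD _ _) _; have := zB r (inT r rab); lra.
have q0 := enorm_ge0 q.
have zq2 u : a <= u <= b -> `|enorm (z u) ^+ 2 - enorm q ^+ 2| <= eps * c3.
  move=> uab; have c1 := zq u uab; have c2 := zB u (inT u uab).
  have c3' := enorm_sub_ge (z u) q; have c4 := enorm_sub_ge q (z u).
  rewrite (enorm_distC q) in c4; have c5 := enorm_ge0 (z u).
  rewrite subr_sqr normrM (ger0_norm (_ : 0 <= enorm (z u) + enorm q)) ?addr_ge0//.
  rewrite (_ : eps * c3 = 2 * eps * (2 * B + 1)); last by rewrite /c3; ring.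
  apply: ler_pM => //; first exact: addr_ge0.
    by rewrite ler_norml; lra.
  lra.
have ocab u : a < u <= b -> a <= u <= b by move=> /andP[/ltW -> ->].
have f1 := h3 a b a0 ab bt br3 (y r) (Dy r (le_trans a0 ar)).
have f2 := vbv_int_approx ck bvk a0 (ltW ab) cz (fun u h => zq u (ocab u h)).
have f3 : (enorm q ^+ 2 - eps * c3) * (b - a) <= Int a b (fun u => enorm (z u) ^+ 2).
  rewrite -(Int_cst _ (ltW ab)); apply: Int_le => //.
    by apply: rcont_locint; exact: rcont_cst.
  apply: ae_all => u /andP[au ub].
  by have := zq2 u; rewrite (ltW au) (ltW ub) ler_norml => /(_ isT); lra.
have f4 := stint_approx nV cV a0 (ltW ab) cz2 (fun u h => zq2 u (ocab u h)).
have f5 := vtv_incr bvk a0 (ltW ab).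
have f6 : C * eps * (b - a + (E b - E a)) * (1 + enorm q) ^+ 2 <=
    C * eps * (b - a + (E b - E a)) * Q.
  apply: ler_wpM2l.
    apply: mulr_ge0; first by rewrite mulr_ge0// ltW.
    by rewrite addr_ge0 ?(ltW ba)// subr_ge0; exact: ndE (ltW ab).
  have qB' : 1 + enorm q <= 2 + B by rewrite -[2]/(1 + 1) -addrA lerD2l addrC.
  have [p1 p2] : 0 <= 1 + enorm q /\ 0 <= 2 + B by split; exact: addr_ge0.
  by rewrite ler_pXn2r.
have f3' := ler_wpM2l rho0 f3.
have f5' := ler_wpM2l (mulr_ge0 gamma0 (sqr_ge0 (enorm q))) f5.
rewrite dotpC -/q in f1.
move: f2 f4; rewrite !ler_norml => /andP[_ f2] /andP[f4 _].
have f4' := ler_wpM2l gamma0 f4.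
move: f1 f2 f3' f4' f5' f6 hr; rewrite /H /w.
move: (vbv_int _ _ _ _) (Int _ _ _) (Int _ _ _) (Int _ _ _) (stint _ _ _ _).
move: (dotp _ _) (psi _) (enorm (k b - k a)) (enorm q ^+ 2) ((1 + _) ^+ 2).
move: (vtv k b) (vtv k a) (ctv k b) (ctv k a) (E b) (E a).
clearbody c3 Q; move=> v1 v2 v3 v4 v5 v6 w1 w2 w3 w4 w5 w6 w7 w8 w9 w10.
lra.
Qed.

End Variational.

(** * Return to the extended-valued phi and to arbitrary continuous test curves *)

Section SubdifferentialLimit.
Opaque Int vtv ctv.
Variables (R : realType) (d : nat) (rho gamma L delta sigma : R).
Variable phi : 'rV[R]_d -> \bar R.
Hypotheses (phiNy : forall v, phi v != -oo%E) (phi_lsc : lower_semicontinuous phi).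
Hypothesis S : skorohod_data rho gamma L delta sigma (edom phi) (fine \o phi).
Notation mu := (@lebesgue_measure R).
Notation psi := (fine \o phi).

Lemma notin_edom v : ~ edom phi v -> phi v = +oo%E.
Proof. by rewrite /edom /= => /negP; rewrite -leNgt leye_eq => /eqP. Qed.

Lemma phi_curve_measurable (y : R -> 'rV[R]_d) (D : set R) : measurable D ->
  (forall t, D t -> 0 <= t) -> continuousRplus y -> measurable_fun D (phi \o y).
Proof.
move=> mD D0 /continuousRplusP cy.
have : measurable_fun setT (phi \o y \o Num.max (0 : R)).
  apply: lower_semicontinuous_measurable => t a /= /phi_lsc[W /nbhs_enormP[e e0 hW] aW].
  have t0 : 0 <= Num.max 0 t by rewrite le_max lexx.
  have [r r0 hr] := cy _ t0 e e0.
  exists (ball t r); first exact: nbhsx_ballx.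
  move=> s; rewrite /ball /= => st; apply/aW/hW/hr; first by rewrite le_max lexx.
  by rewrite distrC in st; apply: le_lt_trans st; exact: max0_contraction.
move=> /(measurable_funS measurableT (@subsetT _ D)); apply: eq_measurable_fun => t.
by rewrite inE => /D0 t0 /=; rewrite max_r.
Qed.

Lemma phi_curve_integrable (y : R -> 'rV[R]_d) (s t : R) : 0 <= s ->
  continuousRplus y -> (forall r, 0 <= r -> edom phi (y r)) ->
  mu.-integrable `[s, t] (phi \o y).
Proof.
move=> s0 cy Dy.
have pos r : r \in `[s, t]%classic -> 0 <= r.
  by rewrite inE /= in_itv/= => /andP[sr _]; exact: le_trans sr.
have eqy : {in `[s, t]%classic, phi \o y =1 EFin \o (psi \o y)}.
  by move=> r rst /=; rewrite (edom_fineK phiNy (Dy r (pos r rst))).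
suff : mu.-integrable `[s, t] (EFin \o (psi \o y)).
  by apply: eq_integrable => // r rst; rewrite eqy.
apply: measurable_bounded_integrable => //.
- by rewrite /= lebesgue_measure_itv; case: ifP => // _; rewrite -EFinB ltry.
- apply/measurable_EFinP; apply: (eq_measurable_fun (phi \o y)); first by move=> r /eqy.
  by apply: phi_curve_measurable => // r /mem_set/pos.
- have [B B0 hB] := rcont_bounded t (continuousRplus_enorm
    (continuousRplusB cy (@continuousRplus_cst R d (y 0)))).
  exists (`|psi (y 0)| + L + L * B); split; first exact: num_real.
  move=> c cB r rst; have r0 := pos r (mem_set rst).
  apply: le_trans (ltW cB); apply: le_trans (psi_curve_le S Dy r0) _.
  rewrite lerD2l; apply: ler_wpM2l; first exact: L_ge0 S.
  apply: le_trans (ler_norm _) (hB _ _); rewrite r0.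
  by move: rst; rewrite /= in_itv/= => /andP[].
Qed.

Lemma phi_curve_integral (y : R -> 'rV[R]_d) (s t : R) : 0 <= s ->
  continuousRplus y -> (forall r, 0 <= r -> edom phi (y r)) ->
  (\int[mu]_(r in `[s, t]) phi (y r))%E = (Int s t (fun r => psi (y r)))%:E.
Proof.
move=> s0 cy Dy; rewrite -(Int_closed t (psi_curve_locint S cy Dy) s0).
have i1 := phi_curve_integrable t s0 cy Dy.
rewrite -[LHS]fineK; last exact: integrable_fin_num.
congr (fine _)%:E; apply: eq_integral => r; rewrite inE /= in_itv/= => /andP[sr _].
by rewrite -(edom_fineK phiNy (Dy r (le_trans s0 sr))).
Qed.

(* The domain is closed: a curve leaving it stays outside on a nondegenerate
   interval. *)
Lemma phi_curve_integral_pinfty (y : R -> 'rV[R]_d) (s t r : R) : 0 <= s -> s < t ->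
  continuousRplus y -> edom phi !=set0 -> s <= r <= t -> ~ edom phi (y r) ->
  (\int[mu]_(r in `[s, t]) phi (y r))%E = +oo%E.
Proof.
move=> s0 st cy [v Dv] /andP[sr rt] nD.
have [e e0 he] : exists2 e : R, 0 < e & forall w, enorm (w - y r) < e -> ~ edom phi w.
  apply: contrapT => hn; apply: nD; apply: (dom_closed S) => e e0.
  apply: contrapT => hn2; apply: hn; exists e => // w we Dw.
  by apply: hn2; exists w.
have [r1 r10 hr] := (continuousRplusP y).1 cy r (le_trans s0 sr) e e0.
pose a := Num.max s (r - r1 / 2); pose b := Num.min t (r + r1 / 2).
have ab : a < b by rewrite gt_max !lt_min; apply/andP; split; apply/andP; split; lra.
have sa : s <= a by rewrite le_max lexx.
have bt : b <= t by rewrite ge_min lexx.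
have ar : r - r1 / 2 <= a by rewrite le_max lexx orbT.
have br : b <= r + r1 / 2 by rewrite ge_min lexx orbT.
have yoo u : a <= u <= b -> phi (y u) = +oo%E.
  move=> /andP[au ub]; apply/notin_edom/he/hr; first by rewrite (le_trans s0)// (le_trans sa).
  rewrite ltr_norml; lra.
have m1 : measurable_fun `[s, t]%classic (phi \o y).
  by apply: phi_curve_measurable => // u; rewrite /= in_itv/= => /andP[su _]; exact: le_trans su.
have [B B0 hB] := rcont_bounded t (continuousRplus_enorm
  (continuousRplusB cy (@continuousRplus_cst R d v))).
have L0 := L_ge0 S.
pose c := `|psi v| + L + L * B.
have c0 : 0 <= c by rewrite !addr_ge0// mulr_ge0.
have low u : s <= u <= t -> ((- c)%:E <= phi (y u))%E.
  move=> /andP[su ut]; have [Du|nDu] := pselect (edom phi (y u)); last first.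
    by rewrite notin_edom// leey.
  rewrite (edom_fineK phiNy Du) lee_fin.
  have h1 := psi_growth S Du Dv.
  have h2 : enorm (y u - v) <= B.
    by apply: le_trans (ler_norm _) (hB _ _); rewrite (le_trans s0 su).
  have h3 := ler_wpM2l L0 h2.
  have h4 := ler_norm (- psi v); rewrite normrN in h4.
  move: h1 h3 h4; rewrite /c ler_norml; move: (L * B) (L * _) `|psi v| => w1 w2 w3.
  by move: (psi v) => p /=; move: (fine (phi (y u))) => p' /andP[]; lra.
rewrite integralE.
have -> : (\int[mu]_(u in `[s, t]) ((fun u => phi (y u))^\+ u))%E = +oo%E.
  apply/eqP; rewrite -leye_eq.
  apply: (@le_trans _ _ (\int[mu]_(u in `[a, b]) ((fun u => phi (y u))^\+ u))%E); last first.
    apply: ge0_subset_integral => //; first exact: measurable_funepos.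
    by move=> u /=; rewrite !in_itv/= => /andP[au ub]; rewrite (le_trans sa)//= (le_trans ub).
  rewrite (eq_integral (cst +oo%E)).
    by rewrite integral_cst//= lebesgue_measure_itv /= lte_fin ab -EFinB gt0_mulye// lte_fin subr_gt0.
  by move=> u; rewrite inE /= in_itv/= => uab; rewrite funeposE yoo// maxye.
have hneg : (\int[mu]_(u in `[s, t]) ((fun u => phi (y u))^\- u) <= (c * (t - s))%:E)%E.
  apply: (@le_trans _ _ (\int[mu]_(u in `[s, t]) (cst c%:E u))%E).
    apply: ge0_le_integral => //.
    - exact: measurable_funeneg.
    - move=> u; rewrite /= in_itv/= => ust; rewrite funenegE ge_max lee_fin c0 andbT.
      by rewrite leeNl -EFinN low.
  by rewrite integral_cst//= lebesgue_measure_itv /= lte_fin st -EFinB -EFinM.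
have hneg0 : (0 <= \int[mu]_(u in `[s, t]) ((fun u => phi (y u))^\- u))%E.
  by apply: integral_ge0.
by move: hneg hneg0; case: (\int[mu]_(u in _) _)%E => [q| |].
Qed.

Variables (x k : R -> 'rV[R]_d) (E : R -> R) (C : R).
Hypotheses (cx : continuousRplus x) (ck : continuousRplus k).
Hypotheses (bvk : BVloc k) (k0 : k 0 = 0).
Hypothesis Dx : forall t, 0 <= t -> edom phi (x t).
Hypotheses (C0 : 0 <= C) (ndE : rnondec E).
Hypothesis piece : forall T eps : R, 0 < eps <= 1 -> exists2 r : R, 0 < r &
  forall a b, 0 <= a -> a < b -> b <= T -> b - a <= r -> forall y, edom phi y ->
   dotp (k b - k a) (y - x a) + Int a b (fun t => psi (x t)) <=
   (b - a) * psi y +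
   (rho * (b - a) + gamma * enorm (k b - k a)) * enorm (y - x a) ^+ 2 +
   C * eps * (b - a + (E b - E a)) * (1 + enorm (y - x a)) ^+ 2.

(** Freezing y outside [s, t] turns a test curve that stays in the domain during [s, t] into one
    that stays there at all times. *)
Lemma continuousRplus_clamp (y : R -> 'rV[R]_d) (s t : R) : 0 <= s -> s <= t ->
  continuousRplus y -> continuousRplus (fun r => y (Num.max s (Num.min t r))).
Proof.
move=> s0 st /continuousRplusP cy; apply/continuousRplusP => u u0 e e0.
have c0 v : 0 <= Num.max s (Num.min t v) by rewrite le_max s0.
have [r r0 hr] := cy _ (c0 u) e e0; exists r => // v v0 uv; apply: hr => //.
apply: le_lt_trans uv; rewrite /Num.max /Num.min.
have := ler_norm (v - u); have := ler_norm (u - v); rewrite (distrC u).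
move: `|v - u| => w; case: (ltP t v) => tv; case: (ltP t u) => tu;
  do 2?[case: ltP => ?]; rewrite ler_norml; lra.
Qed.

Lemma driven_by_subdiff_limit : driven_by_subdiff rho gamma phi x k.
Proof.
split=> //.
  split=> [t t0|T T0]; first by apply: subset_closure; exact: Dx.
  exact: phi_curve_integrable.
move=> s t y s0 st cy.
rewrite (phi_curve_integral t s0 cx Dx).
have [Dy|nDy] := pselect (forall r, s <= r <= t -> edom phi (y r)).
  pose y' r := y (Num.max s (Num.min t r)).
  have cl r : s <= r <= t -> Num.max s (Num.min t r) = r.
    by move=> /andP[sr rt]; rewrite min_r// max_r.
  have cy' : continuousRplus y' by exact: continuousRplus_clamp.
  have Dy' r : 0 <= r -> edom phi (y' r).
    by move=> r0; apply: Dy; rewrite le_max lexx ge_max st ge_min lexx.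
  have oc r : r \in `]s, t]%classic -> y' r = y r.
    rewrite inE /= in_itv/= => /andP[sr rt]; rewrite /y' cl// rt ltW//.
  have cc r : r \in `[s, t]%classic -> y' r = y r.
    by rewrite inE /= in_itv/= => srt; rewrite /y' cl.
  have := variational_inequality S cx ck bvk Dx C0 ndE piece s0 st cy' Dy'.
  have -> : vbv_int s t (fun r => y' r - x r) k = vbv_int s t (fun r => y r - x r) k.
    by apply: eq_bigr => i _; congr (_ - _); apply: eq_Rintegral => r /oc ->.
  have -> : stint s t (fun r => enorm (y' r - x r) ^+ 2) (vtv k) =
     \int[dVar k]_(r in `]s, t]) enorm (y r - x r) ^+ 2.
    by rewrite dVarE; apply: eq_Rintegral => r /oc ->.
  have -> : Int s t (fun r => enorm (y' r - x r) ^+ 2) =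
     \int[mu]_(r in `[s, t]) enorm (y r - x r) ^+ 2.
    have lz := rcont_locint (continuousRplus_enorm2 (continuousRplusB cy' cx)).
    by rewrite -(Int_closed t lz s0); apply: eq_Rintegral => r /cc ->.
  have -> : (\int[mu]_(r in `[s, t]) phi (y r))%E = (\int[mu]_(r in `[s, t]) phi (y' r))%E.
    by apply: eq_integral => r /cc ->.
  by rewrite (phi_curve_integral t s0 cy' Dy') -!EFinD lee_fin.
have [r srt nD] : exists2 r, s <= r <= t & ~ edom phi (y r).
  apply: contrapT => hn; apply: nDy => r srt; apply: contrapT => nD.
  by apply: hn; exists r.
(* If s = t, phi(y(s)) may be +oo, but its integral over a single point is 0, as are all other
   terms. *)
move: st; rewrite le_eqVlt => /predU1P[stE|st].
  rewrite -stE set_itv1 integral_set1 Rintegral_set1 set_itvoc0 Rintegral_set0.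
  rewrite !mulr0 addr0 Intxx adde0 add0e lee_fin /vbv_int big1// => i _.
  by rewrite /bv_int set_itvoc0 !Rintegral_set0 subrr.
rewrite (@phi_curve_integral_pinfty y s t r)//; last by exists (x 0); exact: Dx.
by rewrite addye// leey.
Qed.

End SubdifferentialLimit.

Theorem proposition30 (R : realType) (d : nat)
    (rho gamma L delta sigma : R)
    (phi : 'rV[R]_d -> \bar R)
    (x0 : 'rV[R]_d) (m : R -> 'rV[R]_d) (f : R -> 'rV[R]_d -> 'rV[R]_d) :
  0 <= rho -> 0 <= gamma -> 0 <= L -> 0 < delta -> 0 < sigma ->
  (forall v, phi v != -oo%E) ->
  proper_fun phi ->
  lower_semicontinuous phi ->
  semiconvex_fun rho gamma phi ->
  (forall x y, edom phi x -> edom phi y ->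
    (`|phi x - phi y| <= (L + L * enorm (x - y))%:E)%E) ->
  shifted_uniform_interior_ball gamma delta sigma (edom phi) ->
  closure (edom phi) x0 ->
  continuousRplus m -> m 0 = 0 ->
  (forall x i, lebesgue_measurable_fun `[0, +oo[ (fun t => f t x ord0 i)) ->
  (exists2 mu : R -> R, L1loc (EFin \o mu) &
    {ae lebesgue_measure, forall t, 0 <= t ->
      continuous (f t) /\
      (forall x y : 'rV[R]_d,
         dotp (x - y) (f t x - f t y) <= mu t * enorm (x - y) ^+ 2)}) ->
  (forall T : R, 0 <= T ->
    (\int[lebesgue_measure]_(s in `[0%R, T]) fsharp phi f s < +oo)%E) ->
  exists x k : R -> 'rV[R]_d,
    skorohod_solution rho gamma phi x0 f m x k /\
    (forall x' k' : R -> 'rV[R]_d,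
       skorohod_solution rho gamma phi x0 f m x' k' ->
       forall t, 0 <= t -> x' t = x t /\ k' t = k t).
Proof.
move=> rho0 gamma0 L0 delta0 sigma0 phiNy _ phi_lsc phi_sc phi_gr ball_cond.
move=> cl_x0 cm m0 f_meas [nu /L1loc_locint lnu f_prop] f_bound.
have clD := closure_edom phiNy phi_lsc phi_gr L0.
have S := skorohod_data_intro phiNy phi_lsc phi_gr rho0 gamma0 L0 delta0 sigma0
  phi_sc ball_cond.
have Dx0 : edom phi x0 by rewrite -clD.
have f_cont : {ae lebesgue_measure, forall t : R, 0 <= t -> continuous (f t)}.
  by apply: aeS1 f_prop => t h t0; have [] := h t0.
(* A nonnegative coefficient is required in the Gronwall argument, where |x - x'|^2 is replaced by
   its bound Z; hence |nu|. *)
have f_mono : {ae lebesgue_measure, forall t : R, 0 <= t -> forall x y : 'rV[R]_d,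
    dotp (x - y) (f t x - f t y) <= `|nu t| * enorm (x - y) ^+ 2}.
  apply: aeS1 f_prop => t h t0 x y; have [_ h1] := h t0.
  by apply: le_trans (h1 x y) _; rewrite ler_wpM2r ?sqr_ge0// ler_norm.
have cl0 : closure (edom phi) !=set0 by exists x0.
have [g [lg g0 fg]] := vector_field_dominated cl0 f_meas f_cont f_bound.
have f_loc (x : R -> 'rV[R]_d) i : continuousRplus x ->
    (forall t : R, 0 <= t -> closure (edom phi) (x t)) -> locint (fun t => f t (x t) ord0 i).
  exact: (field_curve_locint f_meas f_cont lg fg).
suff [x [k Sxk]] : exists x k, skorohod_solution rho gamma phi x0 f m x k.
  exists x, k; split => // x' k' Sxk'.
  exact: (skorohod_unique rho0 gamma0 lg (locint_norm lnu) (fun t => normr_ge0 (nu t))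
    g0 f_loc fg f_mono m0 Sxk Sxk').
rewrite clD in fg f_loc.
have [x [h [X [M [cx Dx E h_cvg Xx]]]]] :=
  euler_limit S Dx0 lg fg f_meas cm m0.
(* Defined so that the integral equation holds by construction; [euler_push_cvg] identifies it as
   the limit of the discrete pushing terms. *)
pose k t := x0 + vInt 0 t (fun s => f s (x s)) + m t - x t.
have lfx i : locint (fun t => f t (x t) ord0 i) by exact: f_loc.
have vInt0 : vInt 0 0 (fun s => f s (x s)) = 0 by apply/rowP => i; rewrite !mxE Intxx.
have cv : continuousRplus (fun t => vInt 0 t (fun s => f s (x s))).
  apply/continuousRplusP => t t0 e e0; have [r r0 hr] := Int_rcont lg t0 e0.
  exists r => // s s0 st.
  have incr a b : 0 <= a -> a <= b -> enorm (vInt 0 b (fun s => f s (x s)) -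
      vInt 0 a (fun s => f s (x s))) <= Int 0 b g - Int 0 a g.
    move=> a0 ab; rewrite (vInt_split lfx (lexx 0) a0 ab) addrC addKr -(Int_sub lg a0 ab).
    apply: vInt_norm_le => //; apply: aeS1 fg => u hu /andP[au _].
    have u0 : 0 <= u by rewrite (le_trans a0)// ltW.
    by apply: hu => //; exact: Dx.
  have := hr s s0 st; have [st'|ts] := leP s t.
    rewrite enorm_distC; apply: le_lt_trans; apply: le_trans (incr s t s0 st') _.
    by rewrite distrC ler_norm.
  by apply: le_lt_trans; apply: le_trans (incr t s t0 (ltW ts)) _; rewrite ler_norm.
have ck : continuousRplus k.
  have -> : k = fun t => (m t - (0 - vInt 0 t (fun s => f s (x s)))) - (x t - x0).
    by apply/funext => t; rewrite /k; vring.
  apply: continuousRplusB; last exact: (continuousRplusB cx (@continuousRplus_cst R d x0)).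
  exact: (continuousRplusB cm (continuousRplusB (@continuousRplus_cst R d 0) cv)).
have sch n : discrete_scheme rho gamma (edom phi) (fine \o phi) (h n) (X n) (M n).
  by have [] := E n.
have Kk (t e : R) : 0 <= t -> 0 < e -> \forall n \near \oo,
    enorm (pushing (X n) (M n) (Num.truncn (t / h n)) - k t) <= e.
  exact: (euler_push_cvg lg fg f_meas cm f_cont cx Dx E h_cvg Xx).
have Vb (T : R) : 0 <= T -> exists V : R, \forall n \near \oo,
    forall j, j%:R * h n <= T -> push_var (X n) (M n) j <= V.
  move=> T0; have [V V0 [hm hm0 hV]] := euler_variation S x0 lg fg f_meas cm T0.
  exists V; apply: filterS (h_cvg _ hm0) => n hn; exact: hV (E n) hn.
(* Every scheme starts at x0, so uniform convergence at the node of index 0 gives the initial value,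
   and thereby k 0 = 0. *)
have x00 : x 0 = x0.
  apply/subr0_eq/eqP; rewrite -enorm_eq0 eq_le enorm_ge0 andbT.
  apply/ler_addgt0Pr => e e0; rewrite add0r.
  have [n hn] := filter_ex (Xx 0 e e0).
  have := hn 0%N; rewrite mul0r lexx => /(_ isT).
  by have [_ -> _] := E n; rewrite enorm_distC.
have k00 : k 0 = 0 by rewrite /k vInt0 m0 x00; vring.
have bvk := limit_BVloc sch Kk Vb.
have [F ndF piece] := limit_piece S cx Dx sch h_cvg Xx Kk Vb.
exists x, k; split; first by move=> t t0; rewrite vint_vInt// /k; vring.
apply: (driven_by_subdiff_limit phiNy phi_lsc S cx ck bvk k00 Dx _ ndF piece).
clear -rho0 gamma0; apply: mulr_ge0; lra.
Qed.
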